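(* Assume that there exist $m$ processes $Y^i=(Y^i_t)_{0\le t\le T}$, $i=1,\dots,m$, of $\mathcal{S}^2$ such that for every $i\in\mathcal{I}$ and every $t\le T$, $$Y^i_t=\operatorname*{ess\,sup}_{\tau\ge t}E\Big[\int_t^{\tau}\psi_i(s,X_s)\,ds+\max_{j\in\mathcal{I}^{-i}}\big(-g_{ij}(\tau,X_\tau)+Y^j_\tau\big)\mathbf{1}_{[\tau<T]}\,\Big|\,\mathcal{F}_t\Big],\qquad Y^i_T=0,$$ where $\tau$ ranges over the $\mathbf{F}$-stopping times with $t\le\tau\le T$. Then: (i) $Y^1_0=\sup_{(\delta,\xi)\in\mathcal{D}}J(\delta,\xi)$. (ii) Set $\tau_0^*=0$, $\xi_0^*=1$ and define $\delta^*=(\tau_n^* )_{n\ge1}$ and $\xi^*=(\xi_n^* )_{n\ge 1}$ recursively, for $n\ge1$, by $$\tau_n^*=\inf\Big\{s\ge\tau_{n-1}^*:\ Y_s^{\xi_{n-1}^*}=\max_{k\in\mathcal{I}\setminus\{\xi_{n-1}^*\}}\big(-g_{\xi_{n-1}^*k}(s,X_s)+Y^k_s\big)\Big\}\wedge T,$$ and let $\xi_n^*$ be an $\mathcal{F}_{\tau_n^*}$-measurable random variable with values in $\mathcal{I}$, $\xi_n^*\neq \xi_{n-1}^*$, attaining the maximum at time $\tau_n^*$, i.e. $$-g_{\xi^*_{n-1}\xi^*_n}(\tau_n^*,X_{\tau_n^*})+Y^{\xi_n^*}_{\tau_n^*}=\max_{k\in\mathcal{I}\setminus\{\xi_{n-1}^*\}}\big(-g_{\xi_{n-1}^*k}(\tau_n^*,X_{\tau_n^*})+Y^k_{\tau_n^*}\big).$$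 Then the strategy $(\delta^*,\xi^* )$ satisfies $$E\Big[\sum_{k\ge1}g_{\xi_{k-1}^*\xi_k^*}(\tau_k^*,X_{\tau_k^*})\mathbf{1}_{[\tau_k^*<T]}\Big]<+\infty$$ and it is optimal, i.e. $J(\delta^*,\xi^* )\ge J(\delta,\xi)$ for every $(\delta,\xi)\in\mathcal{D}$. (iii) If $$E\Big[\sum_{k\ge1}g_{\xi_k^*\xi_{k-1}^*}(\tau_k^*,X_{\tau_k^*})\mathbf{1}_{[\tau_k^*<T]}\Big]<+\infty$$ (note the order of the indices: cost of switching from $\xi_k^*$ to $\xi_{k-1}^*$), or if the functions $g_{ij}$ are constant, then the optimal strategy $(\delta^*,\xi^* )$ is finite, i.e. $P(\tau_n^*<T\ \text{for all } n\ge1)=0$.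
   Context: $T>0$ is a real number, $k,d\ge1$ and $m\ge2$ are integers, $\mathcal{I}=\{1,\dots,m\}$ and $\mathcal{I}^{-i}=\mathcal{I}\setminus\{i\}$. Data. For $i,j\in\mathcal{I}$, $\psi_i:[0,T]\times\mathbb{R}^k\to\mathbb{R}$ and $g_{ij}:[0,T]\times\mathbb{R}^k\to\mathbb{R}$ are continuous and of polynomial growth: $|\psi_i(t,x)|+|g_{ij}(t,x)|\le C(1+|x|^\gamma)$ for some positive constants $C,\gamma$. For all $(t,x)$: $g_{ii}(t,x)=0$, $g_{ij}(t,x)\ge0$, and $g_{ij}(t,x)+g_{jl}(t,x)>g_{il}(t,x)$ for all $i,j,l\in\mathcal{I}$ with $j\ne i$, $j\neq l$. There is a constant $\alpha>0$ such that $g_{ij}(t,x)+g_{ji}(t,x)>\alpha$ for all $(t,x)$ and all $i\ne j$. Probability space. $(\Omega,\mathcal{F},P)$ carries a standard $d$-dimensional Brownian motion $B=(B_t)_{0\le t\le T}$; $\mathbf{F}=(\mathcal{F}_t)_{0\le t\le T}$ is its natural filtration completed with the $P$-null sets of $\mathcal{F}$. $\mathcal{M}^{2,1}$ is the set of $\mathbf{F}$-progressively measurable real processes $w$ with $E[\int_0^T|w_s|^2ds]<\infty$; $\mathcal{S}^2$ is the set of $\mathbf{F}$-progressively measurable continuous real processes $w$ with $E[\sup_{t\le T}|w_t|^2]<\infty$. $X=(X_t)_{0\le t\le T}$ is an $\mathbf{F}$-progressively measurable, continuous, $\mathbb{R}^k$-valued process, and it is assumed that $(\psi_i(t,X_t))_{t\le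 T}\in\mathcal{M}^{2,1}$ and $(g_{ij}(t,X_t))_{t\le T}\in\mathcal{S}^2$ for all $i,j$. Strategies. $\mathcal{D}$ is the set of pairs $(\delta,\xi)=((\tau_n)_{n\ge1},(\xi_n)_{n\ge1})$, where $(\tau_n)$ is a nondecreasing sequence of $\mathbf{F}$-stopping times with values in $[0,T]$ ($\tau_0=0$), and $\xi_n$ is an $\mathcal{F}_{\tau_n}$-measurable $\mathcal{I}$-valued random variable, the mode to which the system is switched at $\tau_n$ from its current mode to another one (so $\xi_n\ne\xi_{n-1}$ on $[\tau_n<T]$). The initial mode is $\xi_0=1$. The mode indicator is $u_t=\mathbf{1}_{[0,\tau_1]}(t)+\sum_{n\ge1}\xi_n\mathbf{1}_{(\tau_n,\tau_{n+1}]}(t)$, and (convention) $\psi_0:=0$, which only concerns times after $\lim_n\tau_n$ when this limit is $<T$. The expected total profit is $$J(\delta,\xi)=E\Big[\int_0^T\psi_{u_s}(s,X_s)\,ds-\sum_{n\ge1}g_{\xi_{n-1}\xi_n}(\tau_n,X_{\tau_n})\mathbf{1}_{[\tau_n<T]}\Big]\in[-\infty,\infty).$$ *)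

(* Defs.v *)
From HB Require Import structures.
From mathcomp Require Import all_boot all_order all_algebra.
From mathcomp Require Import all_classical all_reals all_analysis.
From mathcomp Require Import measurable_realfun.

Set Implicit Arguments.
Unset Strict Implicit.
Unset Printing Implicit Defensive.
Import Order.TTheory GRing.Theory Num.Theory.
Import numFieldNormedType.Exports.
Local Open Scope classical_set_scope.
Local Open Scope ring_scope.

(* Processes indexed by [0, T] are represented by functions on all of R; no
   definition below looks at times outside [0, T].  A sub-sigma-algebra is a
   set of sets, a filtration a family of those indexed by time. *)

(* Euclidean norm; the library norm on matrices is the sup norm. *)
Definition enorm (R : realType) (k : nat) (x : 'rV[R]_k) : R :=
  Num.sqrt (\sum_(a < k) x ord0 a ^+ 2).

Section Probability.
Context (R : realType) (disp : measure_display) (Omega : measurableType disp).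
Variables (P : probability Omega R) (T : R).

Definition independent (G H : set (set Omega)) : Prop :=
  forall A B, G A -> H B -> P (A `&` B) = (P A * P B)%E.

(* Z is a version of E[X | G], for an integrable X. *)
Definition is_cond_exp (G : set (set Omega)) (X Z : Omega -> \bar R) : Prop :=
  [/\ measurable_fun setT (Z : g_sigma_algebraType G -> \bar R),
      P.-integrable setT Z &
      forall A, G A ->
        (\int[P]_(w in A) Z w = \int[P]_(w in A) X w)%E].

(* Y is the essential supremum of the family S of random variables: the
   a.s. smallest random variable that dominates a.s. each member of S. *)
Definition is_ess_sup (S : set (Omega -> \bar R)) (Y : Omega -> \bar R) :=
  [/\ measurable_fun setT Y,
      forall Z, S Z -> {ae P, forall w, (Z w <= Y w)%E} &
      forall V : Omega -> \bar R, measurable_fun setT V ->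
        (forall Z, S Z -> {ae P, forall w, (Z w <= V w)%E}) ->
        {ae P, forall w, (Y w <= V w)%E}].

Definition past_events (d : nat) (B : R -> Omega -> 'rV[R]_d) (t : R) :
    set (set Omega) :=
  [set A | exists s (a : 'I_d) (U : set R),
     [/\ 0 <= s <= t, measurable U & A = [set w | U (B s w ord0 a)]]].

Definition increment_events (d : nat) (B : R -> Omega -> 'rV[R]_d) (s t : R) :
    set (set Omega) :=
  [set A | exists (a : 'I_d) (U : set R),
     measurable U /\ A = [set w | U (B t w ord0 a - B s w ord0 a)]].

(* Standard d-dimensional Brownian motion on [0, T].  The second parameter of
   normal_prob is the standard deviation; the product formula says that
   B_t - B_s has law N(0, (t - s) I_d). *)
Record brownian_motion (d : nat) (B : R -> Omega -> 'rV[R]_d) : Prop := {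
  bm_measurable : forall t (a : 'I_d), 0 <= t <= T ->
    measurable_fun setT (fun w => B t w ord0 a);
  bm_start : {ae P, forall w, B 0 w = 0};
  bm_continuous : forall w, {within `[0, T], continuous (fun t => B t w)};
  bm_independent : forall s t, 0 <= s -> s < t -> t <= T ->
    independent <<s past_events B s >> <<s increment_events B s t >>;
  bm_gaussian : forall s t, 0 <= s -> s < t -> t <= T ->
    forall U : 'I_d -> set R, (forall a, measurable (U a)) ->
      P [set w | forall a, U a (B t w ord0 a - B s w ord0 a)] =
      (\prod_(a < d) normal_prob 0 (Num.sqrt (t - s)) (U a))%E }.

(* The natural filtration of B completed with the null sets of the ambient
   sigma-algebra, which is itself not assumed to be complete. *)
Definition completed_filtration (d : nat) (B : R -> Omega -> 'rV[R]_d) (t : R) :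
    set (set Omega) :=
  <<s past_events B t `|` [set N | measurable N /\ P N = 0%E] >>.

Section Filtered.
Variable F : R -> set (set Omega).

(* For every t in [0, T], the restriction of w to [0, t] x Omega is measurable
   for B([0, t]) (x) F_t. *)
Definition progressive (w : R -> Omega -> R) : Prop :=
  forall t, 0 <= t <= T ->
    @measurable_fun _ _ (R * g_sigma_algebraType (F t))%type R
      (`[0, t] `*` setT) (fun p => w p.1 p.2).

Definition M2 (w : R -> Omega -> R) : Prop :=
  progressive w /\
  (\int[P]_o \int[lebesgue_measure]_(s in `[0%R, T]) (`|w s o| ^+ 2)%:E < +oo)%E.

Definition S2 (w : R -> Omega -> R) : Prop :=
  [/\ progressive w,
      forall o, {within `[0, T], continuous (fun t => w t o)} &
      (\int[P]_o ereal_sup [set (`|w t o| ^+ 2)%:E | t in `[0%R, T]]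
         < +oo)%E].

(* The Borel sigma-algebra of R^k is generated by the coordinates. *)
Definition progressive_continuous (k : nat) (X : R -> Omega -> 'rV[R]_k) :=
  (forall a : 'I_k, progressive (fun t w => X t w ord0 a)) /\
  (forall w, {within `[0, T], continuous (fun t => X t w)}).

Definition stopping_time (tau : Omega -> R) : Prop :=
  (forall w, 0 <= tau w <= T) /\
  (forall t, 0 <= t <= T -> F t [set w | tau w <= t]).

(* F_tau, for a stopping time tau; since tau <= T, the case t = T says that
   A belongs to F_T. *)
Definition stopped_sigma_algebra (tau : Omega -> R) : set (set Omega) :=
  [set A | forall t, 0 <= t <= T -> F t (A `&` [set w | tau w <= t])].

End Filtered.
End Probability.

Section Switching.
Context (R : realType) (disp : measure_display) (Omega : measurableType disp).
Variables (P : probability Omega R) (T : R).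
Variable F : R -> set (set Omega).
Variables (k m : nat).
(* The modes 1, ..., m are the elements of 'I_m; mode 1 is the ordinal 0. *)
Variable i1 : 'I_m.
Variables (psi : 'I_m -> R -> 'rV[R]_k -> R).
Variables (g : 'I_m -> 'I_m -> R -> 'rV[R]_k -> R).
Variable X : R -> Omega -> 'rV[R]_k.

(* psi and g are only constrained on [0, T] x R^k. *)
Record switching_data : Prop := {
  psi_continuous : forall i,
    {within `[0, T] `*` setT,
      continuous (fun p : R * 'rV[R]_k => psi i p.1 p.2)};
  g_continuous : forall i j,
    {within `[0, T] `*` setT,
      continuous (fun p : R * 'rV[R]_k => g i j p.1 p.2)};
  polynomial_growth : exists C gamma : R, [/\ 0 < C, 0 < gamma &
    forall i j t x, 0 <= t <= T ->
      `|psi i t x| + `|g i j t x| <= C * (1 + enorm x `^ gamma)];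
  g_diag : forall i t x, 0 <= t <= T -> g i i t x = 0;
  g_ge0 : forall i j t x, 0 <= t <= T -> 0 <= g i j t x;
  g_triangle : forall i j l t x, j != i -> j != l -> 0 <= t <= T ->
    g i l t x < g i j t x + g j l t x;
  g_no_free_loop : exists2 alpha : R, 0 < alpha &
    forall i j t x, i != j -> 0 <= t <= T -> alpha < g i j t x + g j i t x }.

(* max_(j != i) (- g_ij(s, X_s) + Y^j_s).  As 1 < m the maximum is over a
   nonempty set, hence finite; -oo is only the neutral element of maxe. *)
Definition obstacle (Y : 'I_m -> R -> Omega -> R) (i : 'I_m) (s : R)
    (w : Omega) : \bar R :=
  \big[maxe/-oo%E]_(j < m | j != i) (- g i j s (X s w) + Y j s w)%:E.

Definition stopping_payoff (Y : 'I_m -> R -> Omega -> R) (i : 'I_m) (t : R)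
    (tau : Omega -> R) (w : Omega) : \bar R :=
  (\int[lebesgue_measure]_(s in `[t, tau w]) (psi i s (X s w))%:E
   + (if (tau w < T)%R then obstacle Y i (tau w) w else 0))%E.

Definition snell_system (Y : 'I_m -> R -> Omega -> R) : Prop :=
  (forall i t, 0 <= t <= T ->
     is_ess_sup P
       [set Z | exists tau : Omega -> R,
          [/\ stopping_time T F tau, forall w, t <= tau w &
              is_cond_exp P (F t) (stopping_payoff Y i t tau) Z]]
       (fun w => (Y i t w)%:E)) /\
  (forall i, {ae P, forall w, Y i T w = 0}).

(* A strategy is given with its index 0 entries tau_0 = 0 and xi_0 = 1. *)
Record strategy (tau : nat -> Omega -> R) (xi : nat -> Omega -> 'I_m) : Prop := {
  strategy_tau0 : forall w, tau 0%N w = 0;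
  strategy_xi0 : forall w, xi 0%N w = i1;
  strategy_stopping : forall n, stopping_time T F (tau n);
  strategy_nondecreasing : forall n w, tau n w <= tau n.+1 w;
  strategy_measurable : forall n i,
    stopped_sigma_algebra T F (tau n.+1) (xi n.+1 @^-1` [set i]);
  strategy_switch : forall n w, tau n.+1 w < T -> xi n.+1 w != xi n w }.

(* The mode indicator u_s: xi_0 on [0, tau_1], xi_n on ]tau_n, tau_(n+1)], and
   None (the value 0 of the sum of indicators) after lim_n tau_n.  For a
   strategy the intervals are disjoint, so the n chosen is the only one. *)
Definition mode_indicator (tau : nat -> Omega -> R) (xi : nat -> Omega -> 'I_m)
    (s : R) (w : Omega) : option 'I_m :=
  if s <= tau 1%N w then Some (xi 0%N w)
  else if pselect (exists n, tau n w < s <= tau n.+1 w) is left ex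
  then Some (xi (ex_minn ex) w) else None.

(* psi extended by the convention psi_0 := 0. *)
Definition running_profit (u : option 'I_m) (s : R) (x : 'rV[R]_k) : R :=
  if u is Some i then psi i s x else 0.

Definition switching_cost (tau : nat -> Omega -> R)
    (xi : nat -> Omega -> 'I_m) (w : Omega) : \bar R :=
  (\sum_(n <oo) if (tau n.+1 w < T)%R
     then (g (xi n w) (xi n.+1 w) (tau n.+1 w) (X (tau n.+1 w) w))%:E
     else 0)%E.

Definition reverse_switching_cost (tau : nat -> Omega -> R)
    (xi : nat -> Omega -> 'I_m) (w : Omega) : \bar R :=
  (\sum_(n <oo) if (tau n.+1 w < T)%R
     then (g (xi n.+1 w) (xi n w) (tau n.+1 w) (X (tau n.+1 w) w))%:E
     else 0)%E.

Definition profit (tau : nat -> Omega -> R) (xi : nat -> Omega -> 'I_m) :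
    \bar R :=
  (\int[P]_w
     (\int[lebesgue_measure]_(s in `[0%R, T])
        (running_profit (mode_indicator tau xi s w) s (X s w))%:E
      - switching_cost tau xi w))%E.

(* The infimum is taken in \bar R, where that of the empty set is +oo. *)
Record optimal_candidate (Y : 'I_m -> R -> Omega -> R)
    (tau : nat -> Omega -> R) (xi : nat -> Omega -> 'I_m) : Prop := {
  candidate_tau0 : forall w, tau 0%N w = 0;
  candidate_xi0 : forall w, xi 0%N w = i1;
  candidate_tauS : forall n w,
    (tau n.+1 w)%:E =
      mine (ereal_inf [set s%:E | s in
              [set s | tau n w <= s <= T /\
                       (Y (xi n w) s w)%:E = obstacle Y (xi n w) s w]])
           T%:E;
  candidate_measurable : forall n i,
    stopped_sigma_algebra T F (tau n.+1) (xi n.+1 @^-1` [set i]);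
  candidate_switch : forall n w, xi n.+1 w != xi n w;
  candidate_argmax : forall n w,
    (- g (xi n w) (xi n.+1 w) (tau n.+1 w) (X (tau n.+1 w) w)
     + Y (xi n.+1 w) (tau n.+1 w) w)%:E =
    obstacle Y (xi n w) (tau n.+1 w) w }.

End Switching.

(* Main.v *)
Require Import Defs.
From HB Require Import structures.
From mathcomp Require Import all_boot all_order all_algebra.
From mathcomp Require Import all_classical all_reals all_analysis.
From mathcomp Require Import measurable_realfun lra.

Set Implicit Arguments.
Unset Strict Implicit.
Unset Printing Implicit Defensive.
Import Order.TTheory GRing.Theory Num.Theory.
Import numFieldNormedType.Exports.
Local Open Scope classical_set_scope.
Local Open Scope ring_scope.

(** The theorem rests on reading the system for the [Y i] as [m] coupled optimal
    stopping problems and on following the current envelope along a strategy.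

    One mode.  Adding the profit accrued since time 0 turns the equation for
    [Y i] into an ordinary stopping problem, with a continuous [envelope i] and a
    [reward i] which collects the best switching gain before the horizon.  The
    conditional expectations under the essential supremum are upward directed,
    since two stopping times can be glued along an event of the past.  So
    ([ess_sup_ge], [ess_sup_near]) the mean of the reward at any later time is at
    most that of the envelope on every event of the past, and some times attain
    the mean of the envelope up to a given error.  These two facts make the
    envelope a supermartingale, and rounding times up to finer and finer grids
    extends this to stopping times ([optional_stopping]).  Nearly optimal times cannot
    stay below the first time at which the envelope meets the reward, so up to
    that contact time the envelope is a martingale ([snell_martingale]).

    One strategy.  [value n] is the profit accrued up to the [n]-th switch, less
    the costs paid, plus the [Y] of the current mode.  Between switches it
    follows the envelope of the current mode, and at a switch it loses the
    difference between [Y] and the switching gain, which is not negative; so its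
    means do not increase ([value_le]) and start at the mean of [Y i1 0].  If the
    expected cost is infinite, the profit is minus infinity.  Otherwise almost
    every path switches finitely often: infinitely many switches would accumulate
    at some time, at which finite total cost would force a closed loop of free
    switches, against the triangle inequality and the positive cost of going to a
    mode and back ([infinitely_many_switches_cost]).  Then [value n] becomes the
    profit of the path once the switching stops, and its mean converges to the
    profit of the strategy ([value_cvg_profit]).  This gives the upper bound
    ([profit_le]).

    The candidate.  It switches at contact times to modes attaining the maximum,
    so nothing is lost between or at switches and the means of [value n] are
    constant ([candidate_value]).  This bounds the expected cost, and by the
    preceding paragraph the candidate switches finitely often and its profit is
    the mean of [Y i1 0] ([optimal_value]).  Contact times are stopping times
    because a contact by time [t] is detected by the values of the processes at
    countably many times up to [t] ([first_contact_leP]); so a candidate exists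
    ([candidate_exists]) and the upper bound is attained.  Finally [Y i1 0] is
    almost surely equal to its mean, since the Brownian motion starts at a fixed
    point and the initial sigma-algebra is therefore trivial. *)

(** * Random times and uniform grids *)

Section RandomTimes.
Context {R : realType}.

Lemma within_continuous_cvg (a b : R) (f : R -> R) (u : nat -> R) (l : R) :
  {within `[a, b], continuous f} -> (forall n, a <= u n <= b) ->
  a <= l <= b -> u @ \oo --> l -> f (u n) @[n --> \oo] --> f l.
Proof.
move=> /subspace_continuousP cf ub lb ul.
apply: cvg_trans (cf l _); last by rewrite /= in_itv.
move=> A; rewrite /nbhs/= /within/= => -[e /= e0 eA].
have /cvgrPdist_lt/(_ _ e0) [N _ HN] := ul.
exists N => // n Nn /=; apply: eA; last by rewrite /= in_itv/=.
exact: HN.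
Qed.

Lemma nneseries_lty_cvg0 (u : nat -> R) : (forall n, 0 <= u n) ->
  (\sum_(n <oo) (u n)%:E < +oo)%E -> u @ \oo --> 0.
Proof.
move=> u0 Su; apply: cvg_series_cvg_0; apply: nondecreasing_is_cvgn.
  by apply: nondecreasing_series.
exists (fine (\sum_(n <oo) (u n)%:E)%E) => _ [n _ <-].
have S0 : (0 <= \sum_(n <oo) (u n)%:E)%E.
  by apply: nneseries_ge0 => k _ _; rewrite lee_fin.
rewrite -lee_fin fineK ?ge0_fin_numE//.
rewrite /series/= -sumEFin; apply: nneseries_lim_ge => k _ _.
by rewrite lee_fin.
Qed.

(** Random times are rounded up to the grid, never down: the event that the
    rounded time is the [k]-th grid point is then known at that grid point, and
    the rounded time is again a stopping time. *)
Definition grid (c : R) (N k : nat) : R := c * (k%:R / N.+1%:R).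
Definition grid_index (c : R) (N : nat) (s : R) : nat :=
  find (fun k => s <= grid c N k) (iota 0 N.+1).
Definition grid_up (c : R) (N : nat) (s : R) : R := grid c N (grid_index c N s).

Lemma grid0 (c : R) N : grid c N 0 = 0.
Proof. by rewrite /grid mul0r mulr0. Qed.

Lemma gridS (c : R) N : grid c N N.+1 = c.
Proof. by rewrite /grid divff ?mulr1. Qed.

Lemma le_grid (c : R) N j k : 0 <= c -> (j <= k)%N -> grid c N j <= grid c N k.
Proof. by move=> c0 jk; rewrite /grid ler_wpM2l// ler_wpM2r// ler_nat. Qed.

Lemma grid_itv (c : R) N k : 0 <= c -> (k <= N.+1)%N -> 0 <= grid c N k <= c.
Proof.
move=> c0 kN; apply/andP; split.
  by rewrite -[leLHS](grid0 c N) le_grid.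
by rewrite -[leRHS](gridS c N) le_grid.
Qed.

Lemma grid_index_le (c : R) N s : (grid_index c N s <= N.+1)%N.
Proof. by rewrite (leq_trans (find_size _ _))// size_iota. Qed.

Lemma grid_up_ge (c : R) N s : s <= c -> s <= grid_up c N s.
Proof.
move=> sc; rewrite /grid_up; have := grid_index_le c N s.
rewrite leq_eqVlt => /orP[/eqP ->|]; first by rewrite gridS.
rewrite /grid_index -[X in (_ < X)%N](size_iota 0) -has_find => h.
by have := nth_find 0%N h; rewrite nth_iota// -[X in (_ < X)%N](size_iota 0) -has_find.
Qed.

Lemma lt_grid (c : R) N s k : 0 <= c -> s <= c -> (k <= N)%N ->
  (grid c N k < s) = (k < grid_index c N s)%N.
Proof.
move=> c0 sc kN; apply/idP/idP => [ks|kg].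
  rewrite ltnNge; apply/negP => gk; move: ks; rewrite ltNge => /negP; apply.
  exact: le_trans (grid_up_ge N sc) (le_grid N c0 gk).
have := before_find 0%N kg; rewrite nth_iota ?ltnS// add0n => /negbT.
by rewrite -ltNge.
Qed.

Lemma grid_index_leE (c : R) N s k : 0 <= c -> s <= c -> (k <= N.+1)%N ->
  (s <= grid c N k) = (grid_index c N s <= k)%N.
Proof.
move=> c0 sc; rewrite leq_eqVlt => /orP[/eqP ->|kN].
  by rewrite gridS sc grid_index_le.
by rewrite leNgt lt_grid// -leqNgt.
Qed.

Lemma grid_up_itv (c : R) N s : 0 <= c -> 0 <= grid_up c N s <= c.
Proof. by move=> c0; apply: grid_itv => //; exact: grid_index_le. Qed.

Lemma le_grid_up (c : R) N s t : 0 <= c -> s <= t -> t <= c ->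
  grid_up c N s <= grid_up c N t.
Proof.
move=> c0 st tc; apply: le_grid => //; rewrite leqNgt; apply/negP => gts.
have := st; rewrite leNgt => /negP; apply.
apply: le_lt_trans (grid_up_ge N tc) _.
rewrite lt_grid//; first exact: le_trans st tc.
by rewrite -ltnS (leq_trans gts)// grid_index_le.
Qed.

Lemma grid_up_near (c : R) N s : 0 <= s <= c -> grid_up c N s <= s + c / N.+1%:R.
Proof.
move=> /andP[s0 sc]; have c0 := le_trans s0 sc.
rewrite /grid_up; case E : (grid_index c N s) => [|k].
  by rewrite grid0 addr_ge0// divr_ge0.
have -> : grid c N k.+1 = grid c N k + c / N.+1%:R.
  by rewrite /grid -addn1 natrD mulrDl mulrDr mul1r.
rewrite lerD2r ltW// lt_grid// ?E//.
by rewrite -ltnS -E grid_index_le.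
Qed.

Lemma cvg_grid_up (c : R) s : 0 <= s <= c -> grid_up c N s @[N --> \oo] --> s.
Proof.
move=> scb; have /andP[s0 sc] := scb.
apply: (@squeeze_cvgr _ _ _ _ (fun=> s) (fun N => s + c / N.+1%:R)).
- by apply: nearW => N; rewrite grid_up_ge//= grid_up_near.
- exact: cvg_cst.
- rewrite -[X in _ --> X]addr0; apply: cvgD; first exact: cvg_cst.
  rewrite -[X in _ --> X](mulr0 c); apply: cvgM; first exact: cvg_cst.
  exact: cvg_harmonic.
Qed.

(** The increment over a grid interval contributes exactly when the left end of
    the interval lies before [s].  For a random [s] that event is known at the
    left end, so that statements about random times reduce to increments over
    deterministic intervals. *)
Lemma grid_telescope (f : R -> R) c N s : 0 <= s <= c ->
  f (grid_up c N s) =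
  f 0 + \sum_(k < N.+1) (if grid c N k < s
                         then f (grid c N k.+1) - f (grid c N k) else 0).
Proof.
move=> /andP[s0 sc]; have c0 := le_trans s0 sc.
rewrite -big_mkcond/= /grid_up.
have -> : \sum_(k < N.+1 | grid c N k < s) (f (grid c N k.+1) - f (grid c N k)) =
  \sum_(0 <= k < grid_index c N s) (f (grid c N k.+1) - f (grid c N k)).
  rewrite [RHS](big_nat_widen _ _ N.+1) ?grid_index_le// big_mkord.
  by apply: eq_bigl => k; rewrite lt_grid// -ltnS.
by rewrite telescope_sumr// grid0 addrC subrK.
Qed.

Lemma measurable_fun_seq_limit d (W : measurableType d) (h : nat -> W -> R)
    (f : W -> R) : (forall n, measurable_fun setT (h n)) ->
  (forall w, h n w @[n --> \oo] --> f w) -> measurable_fun setT f.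
Proof. by move=> mh hf; exact: (measurable_fun_cvg mh (fun w _ => hf w)). Qed.

(** A continuous process at a random time is the limit of its values at the
    times rounded up to grids, each of which involves finitely many of the
    variables of the process. *)
Lemma measurable_at_random_time d (W : measurableType d) (c : R)
    (Z : R -> W -> R) (rho : W -> R) :
  (forall s, 0 <= s <= c -> measurable_fun setT (Z s)) ->
  (forall w, {within `[0, c], continuous (Z^~ w)}) ->
  (forall w, 0 <= rho w <= c) -> measurable_fun setT rho ->
  measurable_fun setT (fun w => Z (rho w) w).
Proof.
move=> mZ cZ rhoc mrho.
have [[w0 _]|] := pselect (exists w : W, True); last first.
  move=> nW _ U mU; rewrite (_ : _ `&` _ = set0)//.
  by apply/seteqP; split=> // w; exfalso; apply: nW; exists w.
have c0 : 0 <= c by have /andP[h1 h2] := rhoc w0; exact: le_trans h1 h2.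
apply: (@measurable_fun_seq_limit _ _ (fun N w => Z (grid_up c N (rho w)) w)).
  move=> N; rewrite (_ : (fun _ => _) = fun w => Z 0 w + \sum_(k < N.+1)
     (if grid c N k < rho w then Z (grid c N k.+1) w - Z (grid c N k) w else 0)); last first.
    by apply/funext => w; rewrite (grid_telescope (Z^~ w)).
  apply: measurable_funD; first by apply: mZ; rewrite lexx c0.
  apply: measurable_sum => k; apply: measurable_fun_ifT => //.
    exact: measurable_fun_ltr.
  by apply: measurable_funB; apply: mZ; apply: grid_itv => //; rewrite ltnW// ltnS.
move=> w; apply: (within_continuous_cvg (cZ w)) => //.
- by move=> N; exact: grid_up_itv.
- exact: cvg_grid_up.
Qed.

End RandomTimes.

(** * Expectations of real random variables *)

Section Expectation.
Context {R : realType} {disp : measure_display} {Omega : measurableType disp}.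
Variable P : probability Omega R.
Implicit Types (A : set Omega) (f g U : Omega -> R).

Definition summable_rv (f : Omega -> R) : Prop := P.-integrable setT (EFin \o f).

Definition expect (A : set Omega) (f : Omega -> R) : R := (\int[P]_(w in A) f w)%R.

Lemma summable_measurable f : summable_rv f -> measurable_fun setT f.
Proof. by move=> /measurable_int/measurable_EFinP. Qed.

Lemma summable_rvS f A : measurable A -> summable_rv f ->
  P.-integrable A (EFin \o f).
Proof. by move=> mA; apply: integrableS. Qed.

Lemma summable_rv_ae_le f g : measurable_fun setT f -> summable_rv g ->
  {ae P, forall w, `|f w| <= g w} -> summable_rv f.
Proof.
move=> mf ig fg; apply/integrableP; split; first exact/measurable_EFinP.
have [mg ig'] := integrableP _ _ _ ig; apply: le_lt_trans ig'.
apply: ae_ge0_le_integral => //.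
- by apply/measurable_EFinP; exact: measurableT_comp.
- exact: measurableT_comp mg.
- by apply: filterS fg => w h _ /=; rewrite lee_fin (le_trans h)// ler_norm.
Qed.

Lemma summable_rv_le f g : measurable_fun setT f -> summable_rv g ->
  (forall w, `|f w| <= g w) -> summable_rv f.
Proof. by move=> mf ig fg; apply: summable_rv_ae_le mf ig (aeW _ fg). Qed.

Lemma integrable_ae_fine (Z : Omega -> \bar R) : P.-integrable setT Z ->
  {ae P, forall w, Z w = (fine (Z w))%:E}.
Proof.
move=> iZ; have := integrable_ae measurableT iZ.
by apply: filterS => w /(_ I) h; rewrite fineK.
Qed.

Lemma summable_rv_fine (Z : Omega -> \bar R) : P.-integrable setT Z ->
  summable_rv (fun w => fine (Z w)).
Proof.
move=> iZ; have [mZ fZ] := integrableP _ _ _ iZ.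
have mf : measurable_fun setT (fun w => (fine (Z w))%:E).
  by apply/measurable_EFinP; exact: (measurableT_comp (fine_measurable measurableT) mZ).
apply/integrableP; split=> //.
rewrite (ae_eq_integral (fun w => `|Z w|)%E)//.
- exact: measurableT_comp.
- exact: measurableT_comp.
- by apply: filterS (integrable_ae_fine iZ) => w h _; rewrite [in RHS]h.
Qed.

Lemma summable_rvD f g : summable_rv f -> summable_rv g -> summable_rv (f \+ g).
Proof. by move=> hf hg; exact: (integrableD measurableT hf hg). Qed.

Lemma summable_rvB f g : summable_rv f -> summable_rv g -> summable_rv (f \- g).
Proof. by move=> hf hg; exact: (integrableB measurableT hf hg). Qed.

Lemma summable_rv_norm f : summable_rv f -> summable_rv (fun w => `|f w|).
Proof. by move=> sf; exact: (integrable_norm sf). Qed.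

Lemma summable_rv_cst (c : R) : summable_rv (cst c).
Proof. exact: finite_measure_integrable_cst. Qed.

Lemma summable_rv_sum (I : Type) (r : seq I) (f : I -> Omega -> R) :
  (forall i, summable_rv (f i)) -> summable_rv (fun w => \sum_(i <- r) f i w).
Proof.
move=> hf; rewrite /summable_rv (_ : _ \o _ = fun w => \sum_(i <- r) (f i w)%:E)%E.
  by apply: integrable_sum => // i _; exact: hf.
by apply/funext => w /=; rewrite sumEFin.
Qed.

Lemma summable_rv_indic A f : measurable A -> summable_rv f ->
  summable_rv (f \_ A).
Proof.
move=> mA hf; apply: (@summable_rv_le _ (fun w => `|f w|)).
- apply/(measurable_restrictT _ mA); apply: measurable_funS (summable_measurable hf) => //.
- exact: summable_rv_norm.
- by move=> w; rewrite patchE; case: ifP => //; rewrite normr0.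
Qed.

Lemma expectD A f g : measurable A -> summable_rv f -> summable_rv g ->
  expect A (f \+ g) = expect A f + expect A g.
Proof. by move=> mA hf hg; apply: RintegralD => //; exact: summable_rvS. Qed.

Lemma expectB A f g : measurable A -> summable_rv f -> summable_rv g ->
  expect A (f \- g) = expect A f - expect A g.
Proof. by move=> mA hf hg; apply: RintegralB => //; exact: summable_rvS. Qed.

Lemma expect_sum A (I : Type) (r : seq I) (f : I -> Omega -> R) :
  measurable A -> (forall i, summable_rv (f i)) ->
  expect A (fun w => \sum_(i <- r) f i w) = \sum_(i <- r) expect A (f i).
Proof.
move=> mA hf; elim: r => [|i r IH].
  rewrite big_nil (_ : (fun _ => _) = cst 0).
    by rewrite /expect/= Rintegral_cst// mul0r.
  by apply/funext => w; rewrite big_nil.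
rewrite big_cons -IH -expectD//; last exact: summable_rv_sum.
by congr expect; apply/funext => w; rewrite big_cons.
Qed.

Lemma expectE A f : measurable A -> summable_rv f ->
  (expect A f)%:E = (\int[P]_(w in A) (f w)%:E)%E.
Proof. by move=> mA hf; rewrite /expect /Rintegral fineK// integrable_fin_num//; exact: summable_rvS. Qed.

Lemma expect_mkcond A f : expect A f = expect setT (f \_ A).
Proof. exact: Rintegral_mkcond. Qed.

Lemma expect_mkcondr A B f : expect (A `&` B) f = expect A (f \_ B).
Proof. exact: Rintegral_mkcondr. Qed.

Lemma ae_le_expect A f g : measurable A -> summable_rv f -> summable_rv g ->
  {ae P, forall w, A w -> f w <= g w} -> expect A f <= expect A g.
Proof.
move=> mA hf hg fg; have hgB := summable_rvB hg hf.
rewrite -subr_ge0 -expectB// -lee_fin expectE//.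
rewrite (ae_eq_integral (fun w => (`|g w - f w|)%:E))//.
- by apply: integral_ge0 => w _; rewrite lee_fin.
- exact/measurable_int/(summable_rvS mA hgB).
- exact/measurable_int/(integrable_norm (summable_rvS mA hgB)).
- by apply: filterS fg => w h Aw; rewrite /= ger0_norm// subr_ge0 h.
Qed.

Lemma le_expect A f g : measurable A -> summable_rv f -> summable_rv g ->
  (forall w, A w -> f w <= g w) -> expect A f <= expect A g.
Proof. by move=> mA hf hg fg; apply: ae_le_expect => //; exact: aeW. Qed.

Lemma ae_eq_expect A f g : measurable A -> summable_rv f -> summable_rv g ->
  {ae P, forall w, A w -> f w = g w} -> expect A f = expect A g.
Proof.
move=> mA hf hg fg; apply/eqP; rewrite eq_le.
by apply/andP; split; apply: ae_le_expect => //; apply: filterS fg => w h /h ->.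
Qed.

Lemma eq_expect A f g : (forall w, A w -> f w = g w) -> expect A f = expect A g.
Proof. by move=> fg; apply: eq_Rintegral => w; rewrite inE => /fg. Qed.

Lemma expect_setID A f : measurable A -> summable_rv f ->
  expect setT f = expect A f + expect (~` A) f.
Proof.
move=> mA hf; rewrite -(setUv A) [in LHS]/expect Rintegral_setU ?setUv//.
- exact: measurableC.
- by apply/disj_setPRL.
Qed.

Lemma expect_partition (I : finType) A (B : I -> set Omega) f :
  measurable A -> (forall i, measurable (B i)) ->
  (forall w, A w -> exists2 i, B i w & forall j, B j w -> j = i) ->
  summable_rv f -> expect A f = \sum_i expect (A `&` B i) f.
Proof.
move=> mA mB pB hf; under eq_bigr do rewrite expect_mkcondr.
rewrite -expect_sum//; last by move=> i; exact: summable_rv_indic.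
apply: eq_expect => w /pB[i Bi uB]; rewrite (bigD1 i)//= patchE mem_set//.
rewrite big1 ?addr0// => j ji; rewrite patchE ifF//; apply/negP; rewrite inE.
by move=> /uB ji'; rewrite ji' eqxx in ji.
Qed.

Lemma cvg_expect A (f : nat -> Omega -> R) g U : measurable A ->
  (forall n, measurable_fun setT (f n)) -> summable_rv g -> summable_rv U ->
  {ae P, forall w, A w -> f n w @[n --> \oo] --> g w} ->
  (forall n, {ae P, forall w, `|f n w| <= U w}) ->
  expect A (f n) @[n --> \oo] --> expect A g.
Proof.
move=> mA mf hg hU fg fU.
have hf n : summable_rv (f n) by exact: summable_rv_ae_le (mf n) hU (fU n).
have := @dominated_convergence _ _ _ P A mA (fun n => EFin \o f n) (EFin \o g)
  (EFin \o U).
case.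
- by move=> n; apply/measurable_int/(summable_rvS mA (hf n)).
- exact/measurable_int/(summable_rvS mA hg).
- by apply: filterS fg => w h Aw; apply: cvg_EFin (h Aw); exact: nearW.
- exact: summable_rvS.
- by apply: filterS (ae_foralln fU) => w h n _; rewrite /= lee_fin.
move=> _ _ cv; rewrite /expect /Rintegral; apply: (@fine_cvg R nat \oo).
rewrite fineK//; first by rewrite integrable_fin_num//; exact: summable_rvS.
Qed.

(** The means of [`|f n|] are summable, so the sum of the [`|f n|] is integrable,
    hence finite almost everywhere. *)
Lemma ae_cvg0_geometric (f : nat -> Omega -> R) :
  (forall n, summable_rv (f n)) ->
  (forall n, expect setT (fun w => `|f n w|) <= 2^-1 ^+ n) ->
  {ae P, forall w, f n w @[n --> \oo] --> (0 : R)}.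
Proof.
move=> sf fn.
have snf n : summable_rv (fun w => `|f n w|) by exact: summable_rv_norm.
pose S (w : Omega) := (\sum_(n <oo) (`|f n w|)%:E)%E.
have mS : measurable_fun setT S.
  apply: (@ge0_emeasurable_sum _ _ _ setT (fun n w => (`|f n w|)%:E) predT) => //.
  move=> n _.
  exact: measurable_int (snf n).
have iS : P.-integrable setT S.
  apply/integrableP; split=> //.
  under eq_integral do rewrite gee0_abs ?nneseries_ge0//.
  rewrite integral_nneseries//; last by move=> n; exact: measurable_int (snf n).
  apply: (@le_lt_trans _ _ (\sum_(n <oo) (2 / (2 ^ (n + 1))%:R)%:E)%E).
    apply: lee_nneseries => [n _ _|n _]; first exact: integral_ge0.
    rewrite -expectE// lee_fin (le_trans (fn n))//.
    by rewrite addn1 expnS natrM invfM mulrA divff// mul1r natrX exprVn.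
  have /cvg_lim h2 := @cvg_geometric_eseries_half R 2 0.
  by rewrite [X in (X < _)%E]h2// ltry.
have := integrable_ae measurableT iS; apply: filterS => w /(_ I) Sfin.
apply: norm_cvg0; apply: nneseries_lty_cvg0 => //.
by rewrite -ge0_fin_numE// nneseries_ge0// => k _ _; rewrite lee_fin.
Qed.

Lemma expect_le0_ae0 f : summable_rv f -> (forall w, 0 <= f w) ->
  expect setT f <= 0 -> {ae P, forall w, f w = 0}.
Proof.
move=> sf f0 ef; have mf := measurable_int _ sf.
have : (\int[P]_(w in setT) `|(EFin \o f) w| = 0)%E.
  apply/eqP; rewrite eq_le integral_ge0// andbT.
  under eq_integral do rewrite /= ger0_norm//.
  by rewrite -expectE// lee_fin.
move=> /(ae_eq_integral_abs _ measurableT mf); apply: filterS => w /(_ I).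
by move=> /= [].
Qed.

End Expectation.

(** * Filtrations and stopping times *)

(** A stopping time is only known through its sublevel sets at levels of the
    time interval; the other sublevel sets are trivial. *)
Lemma measurable_fun_sublevel (R : realType) d (W : measurableType d) (c : R)
    (f : W -> R) : (forall w, 0 <= f w <= c) ->
  (forall t, 0 <= t <= c -> measurable [set w | f w <= t]) ->
  measurable_fun setT f.
Proof.
move=> fc mf; apply: (measurability _ (RGenOInfty.measurableE R)) => //.
move=> _ [_ [x ->] <-]; rewrite setTI.
have [x0|x0] := ltP x 0.
  rewrite (_ : _ @^-1` _ = setT); first exact: measurableT.
  apply/seteqP; split=> // w _ /=; rewrite in_itv/= andbT.
  by apply: lt_le_trans x0 _; case/andP: (fc w).
have [xc|cx] := leP x c; last first.
  rewrite (_ : _ @^-1` _ = set0); first exact: measurable0.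
  apply/seteqP; split=> // w /=; rewrite in_itv/= andbT ltNge.
  by move=> /negP; apply; apply: le_trans (ltW cx); case/andP: (fc w).
rewrite (_ : _ @^-1` _ = ~` [set w | f w <= x]).
  by apply: measurableC; apply: mf; rewrite x0.
by apply/seteqP; split=> w /=; rewrite in_itv/= andbT ltNge => /negP.
Qed.

Section Filtration.
Context {R : realType} {disp : measure_display} {Omega : measurableType disp}.
Variables (T : R) (F : R -> set (set Omega)).
Implicit Types (s t e : R) (sigma tau : Omega -> R) (A : set Omega).

(** The events are measurable up to the horizon only, as the process that
    generates them may fail to be measurable at later times. *)
Record filtration : Prop := {
  filtration_sigma : forall t, sigma_algebra setT (F t);
  filtration_le : forall s t, s <= t -> F s `<=` F t;
  filtration_measurable : forall t, t <= T -> F t `<=` measurable }.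

Hypothesis HF : filtration.

Lemma filtrationE t :
  F t = (measurable : set (set (g_sigma_algebraType (F t)))).
Proof. by rewrite -[LHS](sigma_algebra_id (filtration_sigma HF t)). Qed.

Lemma filtration_setT t : F t setT.
Proof. by rewrite filtrationE; exact: measurableT. Qed.

Lemma filtration_set0 t : F t set0.
Proof. by rewrite filtrationE; exact: measurable0. Qed.

Lemma filtration_setI t A B : F t A -> F t B -> F t (A `&` B).
Proof. rewrite filtrationE; exact: measurableI. Qed.

Lemma filtration_setU t A B : F t A -> F t B -> F t (A `|` B).
Proof. rewrite filtrationE; exact: measurableU. Qed.

Lemma filtration_setC t A : F t A -> F t (~` A).
Proof. rewrite filtrationE; exact: measurableC. Qed.

Lemma filtration_setD t A B : F t A -> F t B -> F t (A `\` B).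
Proof. rewrite filtrationE; exact: measurableD. Qed.

Lemma filtration_bigcup t (A : nat -> set Omega) :
  (forall n, F t (A n)) -> F t (\bigcup_n A n).
Proof. by rewrite filtrationE => h; exact: bigcupT_measurable. Qed.

Lemma filtration_bigcap t (A : nat -> set Omega) :
  (forall n, F t (A n)) -> F t (\bigcap_n A n).
Proof. by rewrite filtrationE => h; exact: bigcapT_measurable. Qed.

Lemma filtration_fin_bigcup t (I : finType) (A : I -> set Omega) :
  (forall i, F t (A i)) -> F t (\bigcup_i A i).
Proof.
by rewrite filtrationE => h; apply: fin_bigcup_measurable => //; exact: finite_finset.
Qed.

Lemma measurable_filtration t (f : Omega -> R) : t <= T ->
  measurable_fun setT (f : g_sigma_algebraType (F t) -> R) ->
  measurable_fun setT f.
Proof.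
move=> tT mf _ Y mY; apply: (filtration_measurable HF tT).
by rewrite filtrationE; exact: mf.
Qed.

Lemma adapted_le s t (f : Omega -> R) : s <= t ->
  measurable_fun setT (f : g_sigma_algebraType (F s) -> R) ->
  measurable_fun setT (f : g_sigma_algebraType (F t) -> R).
Proof.
move=> st mf _ Y mY; rewrite -filtrationE; apply: (filtration_le HF st).
by rewrite filtrationE; exact: mf.
Qed.

Local Notation stopping := (stopping_time T F).
Local Notation stopped := (stopped_sigma_algebra T F).

Lemma stopping_itv tau w : stopping tau -> 0 <= tau w <= T.
Proof. by case. Qed.

Lemma stopping_le tau t : stopping tau -> 0 <= t <= T -> F t [set w | tau w <= t].
Proof. by case=> _; apply. Qed.

Lemma stopping_gt tau t : stopping tau -> 0 <= t <= T -> F t [set w | t < tau w].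
Proof.
move=> h ht; rewrite (_ : [set _ | _] = ~` [set w | tau w <= t]).
  exact/filtration_setC/stopping_le.
by apply/seteqP; split=> w /=; rewrite ltNge => /negP.
Qed.

Lemma stopping_measurable tau : stopping tau -> measurable_fun setT tau.
Proof.
move=> h; apply: (measurable_fun_sublevel (c := T)) => [w|t tT].
  exact: stopping_itv.
by case/andP: (tT) => _ /(filtration_measurable HF); apply; exact: stopping_le.
Qed.

Lemma stopping_cst t : 0 <= t <= T -> stopping (cst t).
Proof.
move=> tT; split=> [//|s sT]; have [ts|st] := leP t s.
  by rewrite (_ : [set _ | _] = setT); [exact: filtration_setT|apply/seteqP; split].
rewrite (_ : [set _ | _] = set0); first exact: filtration_set0.
by apply/seteqP; split=> w //=; rewrite leNgt st.
Qed.

Lemma stopping_min sigma tau : stopping sigma -> stopping tau ->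
  stopping (fun w => Num.min (sigma w) (tau w)).
Proof.
move=> hs ht; split=> [w|t tT].
  have /andP[s0 sT] := stopping_itv w hs; have /andP[t0 _] := stopping_itv w ht.
  by rewrite le_min s0 t0 ge_min sT.
rewrite (_ : [set _ | _] = [set w | sigma w <= t] `|` [set w | tau w <= t]).
  by apply: filtration_setU; exact: stopping_le.
by apply/seteqP; split=> w /=; rewrite ge_min => /orP.
Qed.

(** On the event that [tau] is at most [t], a process at time [tau] is the process
    at this capped time; its measurability with respect to [F t] thus becomes a
    question about random times on one measurable space. *)
Lemma stopping_capped_measurable tau t : stopping tau -> 0 <= t <= T ->
  measurable_fun setT
    ((fun w => Num.min (tau w) t) : g_sigma_algebraType (F t) -> R).
Proof.
move=> h /andP[t0 tT]; apply: (measurable_fun_sublevel (c := t)) => [w|s /andP[s0 st]].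
  by have /andP[tau0 _] := stopping_itv w h; rewrite le_min ge_min lexx tau0 t0 orbT.
rewrite -filtrationE; move: st; rewrite le_eqVlt => /orP[/eqP ->|st].
  rewrite (_ : [set _ | _] = setT); first exact: filtration_setT.
  by apply/seteqP; split=> // w _ /=; rewrite ge_min lexx orbT.
apply: (filtration_le HF (ltW st)).
rewrite (_ : [set _ | _] = [set w | tau w <= s]).
  by apply: stopping_le => //; rewrite s0 (le_trans (ltW st)).
by apply/seteqP; split=> w /=; rewrite ge_min [t <= s]leNgt st orbF.
Qed.

Lemma stopped_measurable tau A : 0 <= T -> stopping tau -> stopped tau A ->
  F T A.
Proof.
move=> T0 h hA; rewrite (_ : A = A `&` [set w | tau w <= T]).
  by apply: hA; rewrite T0 lexx.
by apply/seteqP; split=> [w Aw|w []//]; split=> //; case/andP: (stopping_itv w h).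
Qed.

Lemma stopped_le sigma tau A : stopping tau -> (forall w, sigma w <= tau w) ->
  stopped sigma A -> stopped tau A.
Proof.
move=> ht st hA t tT; rewrite (_ : _ `&` _ = (A `&` [set w | sigma w <= t]) `&`
  [set w | tau w <= t]).
  by apply: filtration_setI; [exact: hA|exact: stopping_le].
apply/seteqP; split=> w /=; first by move=> [Aw h]; split=> //; split=> //; exact: le_trans h.
by case=> -[].
Qed.

Lemma stopped_setC tau A : stopping tau -> stopped tau A -> stopped tau (~` A).
Proof.
move=> ht hA t tT.
rewrite (_ : _ `&` _ = [set w | tau w <= t] `\` (A `&` [set w | tau w <= t])).
  by apply: filtration_setD; [exact: stopping_le|exact: hA].
apply/seteqP; split=> w /=; first by move=> [nA tt]; split=> // -[].
by move=> [tt nA]; split=> // Aw; apply: nA.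
Qed.

Lemma stopped_setT tau : stopping tau -> stopped tau setT.
Proof. by move=> ht t tT; rewrite setTI; exact: stopping_le. Qed.

Lemma stopped_preimage_cst tau (I : Type) (c : I) (B : set I) : stopping tau ->
  stopped tau (cst c @^-1` B).
Proof.
move=> ht; rewrite preimage_cst; case: ifP => _; first exact: stopped_setT.
by move=> t _; rewrite set0I; exact: filtration_set0.
Qed.

Lemma stopping_grid_up tau N : 0 <= T -> stopping tau ->
  stopping (fun w => grid_up T N (tau w)).
Proof.
move=> T0 h; split=> [w|t tT]; first exact: grid_up_itv.
rewrite (_ : [set _ | _] = \bigcup_(j : 'I_N.+2)
   (if grid T N j <= t then [set w | tau w <= grid T N j] else set0)).
  apply: filtration_fin_bigcup => j; case: ifP => [jt|_]; last exact: filtration_set0.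
  apply: (filtration_le HF jt); apply: stopping_le => //.
  by apply: grid_itv => //; rewrite -ltnS.
apply/seteqP; split=> w /=.
  move=> h1; exists (Ordinal (grid_index_le T N (tau w) : (_ < N.+2)%N)) => //=.
  by rewrite -[grid _ _ _]/(grid_up T N (tau w)) h1 /= grid_up_ge//;
    case/andP: (stopping_itv w h).
move=> [j _]; case: ifP => //= jt tj; apply: le_trans jt.
have jN : (j <= N.+1)%N by rewrite -ltnS.
have /andP[_ jT] := grid_itv T0 jN.
apply: le_trans (le_grid_up N T0 tj jT) _.
apply: le_grid => //; rewrite leqNgt; apply/negP => jg.
have jN' : (j <= N)%N by rewrite -ltnS (leq_trans jg)// grid_index_le.
by move: jg; rewrite -lt_grid// ltxx.
Qed.

End Filtration.

(** * Optional stopping *)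

Definition stopped_value {R Omega : Type} (M : R -> Omega -> R)
  (tau : Omega -> R) (w : Omega) : R := M (tau w) w.

Section OptionalStopping.
Context {R : realType} {disp : measure_display} {Omega : measurableType disp}.
Variables (P : probability Omega R) (T : R) (F : R -> set (set Omega)).
Implicit Types (s t e : R) (sigma tau : Omega -> R) (A : set Omega).
Hypotheses (T0 : 0 < T) (HF : filtration T F).

Local Notation stopping := (stopping_time T F).
Local Notation stopped := (stopped_sigma_algebra T F).
Local Notation "''E[' f ; A ]" := (expect P A f) (format "''E[' f ;  A ]").

Variables (M : R -> Omega -> R) (U : Omega -> R).
Hypothesis mM : forall t, 0 <= t <= T -> measurable_fun setT (M t).
Hypothesis cM : forall w, {within `[0, T], continuous (M^~ w)}.
Hypothesis sU : summable_rv P U.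
Hypothesis MU : forall t w, 0 <= t <= T -> `|M t w| <= U w.

Lemma stopped_value_measurable tau : (forall w, 0 <= tau w <= T) ->
  measurable_fun setT tau -> measurable_fun setT (stopped_value M tau).
Proof. by move=> tauT mtau; apply: measurable_at_random_time (mM) _ tauT mtau. Qed.

Lemma stopped_value_summable tau : (forall w, 0 <= tau w <= T) ->
  measurable_fun setT tau -> summable_rv P (stopped_value M tau).
Proof.
move=> tauT mtau; apply: summable_rv_le sU _; first exact: stopped_value_measurable.
by move=> w; apply: MU.
Qed.

Lemma stopping_value_summable tau : stopping tau ->
  summable_rv P (stopped_value M tau).
Proof.
move=> h; apply: stopped_value_summable; first by case: h.
exact: (stopping_measurable HF h).
Qed.

Lemma summable_at t : 0 <= t <= T -> summable_rv P (M t).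
Proof.
by move=> tT; apply: (@stopped_value_summable (cst t)) => //; exact: measurable_cst.
Qed.

Lemma cvg_stopped_value w (u : nat -> R) l : (forall n, 0 <= u n <= T) ->
  0 <= l <= T -> u @ \oo --> l -> M (u n) w @[n --> \oo] --> M l w.
Proof. by move=> uT lT ul; apply: (within_continuous_cvg (f := M^~ w)) ul. Qed.

Hypothesis super : forall s t A, 0 <= s -> s <= t -> t <= T -> F s A ->
  'E[M t; A] <= 'E[M s; A].

Let stopped_meas tau A : stopping tau -> stopped tau A -> measurable A.
Proof.
by move=> h hA; apply: (filtration_measurable HF (lexx T)); apply: (stopped_measurable (ltW T0) h).
Qed.

(** The difference of the two stopped values is a sum of increments over grid
    intervals, each restricted to the event that [sigma] is at most the left end
    and [tau] exceeds it.  Intersected with [A] this event is known at the left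
    end, where the inequality for deterministic times applies. *)
Lemma optional_stopping_grid N sigma tau A : stopping sigma -> stopping tau ->
  stopped sigma A -> (forall w, A w -> sigma w <= tau w) ->
  'E[stopped_value M (fun w => grid_up T N (tau w)); A] <=
  'E[stopped_value M (fun w => grid_up T N (sigma w)); A].
Proof.
move=> hs ht hA st; have mA := stopped_meas hs hA.
have gN k : (k <= N.+1)%N -> 0 <= grid T N k <= T by move=> ?; apply: grid_itv => //; exact: ltW.
pose D k := M (grid T N k.+1) \- M (grid T N k).
pose B k := [set w | sigma w <= grid T N k] `&` [set w | grid T N k < tau w].
have sD (k : 'I_N.+1) : summable_rv P (D k).
  by apply: summable_rvB; apply: summable_at; apply: gN => //; exact: ltnW.
have FB (k : 'I_N.+1) : F (grid T N k) (A `&` B k).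
  rewrite setIA; apply: (filtration_setI HF).
    by apply: hA; apply: gN; exact: ltnW.
  by apply: (stopping_gt HF ht); apply: gN; exact: ltnW.
have mB (k : 'I_N.+1) : measurable (B k).
  have /andP[_ gT] := gN k (ltnW (ltn_ord k)).
  apply: (filtration_measurable HF gT); apply: (filtration_setI HF).
    by apply: (stopping_le hs); apply: gN; exact: ltnW.
  by apply: (stopping_gt HF ht); apply: gN; exact: ltnW.
rewrite -subr_le0 -expectB//; last 2 first.
- apply: stopping_value_summable; exact: (stopping_grid_up HF _ (ltW T0) ht).
- apply: stopping_value_summable; exact: (stopping_grid_up HF _ (ltW T0) hs).
rewrite (@eq_expect _ _ _ _ A _ (fun w => \sum_(k < N.+1) (D k \_ (B k)) w)); last first.
  move=> w Aw; rewrite /stopped_value /= (grid_telescope (M^~ w)); last by case: ht.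
  rewrite (grid_telescope (M^~ w)); last by case: hs.
  rewrite opprD addrACA subrr add0r -sumrB; apply: eq_bigr => k _; rewrite patchE /B.
  have [tk|kt] := ltP (grid T N k) (tau w); last first.
    rewrite ltNge (le_trans (st w Aw) kt)/= subrr ifF//.
    by apply/negP; rewrite inE /= => -[_]; rewrite ltNge kt.
  have [sk|ks] := ltP (grid T N k) (sigma w).
    rewrite subrr ifF//.
    by apply/negP; rewrite inE /= => -[]; rewrite leNgt sk.
  by rewrite subr0 mem_set.
rewrite expect_sum//; last by move=> k; exact: summable_rv_indic.
apply: sumr_le0 => k _; rewrite -expect_mkcondr.
have gk : 0 <= grid T N k <= T by apply: gN; exact: ltnW.
have gk1 : 0 <= grid T N k.+1 <= T by exact: gN.
rewrite expectB; [|exact: measurableI|exact: summable_at..].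
rewrite subr_le0; apply: super => //; first by case/andP: gk.
- by apply: le_grid; [exact: ltW|].
- by case/andP: gk1.
Qed.

(** Continuity and domination carry the inequality from the grids to the limit. *)
Lemma optional_stopping sigma tau A : stopping sigma -> stopping tau ->
  stopped sigma A -> (forall w, A w -> sigma w <= tau w) ->
  'E[stopped_value M tau; A] <= 'E[stopped_value M sigma; A].
Proof.
move=> hs ht hA st; have mA := stopped_meas hs hA.
have cv rho : stopping rho ->
    'E[stopped_value M (fun w => grid_up T N (rho w)); A] @[N --> \oo] -->
    'E[stopped_value M rho; A].
  move=> h; apply: (cvg_expect mA _ _ sU) => //.
  - move=> N; apply: summable_measurable; apply: stopping_value_summable.
    exact: (stopping_grid_up HF _ (ltW T0) h).
  - exact: stopping_value_summable.
  - apply: aeW => w _; apply: cvg_stopped_value.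
    + by move=> N; apply: grid_up_itv; exact: ltW.
    + by case: h.
    + by apply: cvg_grid_up; case: h.
  - by move=> N; apply: aeW => w; apply: MU; apply: grid_up_itv; exact: ltW.
apply: (ler_cvg_to (cv tau ht) (cv sigma hs)); apply: nearW => N.
exact: optional_stopping_grid.
Qed.
End OptionalStopping.

(** * The Snell envelope up to the contact time *)

Section SnellEnvelope.
Context {R : realType} {disp : measure_display} {Omega : measurableType disp}.
Variables (P : probability Omega R) (T : R) (F : R -> set (set Omega)).
Implicit Types (s t e : R) (sigma tau : Omega -> R) (A : set Omega).
Hypotheses (T0 : 0 < T) (HF : filtration T F).

Local Notation stopping := (stopping_time T F).
Local Notation stopped := (stopped_sigma_algebra T F).
Local Notation "''E[' f ; A ]" := (expect P A f) (format "''E[' f ;  A ]").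

Variables (M N : R -> Omega -> R) (U : Omega -> R).
Hypothesis mM : forall t, 0 <= t <= T -> measurable_fun setT (M t).
Hypothesis cM : forall w, {within `[0, T], continuous (M^~ w)}.
Hypothesis sU : summable_rv P U.
Hypothesis MU : forall t w, 0 <= t <= T -> `|M t w| <= U w.
Hypothesis mN : forall tau, stopping tau -> measurable_fun setT (stopped_value N tau).
Hypothesis NU : forall t w, 0 <= t <= T -> `|N t w| <= U w.

Hypothesis reward_le : forall t tau A, 0 <= t <= T -> stopping tau ->
  (forall w, t <= tau w) -> F t A -> 'E[stopped_value N tau; A] <= 'E[M t; A].
Hypothesis reward_near : forall t e, 0 <= t <= T -> 0 < e -> exists tau,
  [/\ stopping tau, forall w, t <= tau w &
      'E[M t; setT] <= 'E[stopped_value N tau; setT] + e].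
Hypothesis cN : forall w b, b < T -> {within `[0, b], continuous (N^~ w)}.
Hypothesis NM : {ae P, forall w, forall t, 0 <= t <= T -> N t w <= M t w}.

Let mF t A : t <= T -> F t A -> measurable A.
Proof. by move=> tT; exact: (filtration_measurable HF tT). Qed.

Let sM tau : stopping tau -> summable_rv P (stopped_value M tau).
Proof. exact: (stopping_value_summable HF mM cM sU MU). Qed.

Let sMt t : 0 <= t <= T -> summable_rv P (M t).
Proof. exact: (summable_at mM cM sU MU). Qed.

Let sN tau : stopping tau -> summable_rv P (stopped_value N tau).
Proof.
move=> h; apply: summable_rv_le sU _; first exact: mN.
by move=> w; apply: NU; case: h.
Qed.

(** On the complement of an event of the past no time beats the envelope, so a
    time that is nearly optimal overall cannot lose on the event itself. *)
Lemma reward_near_on t e : 0 <= t <= T -> 0 < e -> exists tau,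
  [/\ stopping tau, forall w, t <= tau w & forall A, F t A ->
      'E[M t; A] <= 'E[stopped_value N tau; A] + e].
Proof.
move=> tT e0; have [tau [h1 h2 h3]] := reward_near tT e0.
exists tau; split=> // A FA; have /andP[_ tT'] := tT; have mA := mF tT' FA.
have hC := reward_le tT h1 h2 (filtration_setC HF FA).
move: h3; rewrite (expect_setID mA (sMt tT)) (expect_setID mA (sN h1)) => h3.
lra.
Qed.

(** A nearly optimal time after [t] is also an admissible time after [s]. *)
Lemma snell_supermartingale s t A : 0 <= s -> s <= t -> t <= T -> F s A ->
  'E[M t; A] <= 'E[M s; A].
Proof.
move=> s0 st tT FA; apply/ler_addgt0Pr => e e0.
have tT' : 0 <= t <= T by rewrite (le_trans s0 st).
have [tau [h1 h2 h3]] := reward_near_on tT' e0.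
apply: le_trans (h3 _ (filtration_le HF st FA)) _; rewrite lerD2r.
apply: reward_le => //; first by rewrite s0 (le_trans st).
by move=> w; exact: le_trans st (h2 w).
Qed.

Let optM sigma tau A : stopping sigma -> stopping tau -> stopped sigma A ->
  (forall w, A w -> sigma w <= tau w) ->
  'E[stopped_value M tau; A] <= 'E[stopped_value M sigma; A].
Proof. exact: (optional_stopping T0 HF mM cM sU MU snell_supermartingale). Qed.

(** Nearly optimal times for the finitely many values of a discretised stopping
    time are glued along the events where these values are taken. *)
Lemma reward_near_grid n sigma e : stopping sigma -> 0 < e -> exists tau,
  [/\ stopping tau, forall w, grid_up T n (sigma w) <= tau w &
      'E[stopped_value M (fun w => grid_up T n (sigma w)); setT] <=
      'E[stopped_value N tau; setT] + e].
Proof.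
move=> hs e0; have T0' := ltW T0.
have tj (j : 'I_n.+2) : 0 <= grid T n j <= T by apply: grid_itv; rewrite // -ltnS.
have e0' : 0 < e / n.+2%:R by rewrite divr_gt0.
have [f hf] := choice (fun j : 'I_n.+2 => reward_near_on (tj j) e0').
pose idx w : 'I_n.+2 := Ordinal (grid_index_le T n (sigma w) : (_ < n.+2)%N).
pose tau w := f (idx w) w.
pose B j := [set w | idx w = j].
have FB (j : 'I_n.+2) : F (grid T n j) (B j).
  rewrite (_ : B j = [set w | sigma w <= grid T n j] `\`
     (if (0 < j)%N then [set w | sigma w <= grid T n j.-1] else set0)).
    apply: (filtration_setD HF); first exact: (stopping_le hs).
    case: ifP => j0; last exact: (filtration_set0 HF).
    apply: (filtration_le HF (le_grid _ T0' (leq_pred j))).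
    apply: (stopping_le hs); apply: grid_itv => //.
    by rewrite (leq_trans (leq_pred j))// -ltnS.
  apply/seteqP; split=> w /=.
    move=> <- /=; have /andP[_ sT] := stopping_itv w hs.
    split; first exact: grid_up_ge.
    case E : (grid_index T n (sigma w)) => [|i]//=.
    apply/negP; rewrite -ltNge lt_grid// ?E//.
    by rewrite -ltnS -E grid_index_le.
  have /andP[_ sT] := stopping_itv w hs.
  move=> [h1 h2]; apply/val_inj => /=; apply/eqP; rewrite eqn_leq -grid_index_leE//; last first.
    by rewrite -ltnS.
  rewrite h1/=; case: posnP h2 => [->//|j0 /negP].
  rewrite grid_index_leE//; first by rewrite -ltnNge prednK.
  by rewrite (leq_trans (leq_pred j))// -ltnS.
have htau : stopping tau.
  split=> [w|t tT]; first by have [h _ _] := hf (idx w); exact: stopping_itv h.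
  rewrite (_ : [set _ | _] = \bigcup_(j : 'I_n.+2)
    (if grid T n j <= t then B j `&` [set w | f j w <= t] else set0)).
    apply: (filtration_fin_bigcup HF) => j; case: ifP => jt; last exact: (filtration_set0 HF).
    apply: (filtration_setI HF); first exact: (filtration_le HF jt).
    by have [h _ _] := hf j; exact: (stopping_le h).
  apply/seteqP; split=> w /=.
    move=> tw; exists (idx w) => //; have [_ h _] := hf (idx w).
    by rewrite (le_trans (h w) tw).
  by move=> [j _]; case: ifP => // _ [] <-.
exists tau; split=> //.
  by move=> w; have [_ h _] := hf (idx w); exact: h.
have pB w : [set: Omega] w -> exists2 j, B j w & forall i, B i w -> i = j.
  by move=> _; exists (idx w).
have mB (j : 'I_n.+2) : measurable (B j) by have /andP[_ gT] := tj j; exact: mF gT (FB j).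
rewrite (expect_partition _ mB pB) ?(expect_partition _ mB pB (sN htau))//; last first.
  apply: sM; exact: stopping_grid_up.
have -> : e = \sum_(j < n.+2) e / n.+2%:R.
  by rewrite sumr_const card_ord -[RHS]mulr_natr divfK// pnatr_eq0.
rewrite -big_split/=; apply: ler_sum => j _; rewrite setTI.
have [h1 h2 h3] := hf j.
rewrite (@eq_expect _ _ _ _ (B j) (stopped_value M _) (M (grid T n j))); last first.
  by move=> w Bw; rewrite -Bw.
rewrite (@eq_expect _ _ _ _ (B j) (stopped_value N tau) (stopped_value N (f j))); last first.
  by move=> w Bw; rewrite -Bw.
exact: h3.
Qed.

(** Choose times [tau n] after [sigma] that are optimal up to [2^-1 ^+ n].  Their
    rewards, hence the values of the envelope there, have nearly the mean of the
    envelope at [sigma]; this gives the equality with [min (tau n) D] in place of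
    [D] up to the same error, and makes [M - N] at [tau n] vanish along almost
    every path.  As [M - N] is bounded away from 0 on compact intervals between
    [sigma] and [D], the [tau n] cannot stay below a time before [D], so
    [min (tau n) D] converges to [D].  The compact intervals end before [T], where
    the reward may jump. *)
Lemma snell_martingale sigma D A : stopping sigma -> stopping D ->
  stopped sigma A -> (forall w, sigma w <= D w) ->
  (forall w s, A w -> sigma w <= s -> s < D w -> M s w <> N s w) ->
  'E[stopped_value M D; A] = 'E[stopped_value M sigma; A].
Proof.
move=> hs hD hA sD nMN; have T0' := ltW T0.
have mA : measurable A by apply: mF (lexx T) _; exact: (stopped_measurable T0' hs hA).
apply/eqP; rewrite eq_le optM//=.
have e0 n : 0 < (2^-1 : R) ^+ n by rewrite exprn_gt0.
have [tau htau] := choice (fun n => reward_near_grid n hs (e0 n)).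
have st n : stopping (tau n) by case: (htau n).
pose up n w := grid_up T n (sigma w).
have sup n : stopping (up n) by exact: stopping_grid_up.
have uptau n w : up n w <= tau n w by case: (htau n) => _ + _; apply.
have sigup n w : sigma w <= up n w by apply: grid_up_ge; case/andP: (stopping_itv w hs).
have stD n : stopping (fun w => Num.min (tau n w) (D w)) by exact: stopping_min.
have Aup n : stopped (up n) A by exact: stopped_le (sigup n) hA.
have ACup n : stopped (up n) (~` A) by exact: stopped_setC.
(* On the complement of [A] the supermartingale property is used from the
   discretised [sigma] to [tau n]; on [A], from [min (tau n) D] to [tau n]. *)
have near n : 'E[stopped_value M (up n); A] <=
    'E[stopped_value M (fun w => Num.min (tau n w) (D w)); A] + (2^-1) ^+ n.
  have [_ _ h1] := htau n.
  have h2 : 'E[stopped_value N (tau n); setT] <= 'E[stopped_value M (tau n); setT].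
    apply: ae_le_expect; [exact: measurableT|exact: sN|exact: sM|].
    by apply: filterS NM => w h _; apply: h; exact: stopping_itv.
  have h3 := optM (sup n) (st n) (ACup n) (fun w _ => uptau n w).
  have h4 : 'E[stopped_value M (tau n); A] <=
      'E[stopped_value M (fun w => Num.min (tau n w) (D w)); A].
    apply: optM => //; last by move=> w _; rewrite ge_min lexx.
    apply: stopped_le hA => // w; rewrite le_min sD andbT.
    exact: le_trans (sigup n w) (uptau n w).
  move: h1 h2; rewrite -/(up n) (expect_setID mA (sN (st n))).
  rewrite (expect_setID mA (sM (st n))) (expect_setID mA (sM (sup n))); lra.
have vanish : {ae P, forall w, M (tau n w) w - N (tau n w) w @[n --> \oo] --> 0}.
  have sMN n : summable_rv P (stopped_value M (tau n) \- stopped_value N (tau n)).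
    by apply: summable_rvB; [exact: sM|exact: sN].
  apply: (ae_cvg0_geometric sMN) => n.
  rewrite (@ae_eq_expect _ _ _ _ _ _ (stopped_value M (tau n) \- stopped_value N (tau n)))//.
  - rewrite expectB//; [|exact: sM|exact: sN].
    have [_ _] := htau n.
    have := optM (sup n) (st n) (stopped_setT (sup n)) (fun w _ => uptau n w).
    by rewrite -/(up n); lra.
  - exact: summable_rv_norm (sMN n).
  - apply: filterS NM => w h _; rewrite ger0_norm// subr_ge0.
    by apply: h; exact: (stopping_itv w (st n)).
have cvtau : {ae P, forall w, A w -> Num.min (tau n w) (D w) @[n --> \oo] --> D w}.
  apply: filterS2 NM vanish => w NMw van Aw.
  apply/cvgrPdist_le => e e_gt0.
  have stau n : sigma w <= tau n w by exact: le_trans (sigup n w) (uptau n w).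
  suff : \forall n \near \oo, D w - e <= tau n w.
    apply: filterS => n Dtau; rewrite ler_norml.
    have : Num.min (tau n w) (D w) <= D w by rewrite ge_min lexx orbT.
    have : D w - e <= Num.min (tau n w) (D w) by rewrite le_min Dtau gerBl ltW.
    by move=> h1 h2; apply/andP; split; lra.
  have [Ds|sDe] := ltP (D w - e) (sigma w).
    by apply: nearW => n; exact: le_trans (ltW Ds) (stau n).
  have DeD : D w - e < D w by rewrite gtrBl.
  have /andP[D0 DT] := stopping_itv w hD.
  have /andP[s0 sT] := stopping_itv w hs.
  have DeT : D w - e < T by exact: lt_le_trans DeD DT.
  have cMN : {within `[sigma w, D w - e], continuous (fun s => M s w - N s w)}.
    have sub b : D w - e <= b -> `[sigma w, D w - e] `<=` `[0, b].
      move=> hb x /=; rewrite !in_itv/= => /andP[h1 h2].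
      by rewrite (le_trans s0 h1) (le_trans h2 hb).
    have c1 := continuous_subspaceW (sub _ (ltW DeT)) (@cM w).
    have c2 := continuous_subspaceW (sub _ (lexx _)) (@cN w _ DeT).
    by move=> x; apply: cvgB; [exact: c1|exact: c2].
  have [c cI cmin] := EVT_min sDe cMN.
  move: cI; rewrite in_itv/= => /andP[sc cD].
  have cT : 0 <= c <= T by rewrite (le_trans s0 sc) (le_trans cD (ltW DeT)).
  have c0 : 0 < M c w - N c w.
    rewrite lt0r subr_ge0 NMw// andbT subr_eq0; apply/eqP.
    by apply: nMN => //; exact: le_lt_trans cD DeD.
  have /cvgrPdist_lt/(_ _ c0) := van; apply: filterS => n.
  rewrite sub0r normrN => hn; rewrite leNgt; apply/negP => tD.
  have := cmin (tau n w); rewrite in_itv/= stau (ltW tD) => /(_ isT).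
  by rewrite leNgt (le_lt_trans (ler_norm _) hn).
have cv1 : 'E[stopped_value M (up n); A] @[n --> \oo] --> 'E[stopped_value M sigma; A].
  apply: (cvg_expect mA _ _ sU) => //.
  - by move=> n; apply: summable_measurable; exact: sM.
  - exact: sM.
  - apply: aeW => w _; apply: (cvg_stopped_value cM).
    + by move=> n; exact: (stopping_itv w (sup n)).
    + exact: (stopping_itv w hs).
    + by apply: cvg_grid_up; exact: (stopping_itv w hs).
  - by move=> n; apply: aeW => w; apply: MU; exact: (stopping_itv w (sup n)).
have cv2 : 'E[stopped_value M (fun w => Num.min (tau n w) (D w)); A] + (2^-1) ^+ n
    @[n --> \oo] --> 'E[stopped_value M D; A].
  rewrite -[X in _ --> X]addr0; apply: cvgD; last first.
    by apply: cvg_expr; rewrite ger0_norm// invf_lt1// ltr1n.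
  apply: (cvg_expect mA _ _ sU) => //.
  - by move=> n; apply: summable_measurable; exact: sM.
  - exact: sM.
  - apply: filterS cvtau => w h Aw; apply: (cvg_stopped_value cM).
    + by move=> n; exact: (stopping_itv w (stD n)).
    + exact: (stopping_itv w hD).
    + exact: h.
  - by move=> n; apply: aeW => w; apply: MU; exact: (stopping_itv w (stD n)).
by apply: (ler_cvg_to cv1 cv2); apply: nearW.
Qed.

End SnellEnvelope.

(** * Conditional expectations *)

Section SubSigmaAlgebra.
Context {R : realType} {disp : measure_display} {Omega : measurableType disp}.
Variables (P : probability Omega R) (G : set (set Omega)).
Local Notation GT := (g_sigma_algebraType G).

Definition sub_measure (sG : sigma_algebra setT G) (mG : G `<=` measurable) :
  set GT -> \bar R := P.

Definition sub_charge (sG : sigma_algebra setT G) (mG : G `<=` measurable)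
    (X : Omega -> \bar R) (iX : P.-integrable setT X) : set GT -> \bar R :=
  fun A => (\int[P]_(w in A) X w)%E.

Hypotheses (sG : sigma_algebra setT G) (mG : G `<=` measurable).

Let sub_measurableE (A : set GT) : measurable A = G A.
Proof.
by transitivity (<<s G >> A); [|rewrite (sigma_algebra_id sG)].
Qed.

Let measurable_sub (A : set GT) : measurable A -> measurable (A : set Omega).
Proof. by rewrite sub_measurableE => /mG. Qed.

Let mu0 : sub_measure sG mG set0 = 0%E. Proof. exact: measure0. Qed.
Let mu_ge0 A : (0 <= sub_measure sG mG A)%E. Proof. exact: measure_ge0. Qed.
Let mu_sigma : semi_sigma_additive (sub_measure sG mG).
Proof.
move=> A mA tA mUA; apply: measure_semi_sigma_additive => //.
- by move=> i; apply: measurable_sub.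
- exact: measurable_sub.
Qed.
HB.instance Definition _ := isMeasure.Build _ _ _ (sub_measure sG mG)
  mu0 mu_ge0 mu_sigma.
Let mu1 : sub_measure sG mG setT = 1%E. Proof. exact: probability_setT. Qed.
HB.instance Definition _ := Measure_isProbability.Build _ _ _ (sub_measure sG mG) mu1.

Variables (X : Omega -> \bar R) (iX : P.-integrable setT X).

Let nu0 : sub_charge sG mG iX set0 = 0%E. Proof. exact: integral_set0. Qed.
Let nu_fin A : measurable A -> sub_charge sG mG iX A \is a fin_num.
Proof.
move=> mA; apply: integrable_fin_num; first exact: measurable_sub.
by apply: integrableS iX => //; exact: measurable_sub.
Qed.
Let nu_sigma : semi_sigma_additive (sub_charge sG mG iX).
Proof.
move=> A mA tA mUA; apply: (@charge_semi_sigma_additive _ _ _ (induced_charge iX)) => //.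
- by move=> i; apply: measurable_sub.
- exact: measurable_sub.
Qed.
HB.instance Definition _ := isCharge.Build _ _ _ (sub_charge sG mG iX) nu0 nu_fin nu_sigma.

Let measurable_id_sub : measurable_fun setT (id : Omega -> GT).
Proof. by move=> _ A mA; rewrite setTI; exact: measurable_sub. Qed.

Lemma measurable_from_sub d (V : measurableType d) (f : Omega -> V) :
  measurable_fun setT (f : GT -> V) -> measurable_fun setT f.
Proof. by move=> mf; exact: (measurableT_comp mf measurable_id_sub). Qed.

Lemma ge0_integral_sub_measure (f : GT -> \bar R) A : measurable_fun setT f ->
  (forall w, 0 <= f w)%E -> measurable A ->
  (\int[sub_measure sG mG]_(w in A) f w = \int[P]_(w in A) f w)%E.
Proof.
move=> mf f0 mA.
have := @ge0_integral_pushforward _ _ _ _ _ _ measurable_id_sub P A f mA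
  (measurable_funTS mf) (fun w _ => f0 w).
by move=> <-; apply: eq_measure_integral.
Qed.

(** The conditional expectation is the derivative of the charge that [X] defines
    on the events of [G] with respect to the restriction of [P] to them. *)
Lemma cond_exp_exists : exists Z : Omega -> R,
  is_cond_exp P G X (fun w => (Z w)%:E).
Proof.
have numu : sub_charge sG mG iX `<< sub_measure sG mG.
  apply/null_content_dominatesP => A mA A0.
  by apply: null_set_integral => //; [exact: measurable_sub|
    exact: measurable_funTS (measurable_int _ iX)].
set D := Radon_Nikodym (sub_charge sG mG iX) (sub_measure sG mG).
have Dfin w : D w \is a fin_num by exact: Radon_Nikodym_fin_num.
have iD : (sub_measure sG mG).-integrable setT D by exact: Radon_Nikodym_integrable.
have mD : measurable_fun setT D by exact: measurable_int iD.
have iPD : P.-integrable setT (D : Omega -> \bar R).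
  apply/integrableP; split; first exact: measurable_from_sub.
  rewrite -ge0_integral_sub_measure//; last exact: measurableT_comp.
  by case/integrableP : iD.
exists (fun w => fine (D w)).
rewrite (_ : (fun _ => _) = D); last by apply/funext => w; rewrite fineK.
split=> // A GA.
have mA : measurable (A : set GT) by rewrite sub_measurableE.
have -> : (\int[P]_(w in A) X w)%E = sub_charge sG mG iX A by [].
rewrite (Radon_Nikodym_integral numu mA) [LHS]integralE [RHS]integralE.
rewrite !ge0_integral_sub_measure//.
- exact: measurable_funeneg.
- exact: measurable_funepos.
Qed.
End SubSigmaAlgebra.

(** * Essential suprema of directed families *)

Lemma integral_setID {R : realType} d (W : measurableType d)
    (mu : {measure set W -> \bar R}) (B A : set W) (f : W -> \bar R) :
  measurable B -> measurable A -> measurable_fun B f ->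
  (\int[mu]_(w in B) f w =
   \int[mu]_(w in B `&` A) f w + \int[mu]_(w in B `\` A) f w)%E.
Proof.
move=> mB mA mf; rewrite -[in LHS](setUIDK B A) integral_setU ?setUIDK//.
- exact: measurableI.
- exact: measurableD.
- by apply/disj_setPS => w [[_ Aw] [_ /(_ Aw)]].
Qed.

Section DirectedEssSup.
Context {R : realType} {disp : measure_display} {Omega : measurableType disp}.
Variables (P : probability Omega R) (G : set (set Omega)).
Hypotheses (sG : sigma_algebra setT G) (mG : G `<=` measurable).
Variables (C : set (Omega -> \bar R)) (U Y : Omega -> R).
Hypothesis C0 : C !=set0.
Hypothesis mC : forall p, C p -> measurable_fun setT p.
Hypotheses (sU : summable_rv P U) (U0 : forall w, 0 <= U w).
Hypothesis CU : forall p, C p -> {ae P, forall w, (`|p w| <= (U w)%:E)%E}.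
Hypothesis glue : forall p q A, C p -> C q -> G A ->
  C (fun w => if w \in A then p w else q w).
Hypothesis sY : summable_rv P Y.
Hypothesis supY : is_ess_sup P [set Z | exists2 p, C p & is_cond_exp P G p Z]
  (fun w => (Y w)%:E).

Local Notation GT := (g_sigma_algebraType G).
Local Notation cond_exp p z := (is_cond_exp P G p (fun w => (z w)%:E)).

Let measG (A : set GT) : measurable A = G A.
Proof.
by transitivity (<<s G >> A); [|rewrite (sigma_algebra_id sG)].
Qed.

Let iC p : C p -> P.-integrable setT p.
Proof.
move=> Cp; apply/integrableP; split; first exact: mC.
apply: le_lt_trans (_ : \int[P]_w (U w)%:E < +oo)%E; last first.
  exact: integrable_lty.
apply: ae_ge0_le_integral => //.
- exact: measurableT_comp (mC Cp).
- by move=> w _; rewrite lee_fin.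
- exact: measurable_int sU.
- by apply: filterS (CU Cp) => w.
Qed.

Let cond_exp_summable p (z : Omega -> R) : cond_exp p z -> summable_rv P z.
Proof. by case. Qed.

Let cond_exp_expect p (z : Omega -> R) A : cond_exp p z -> G A ->
  ((expect P A z)%:E = \int[P]_(w in A) p w)%E.
Proof.
move=> h GA; rewrite expectE; [|exact: mG|exact: cond_exp_summable h].
by case: h => _ _; apply.
Qed.

Let cond_exp_le p (z : Omega -> R) : C p -> cond_exp p z ->
  {ae P, forall w, z w <= Y w}.
Proof.
move=> Cp h; have [_ + _] := supY => /(_ (fun w => (z w)%:E)).
by case; [exists p|move=> N [mN N0 sN]; exists N].
Qed.

(** [Y] dominates a conditional expectation of [p], which has the same integral
    over the events of [G]. *)
Lemma ess_sup_ge p A : C p -> G A ->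
  (\int[P]_(w in A) p w <= (expect P A Y)%:E)%E.
Proof.
move=> Cp GA; have [z hz] := cond_exp_exists sG mG (iC Cp).
rewrite -(cond_exp_expect hz GA) lee_fin.
apply: ae_le_expect => //; [exact: mG|exact: cond_exp_summable hz|].
by apply: filterS (cond_exp_le Cp hz) => w.
Qed.

(** Gluing [p] and [q] along the event where [z] is at least [y] gives a member of
    the class, because this event belongs to [G]. *)
Let cond_exp_max p q (z y : Omega -> R) : C p -> C q ->
  cond_exp p z -> cond_exp q y ->
  exists2 r, C r & cond_exp r (fun w => Num.max (z w) (y w)).
Proof.
move=> Cp Cq hz hy.
have [/measurable_EFinP mz iz ez] := hz.
have [/measurable_EFinP my iy ey] := hy.
have mmax : measurable_fun setT ((fun w => Num.max (z w) (y w)) : GT -> R).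
  exact: measurable_maxr.
pose A : set Omega := [set w | y w <= z w].
have GA : G A.
  rewrite -measG -[X in measurable X]setTI.
  by apply: (measurable_fun_ler my mz) => //; exact: measurableT.
exists (fun w => if w \in A then p w else q w); first exact: glue.
have smax : summable_rv P (fun w => Num.max (z w) (y w)).
  apply: (@summable_rv_le _ _ _ _ _ (fun w => `|z w| + `|y w|)).
  - exact: (measurable_from_sub sG mG mmax).
  - by apply: summable_rvD; apply: summable_rv_norm.
  - move=> w; rewrite /Num.max; case: ifP => _; first by rewrite lerDr.
    by rewrite lerDl.
split => //; first exact/measurable_EFinP.
move=> B GB; have mB := mG GB; have mA := mG GA.
have GBA : G (B `&` A) by rewrite -measG; apply: measurableI; rewrite measG.
have GBD : G (B `\` A) by rewrite -measG; apply: measurableD; rewrite measG.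
rewrite (integral_setID P mB mA); last exact/measurable_funTS/measurable_int/smax.
have mr : measurable_fun setT (fun w => if w \in A then p w else q w).
  by apply: mC; exact: glue.
rewrite [RHS](integral_setID P mB mA); last exact: measurable_funTS.
congr (_ + _)%E.
- transitivity (\int[P]_(w in B `&` A) (z w)%:E)%E.
    by apply: eq_integral => w; rewrite inE => -[_ /= /max_idPl ->].
  rewrite ez//; apply: eq_integral => w; rewrite inE => -[_ Aw].
  by rewrite mem_set.
- transitivity (\int[P]_(w in B `\` A) (y w)%:E)%E.
    apply: eq_integral => w; rewrite inE => -[_ /= /negP].
    by rewrite -ltNge => /ltW/max_idPr ->.
  rewrite ey//; apply: eq_integral => w; rewrite inE => -[_ Aw].
  by rewrite memNset.
Qed.

Let cond_exp_fine p (Z : Omega -> \bar R) : C p -> is_cond_exp P G p Z ->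
  cond_exp p (fine \o Z) /\ {ae P, forall w, Z w = (fine (Z w))%:E}.
Proof.
move=> Cp [mZ iZ eZ].
have aeZ := integrable_ae_fine iZ.
have mfZ : measurable_fun setT (fine \o Z : GT -> R).
  exact: (measurableT_comp (fine_measurable measurableT) mZ).
split=> //; split.
- exact/measurable_EFinP.
- exact: summable_rv_fine.
- move=> A GA; rewrite -eZ//; apply: ae_eq_integral; first exact: mG.
  + by apply: measurable_funTS; exact: measurable_int (summable_rv_fine iZ).
  + by apply: measurable_funTS; exact: measurable_int iZ.
  + by apply: filterS aeZ => w h _.
Qed.

(** Conditional expectations over the class form an upward directed family, so
    that an increasing sequence [v] of them has means converging to the supremum
    [c] of all means.  Its limit [V] dominates each [x] of the family: otherwise
    the mean of [max x (v n)] would exceed [c] for some [n].  Hence [Y] is at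
    most [V], whose mean is at most [c]. *)
Lemma ess_sup_near e : 0 < e -> exists2 p, C p &
  ((expect P setT Y)%:E <= \int[P]_w p w + e%:E)%E.
Proof.
move=> e0; have GT1 : G setT by rewrite -measG; exact: measurableT.
pose E := [set x | exists p z, [/\ C p, cond_exp p z & x = expect P setT z]].
pose c := sup E.
have ubE : ubound E (expect P setT Y).
  move=> _ [p [z [Cp hz ->]]]; apply: ae_le_expect => //.
  - exact: cond_exp_summable hz.
  - by apply: filterS (cond_exp_le Cp hz) => w h _.
have supE : has_sup E.
  split; last by exists (expect P setT Y).
  have [p Cp] := C0; have [z hz] := cond_exp_exists sG mG (iC Cp).
  by exists (expect P setT z), p, z.
have leE p z : C p -> cond_exp p z -> expect P setT z <= c.
  by move=> Cp hz; apply: (sup_upper_bound supE); exists p, z.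
suff Yc : expect P setT Y <= c.
  have [_ [p [z [Cp hz ->]]] zc] := sup_adherent e0 supE.
  exists p => //; rewrite -(cond_exp_expect hz GT1) -EFinD lee_fin.
  by rewrite (le_trans Yc)// -lerBlDr ltW.
have h0 n : (0 : R) < n.+1%:R^-1 by rewrite invr_gt0.
have /choice[z hz] n : exists z : Omega -> R, exists p,
    [/\ C p, cond_exp p z & c - n.+1%:R^-1 < expect P setT z].
  have [_ [p [z [Cp hz ->]]] zc] := sup_adherent (h0 n) supE.
  by exists z, p.
pose v := fix v n := if n is n'.+1 then fun w => Num.max (z n w) (v n' w) else z 0%N.
have hv n : exists2 p, C p & cond_exp p (v n).
  elim: n => [|n [q Cq hq]]; first by have [p [Cp hp _]] := hz 0%N; exists p.
  by have [p [Cp hp _]] := hz n.+1; exact: cond_exp_max hp hq.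
have sv n : summable_rv P (v n) by have [p _ h] := hv n; exact: cond_exp_summable h.
have vY : {ae P, forall w, forall n, v n w <= Y w}.
  by apply: ae_foralln => n; have [p Cp h] := hv n; exact: cond_exp_le Cp h.
have zv n w : z n w <= v n w by case: n => //= n; rewrite le_max lexx.
have vS n w : v n w <= v n.+1 w by rewrite /= le_max lexx orbT.
(* Truncation at [Y] changes [v n] on a null set only, and makes the sequence
   converge for every outcome. *)
pose u n w := Num.min (v n w) (Y w).
have u_nd w : nondecreasing_seq (u^~ w).
  by apply/nondecreasing_seqP => n; rewrite le_min !ge_min vS lexx orbT.
have uY n w : u n w <= Y w by rewrite ge_min lexx orbT.
have uV w : u n w @[n --> \oo] --> limn (u^~ w).
  apply: nondecreasing_is_cvgn => //.
  by exists (Y w) => _ [n _ <-].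
pose V w := limn (u^~ w).
have mu' n : measurable_fun setT (u n).
  apply: measurable_minr; first exact: summable_measurable (sv n).
  exact: summable_measurable sY.
have mV : measurable_fun setT V by exact: measurable_fun_seq_limit uV.
pose U' w := `|u 0%N w| + `|Y w|.
have sU' : summable_rv P U'.
  apply: summable_rvD; last exact: summable_rv_norm.
  apply: summable_rv_norm; apply: (@summable_rv_le _ _ _ _ _ (fun w => `|v 0%N w| + `|Y w|)) => //.
  - by apply: summable_rvD; apply: summable_rv_norm.
  - move=> w; rewrite /u /Num.min; case: ifP => _; first by rewrite lerDl.
    by rewrite lerDr.
have bounded x w : u 0%N w <= x -> x <= Y w -> `|x| <= U' w.
  move=> h1 h2; rewrite ler_norml /U'; have := ler_norm (Y w).
  have := ler_norm (- u 0%N w); rewrite normrN.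
  have := normr_ge0 (Y w); have := normr_ge0 (u 0%N w).
  by move=> *; apply/andP; split; lra.
have uU' n w : `|u n w| <= U' w by apply: bounded => //; exact: u_nd.
have uleV n w : u n w <= V w.
  by apply: nondecreasing_cvgn_le => //; exact/cvgP/uV.
have sV : summable_rv P V.
  apply: summable_rv_le mV sU' _ => w; apply: bounded => //.
  by apply: limr_le; [exact/cvgP/uV|exact: nearW].
have uv n : {ae P, forall w, [set: Omega] w -> u n w = v n w}.
  by apply: filterS vY => w h _; apply/min_idPl.
have su n : summable_rv P (u n) by exact: summable_rv_le (mu' n) sU' (uU' n).
have Vc : expect P setT V <= c.
  apply: (cvgr_to_le (cvg_expect measurableT mu' sV sU' (aeW _ (fun w _ => uV w))
  (fun n => aeW _ (uU' n)))).
  apply: nearW => n; rewrite (ae_eq_expect measurableT (su n) (sv n) (uv n)).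
  by have [p Cp h] := hv n; exact: leE Cp h.
apply: le_trans Vc; apply: ae_le_expect => //.
have [_ _ /(_ (fun w => (V w)%:E))] := supY; case.
- exact/measurable_EFinP.
- move=> Z /= [p Cp /(cond_exp_fine Cp)[hx Zx]].
  set x := fine \o Z in hx; have sx := cond_exp_summable hx.
  pose f w := Num.max (x w) (V w) - V w.
  have f0 w : 0 <= f w by rewrite subr_ge0 le_max lexx orbT.
  have smax y y' : summable_rv P y -> summable_rv P y' ->
      summable_rv P (fun w => Num.max (y w) (y' w)).
    move=> sy sy'; apply: (@summable_rv_le _ _ _ _ _ (fun w => `|y w| + `|y' w|)).
    - apply: measurable_maxr; first exact: summable_measurable sy.
      exact: summable_measurable sy'.
    - by apply: summable_rvD; apply: summable_rv_norm.
    - move=> w; rewrite /Num.max; case: ifP => _; first by rewrite lerDr.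
      by rewrite lerDl.
  have sf : summable_rv P f by apply: summable_rvB => //; exact: smax.
  have fle n : expect P setT f <= n.+1%:R^-1.
    have [q [Cq hq cq]] := hz n; have [r Cr hr] := hv n.
    have [r' Cr' hr'] := cond_exp_max Cp Cr hx hr.
    apply: (@le_trans _ _ (expect P setT ((fun w => Num.max (x w) (v n w)) \- v n))).
      apply: ae_le_expect => //; first by apply: summable_rvB => //; exact: smax.
      apply: filterS (uv n) => w /(_ I) uvn _; rewrite /f /=.
      have := uleV n w; rewrite uvn.
      by move: (x w) (V w) (v n w) => a b c'; case: (leP a b) => h1; case: (leP a c') => h2 h3; lra.
    rewrite expectB//; last exact: smax.
    have := leE _ _ Cr' hr'.
    have : expect P setT (z n) <= expect P setT (v n).
      apply: le_expect => //; exact: cond_exp_summable hq.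
    move=> zv_mean max_mean; rewrite lerBlDl (le_trans max_mean)//.
    by move: cq; rewrite ltrBlDr => /ltW /le_trans -> //; rewrite lerD2r.
  have f00 : expect P setT f <= 0.
    apply/ler_addgt0Pr => d d0; rewrite add0r.
    have /cvgrPdist_lt/(_ _ d0)[n _ /(_ n (leqnn n))] := @cvg_harmonic R.
    rewrite /= sub0r normrN ger0_norm// => hd.
    exact: le_trans (fle n) (ltW hd).
  apply: filterS2 (expect_le0_ae0 sf f0 f00) Zx => w fw ->.
  by rewrite lee_fin -[leRHS]add0r -lerBlDr -fw /f lerD2r le_max lexx.
- by move=> N [mN N0 sN]; exists N; split => // w h; apply: sN => h'; apply: h => _; rewrite -lee_fin.
Qed.

End DirectedEssSup.

(** * Infinitely many switches *)

Section InfinitelyManySwitches.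
Context {R : realType}.
Variables (T alpha : R) (m : nat) (G : 'I_m -> 'I_m -> R -> R).
Hypothesis alpha0 : 0 < alpha.
Hypothesis cG : forall i j, {within `[0, T], continuous (G i j)}.
Hypothesis G0 : forall i j t, 0 <= t <= T -> 0 <= G i j t.
Hypothesis Gii : forall i t, 0 <= t <= T -> G i i t = 0.
Hypothesis G_triangle : forall i j l t, j != i -> j != l -> 0 <= t <= T ->
  G i l t < G i j t + G j l t.
Hypothesis G_loop : forall i j t, i != j -> 0 <= t <= T ->
  alpha < G i j t + G j i t.

(** By the triangle inequality a direct switch costs at most as much as the walk,
    whose steps are free. *)
Lemma walk_cost_vanish t (x : nat -> 'I_m) n p : 0 <= t <= T ->
  (forall q, (n <= q)%N -> G (x q) (x q.+1) t = 0) -> G (x n) (x (n + p)%N) t = 0.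
Proof.
move=> tT x0; elim: p => [|p IH]; first by rewrite addn0 Gii.
rewrite addnS; set i := x n; set j := x (n + p)%N in IH *.
have jl : G j (x (n + p).+1) t = 0 by apply: x0; exact: leq_addr.
apply/eqP; rewrite eq_le G0// andbT.
have [<-|ji] := eqVneq j i; first by rewrite jl.
have [<-|jl'] := eqVneq j (x (n + p).+1); first by rewrite IH.
by rewrite -[leRHS]addr0 -[X in _ <= X + _]IH -[X in _ <= _ + X]jl ltW// G_triangle.
Qed.

(** Infinitely many switches accumulate at some time [l].  If their costs were
    summable, every transition made infinitely often would be free at [l], and
    as there are finitely many modes the walk would contain a free closed loop
    at time [l].  By the triangle inequality, after the first step of the loop
    the direct way back is free as well, which contradicts the lower bound on
    the cost of going to a mode and back. *)
Lemma infinitely_many_switches_cost (x : nat -> 'I_m) (t : nat -> R) :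
  (forall n, 0 <= t n <= T) -> (forall n, t n <= t n.+1) ->
  (forall n, x n.+1 != x n) ->
  (\sum_(n <oo) (G (x n) (x n.+1) (t n.+1))%:E = +oo)%E.
Proof.
move=> tT t_nd xx; apply/eqP; rewrite eq_le leey/= leNgt; apply/negP => Sfin.
have u0 n : 0 <= G (x n) (x n.+1) (t n.+1) by exact: G0.
have ucv := nneseries_lty_cvg0 u0 Sfin.
have tcv : t n @[n --> \oo] --> limn t.
  apply: nondecreasing_is_cvgn; first exact/nondecreasing_seqP.
  by exists T => _ [n _ <-]; case/andP: (tT n).
set l := limn t in tcv.
have lT : 0 <= l <= T.
  apply/andP; split; first by apply: limr_ge; [exact: cvgP tcv|apply: nearW => n; case/andP: (tT n)].
  by apply: limr_le; [exact: cvgP tcv|apply: nearW => n; case/andP: (tT n)].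
have tcvS : t n.+1 @[n --> \oo] --> l by rewrite (cvg_shiftS t).
have free : \forall n \near \oo, forall p : 'I_m * 'I_m,
    x n = p.1 -> x n.+1 = p.2 -> G p.1 p.2 l = 0.
  apply: filter_forall => -[i j] /=.
  have [->|Gl] := eqVneq (G i j l) 0; first exact: nearW.
  have e0 : 0 < G i j l / 2 by rewrite divr_gt0// lt0r Gl G0.
  have Gcv : G i j (t n.+1) @[n --> \oo] --> G i j l.
    by apply: (within_continuous_cvg (u := fun n => t n.+1) (cG (i:=i) (j:=j))) => // n.
  have /cvgrPdist_lt/(_ _ e0) h1 := Gcv.
  have /cvgrPdist_lt/(_ _ e0) h2 := ucv.
  apply: filterS2 h1 h2 => n + + xi xj; rewrite xi xj sub0r normrN => h1 h2.
  suff : G i j l < G i j l by rewrite ltxx.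
  rewrite -[ltLHS](subrK (G i j (t n.+1))) [ltRHS]splitr.
  by apply: ltrD; [exact: le_lt_trans (ler_norm _) h1|exact: le_lt_trans (ler_norm _) h2].
have [n _ hn] := free.
have fr q : (n <= q)%N -> G (x q) (x q.+1) l = 0.
  by move=> nq; exact: (hn q nq (x q, x q.+1)).
(* Among [m.+1] consecutive modes two coincide. *)
pose f (k : 'I_m.+1) := x (n + k)%N.
have /injectivePn[a [b ab fab]] : ~~ injectiveb f.
  by apply/injectiveP => /leq_card; rewrite !card_ord ltnn.
wlog ltab : a b ab fab / (a < b)%N.
  move=> wl; case: (ltngtP a b) => [h|h|/val_inj h].
  - exact: wl ab fab h.
  - by apply: (wl b a) => //; rewrite eq_sym.
  - by rewrite h eqxx in ab.
have := @G_loop (x (n + a)%N) (x (n + a).+1) l.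
rewrite eq_sym xx => /(_ isT lT).
rewrite fr ?leq_addr// add0r.
have -> : x (n + a)%N = x ((n + a).+1 + (b - a.+1))%N.
  by rewrite -addnS -addnA subnKC.
rewrite walk_cost_vanish//; first by rewrite ltNge ltW.
by move=> q nq; apply: fr; rewrite (leq_trans _ nq)// leqW// leq_addr.
Qed.

End InfinitelyManySwitches.

(** * Progressive processes *)

Section Processes.
Context {R : realType} {disp : measure_display} {Omega : measurableType disp}.
Variables (P : probability Omega R) (T : R) (F : R -> set (set Omega)).
Hypotheses (T0 : 0 < T) (HF : filtration T F).
Implicit Types (s t : R) (tau : Omega -> R) (X : R -> Omega -> R).

Lemma progressive_adapted X t : progressive T F X -> 0 <= t <= T ->
  measurable_fun setT (X t : g_sigma_algebraType (F t) -> R).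
Proof.
move=> pX tT; have /andP[t0 _] := tT.
have := pX t tT => mX.
apply: (measurable_comp (F := `[0, t] `*` [set: g_sigma_algebraType (F t)])
  (f := fun p : R * g_sigma_algebraType (F t) => X p.1 p.2)
  (g := fun w : g_sigma_algebraType (F t) => (t, w))) => //.
- by apply: measurableX.
- by move=> _ [w _ <-]; split => //=; rewrite in_itv/= t0 lexx.
- exact: (measurable_fun_pair (measurable_cst t) (@measurable_id _ (g_sigma_algebraType (F t)) setT)).
Qed.

Lemma progressive_measurable X t : progressive T F X -> 0 <= t <= T ->
  measurable_fun setT (X t).
Proof.
by move=> pX tT; have /andP[_ tT'] := tT; apply: (measurable_filtration HF tT'); exact: progressive_adapted.
Qed.

Lemma progressive_joint X : progressive T F X ->
  measurable_fun setT
    ((fun p : R * Omega => X p.1 p.2) \_ (`[0, T] `*` setT)).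
Proof.
move=> pX.
have mDO : measurable (`[0, T]%classic `*` [set: Omega]) by exact: measurableX.
apply/(measurable_restrictT _ mDO).
have TT : 0 <= T <= T by rewrite lexx ltW.
have := pX T TT => mX.
have mD : measurable (`[0, T]%classic `*` [set: g_sigma_algebraType (F T)]).
  exact: measurableX.
apply: (measurable_comp (F := `[0, T] `*` [set: g_sigma_algebraType (F T)])
  (f := fun p : R * g_sigma_algebraType (F T) => X p.1 p.2)
  (g := fun p : R * Omega => (p.1, p.2 : g_sigma_algebraType (F T)))) => //.
  by move=> _ [p [h _] <-].
have mid : measurable_fun setT (id : Omega -> g_sigma_algebraType (F T)).
  move=> _ A mA; rewrite setTI; apply: (filtration_measurable HF (lexx T)).
  by rewrite (filtrationE HF).
apply: measurable_funTS; apply: measurable_fun_pair; first exact: measurable_fst.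
exact: (measurableT_comp mid measurable_snd).
Qed.

(** The supremum of a continuous path is the supremum over the countable set of
    all grid points, hence a random variable; [|x| <= 1 + x ^ 2] turns square
    integrability into integrability. *)
Lemma S2_dominated X : S2 P T F X -> exists U : Omega -> R,
  [/\ summable_rv P U, forall w, 0 <= U w &
      forall t w, 0 <= t <= T -> `|X t w| <= U w].
Proof.
move=> [pX cX iX].
pose q (n : nat) : R := if unpickle n is Some (N, k) then grid T N (minn k N.+1) else 0.
have qT n : 0 <= q n <= T.
  rewrite /q; case: (unpickle n) => [[N k]|]; last by rewrite lexx ltW.
  by apply: grid_itv; [exact: ltW|exact: geq_minr].
pose S w := esups (fun n => (`|X (q n) w| ^+ 2)%:E) 0.
have mS : measurable_fun setT S.
  apply: measurable_fun_esups => n; apply/measurable_EFinP.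
  apply: measurable_funX; apply: measurableT_comp => //.
  exact: progressive_measurable.
have XS t w : 0 <= t <= T -> ((`|X t w| ^+ 2)%:E <= S w)%E.
  move=> tT.
  have cv : (`|X (grid_up T N t) w| ^+ 2)%:E @[N --> \oo] --> (`|X t w| ^+ 2)%:E.
    apply: cvg_EFin; first exact: nearW.
    have cX' : X (grid_up T N t) w @[N --> \oo] --> X t w.
      apply: (within_continuous_cvg (f := X^~ w)) => //.
        by move=> N; exact/grid_up_itv/ltW.
      exact: cvg_grid_up.
    by under eq_fun do rewrite expr2; rewrite expr2; apply: cvgM; exact: cvg_norm.
  apply: (cvge_to_le cv); apply: nearW => N.
  apply: ereal_sup_ubound; exists (pickle (N, grid_index T N t)) => //=.
  by rewrite /q pickleK (minn_idPl (grid_index_le _ _ _)).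
have SX w : (S w <= ereal_sup [set (`|X t w| ^+ 2)%:E | t in `[0%R, T]])%E.
  apply: ub_ereal_sup => _ [n _ <-]; apply: ereal_sup_ubound.
  by exists (q n) => //=; rewrite in_itv/=.
have S0 w : (0 <= S w)%E.
  by apply: le_trans (XS 0 w _); rewrite ?lee_fin ?sqr_ge0// lexx ltW.
have Sfin w : S w \is a fin_num.
  rewrite ge0_fin_numE//.
  have [c _ cM] := EVT_max (ltW T0) (cX w).
  have [c' _ cm] := EVT_min (ltW T0) (cX w).
  apply: (@le_lt_trans _ _ ((`|X c w| + `|X c' w|) ^+ 2)%:E); last exact: ltry.
  apply: ub_ereal_sup => _ [n _ <-]; rewrite lee_fin.
  rewrite ler_sqr ?nnegrE ?addr_ge0//.
  have h1 := cM (q n); have h2 := cm (q n).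
  rewrite ler_norml; apply/andP; split.
    apply: le_trans (h2 _); last by rewrite in_itv/= qT.
    have := ler_norm (- X c' w); rewrite normrN.
    by have := normr_ge0 (X c w); move=> h3 h4; lra.
  apply: le_trans (h1 _) _; first by rewrite in_itv/= qT.
  by rewrite (le_trans (ler_norm _))// lerDl.
have E : (fun w => (fine (S w))%:E) = S by apply/funext => w; rewrite fineK.
have iS : P.-integrable setT S.
  apply/integrableP; split => //.
  apply: le_lt_trans iX.
  under eq_integral do rewrite gee0_abs//.
  rewrite le_eqVlt; apply/orP; left; apply/eqP; apply: eq_integral => w _.
  apply/eqP; rewrite eq_le SX/=; apply: ub_ereal_sup => _ [t + <-].
  by rewrite /= in_itv/= => /XS.
have sS : summable_rv P (fun w => fine (S w)) by rewrite /summable_rv /comp E.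
exists (fun w => 1 + fine (S w)); split.
- by apply: summable_rvD sS; exact: summable_rv_cst.
- by move=> w; rewrite addr_ge0// fine_ge0.
- move=> t w tT; have := XS t w tT; rewrite -[S w]fineK// lee_fin.
  have := sqr_ge0 (`|X t w| - 1); rewrite sqrrB1 => h1 h2.
  have := normr_ge0 (X t w); rewrite mulr2n in h1; lra.
Qed.
End Processes.

(** * Path integrals *)

Section JointIntegral.
Context {R : realType} {disp : measure_display} {Omega : measurableType disp}.

Lemma measurable_joint_integral (h : R * Omega -> \bar R) :
  measurable_fun setT h ->
  measurable_fun setT (fun w => \int[lebesgue_measure]_s h (s, w))%E.
Proof.
move=> mh.
rewrite (_ : (fun _ => _) = fun w =>
  (fubini_G lebesgue_measure h^\+ w - fubini_G lebesgue_measure h^\- w)%E); last first.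
  by apply/funext => w; rewrite [LHS]integralE /fubini_G; congr (_ - _)%E;
    apply: eq_integral => s _; rewrite ?funeposE ?funenegE.
apply: emeasurable_funB; apply: measurable_fun_fubini_tonelli_G => //.
- exact: measurable_funepos.
- exact: measurable_funeneg.
Qed.

Lemma measurable_section (h : R * Omega -> R) w : measurable_fun setT h ->
  measurable_fun setT (fun s => h (s, w)).
Proof.
move=> mh; apply: (measurableT_comp mh).
exact: (measurable_fun_pair (@measurable_id _ R setT) (measurable_cst w)).
Qed.

End JointIntegral.

Section PathIntegral.
Context {R : realType} {disp : measure_display} {Omega : measurableType disp}.
Variables (P : probability Omega R) (T : R) (F : R -> set (set Omega)).
Variables (X : R -> Omega -> R).
Local Notation leb := (@lebesgue_measure R).

Definition horizon_path : R * Omega -> R :=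
  (fun p : R * Omega => X p.1 p.2) \_ (`[0, T] `*` setT).

Definition integrable_paths : set Omega :=
  [set w | \int[leb]_s `|horizon_path (s, w)|%:E < +oo]%E.

(** Paths that are not integrable, which form a null set, are replaced by 0, so
    that the integrals below are finite for every outcome. *)
Definition path_rate : R * Omega -> R :=
  horizon_path \_ (setT `*` integrable_paths).

Definition path_integral (t : R) (w : Omega) : R :=
  (\int[leb]_(s in `[0, t]) path_rate (s, w))%R.

Definition path_variation (t : R) (w : Omega) : R :=
  (\int[leb]_(s in `[0, t]) `|path_rate (s, w)|)%R.

Hypotheses (T0 : 0 < T) (HF : filtration T F) (HX : M2 P T F X).
Implicit Types (s t a b : R) (w : Omega).

Let mX : measurable_fun setT horizon_path.
Proof. by case: HX => pX _; exact: (progressive_joint T0 HF pX). Qed.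

Let mnX : measurable_fun setT (fun p => `|horizon_path p|%:E).
Proof. by apply/measurable_EFinP; exact: measurableT_comp. Qed.

Lemma measurable_integrable_paths : measurable integrable_paths.
Proof.
have mI := measurable_joint_integral mnX.
rewrite -[X in measurable X]setTI.
exact: emeasurable_fun_infty_o.
Qed.

Lemma measurable_path_rate : measurable_fun setT path_rate.
Proof.
have mD : measurable ([set: R] `*` integrable_paths).
  by apply: measurableX => //; exact: measurable_integrable_paths.
apply/(measurable_restrictT _ mD); exact: measurable_funTS.
Qed.

Lemma path_rate_good w s : integrable_paths w -> 0 <= s <= T ->
  path_rate (s, w) = X s w.
Proof.
move=> gw sT; rewrite /path_rate patchE mem_set// /horizon_path patchE mem_set//.
Qed.

Let total_variation w : (\int[leb]_s `|path_rate (s, w)|%:E =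
  if w \in integrable_paths then \int[leb]_s `|horizon_path (s, w)|%:E else 0)%E.
Proof.
case: ifPn => gw.
  by apply: eq_integral => s _; rewrite /path_rate patchE in_setX/= in_setT gw.
rewrite integral0_eq// => s _; rewrite /path_rate patchE in_setX/= (negbTE gw) andbF.
by rewrite normr0.
Qed.

Lemma path_rate_integrable w : leb.-integrable setT (EFin \o (fun s => path_rate (s, w))).
Proof.
apply/integrableP; split.
  by apply/measurable_EFinP; exact: measurable_section measurable_path_rate.
rewrite -[ltLHS]/(\int[leb]_s `|path_rate (s, w)|%:E)%E total_variation.
by case: ifP; rewrite ?ltry// inE.
Qed.

Lemma path_rate_integrableS w (A : set R) : measurable A ->
  leb.-integrable A (EFin \o (fun s => path_rate (s, w))).
Proof. by move=> mA; exact: integrableS (path_rate_integrable w). Qed.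

Lemma path_integralB a b w : 0 <= a -> a <= b ->
  path_integral b w - path_integral a w = (\int[leb]_(s in `]a, b]) path_rate (s, w))%R.
Proof.
move=> a0 ab; rewrite /path_integral Rintegral_itvB//.
exact: path_rate_integrableS.
Qed.

Lemma path_variationB a b w : 0 <= a -> a <= b ->
  path_variation b w - path_variation a w = (\int[leb]_(s in `]a, b]) `|path_rate (s, w)|)%R.
Proof.
move=> a0 ab; rewrite /path_variation Rintegral_itvB//.
exact: (integrable_norm (path_rate_integrableS w _)).
Qed.

Lemma path_integral_variation a b w : 0 <= a -> a <= b ->
  `|path_integral b w - path_integral a w| <= path_variation b w - path_variation a w.
Proof.
move=> a0 ab; rewrite path_integralB// path_variationB//.
by apply: le_normr_Rintegral => //; exact: path_rate_integrableS.
Qed.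

Lemma path_variation_nd a b w : 0 <= a -> a <= b ->
  path_variation a w <= path_variation b w.
Proof.
move=> a0 ab; rewrite -subr_ge0 path_variationB//; apply: Rintegral_ge0 => s _.
exact: normr_ge0.
Qed.

Lemma path_integral0 w : path_integral 0 w = 0.
Proof. by rewrite /path_integral set_itv1 Rintegral_set1. Qed.

Lemma path_variation0 w : path_variation 0 w = 0.
Proof. by rewrite /path_variation set_itv1 Rintegral_set1. Qed.

Lemma path_integral_bound t w : 0 <= t <= T ->
  `|path_integral t w| <= path_variation T w.
Proof.
move=> /andP[t0 tT]; have := path_integral_variation w (lexx 0) t0.
rewrite path_integral0 path_variation0 !subr0 => /le_trans; apply.
exact: path_variation_nd.
Qed.

Lemma path_integral_continuous w :
  {within `[0, T], continuous (path_integral^~ w)}.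
Proof.
exact: (parameterized_integral_continuous (ltW T0) (path_rate_integrableS w _)).
Qed.

Let measurable_cut (h : R * Omega -> R) t : measurable_fun setT h ->
  measurable_fun setT (fun w => (\int[leb]_(s in `[0, t]) h (s, w))%R).
Proof.
move=> mh; rewrite /Rintegral.
apply: (measurableT_comp (fine_measurable measurableT)).
rewrite (_ : (fun _ => _) = fun w => \int[leb]_s ((h \_ (`[0, t] `*` setT)) (s, w))%:E)%E.
  apply: (measurable_joint_integral
    (h := fun p => ((h \_ (`[0, t] `*` setT)) p)%:E)).
  have mD : measurable (`[0, t]%classic `*` [set: Omega]) by exact: measurableX.
  apply/measurable_EFinP; apply/(measurable_restrictT _ mD); exact: measurable_funTS.
apply/funext => w; rewrite integral_mkcond; apply: eq_integral => s _.
by rewrite !patchE in_setX in_setT andbT; case: ifP.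
Qed.

Lemma measurable_path_integral t : measurable_fun setT (path_integral t).
Proof. by apply: measurable_cut; exact: measurable_path_rate. Qed.

Lemma measurable_path_variation t : measurable_fun setT (path_variation t).
Proof.
apply: (measurable_cut (h := fun p => `|path_rate p|)).
by apply: measurableT_comp => //; exact: measurable_path_rate.
Qed.

Let variation w : \bar R := (\int[leb]_s `|horizon_path (s, w)|%:E)%E.

Let variation_ge0 w : (0 <= variation w)%E.
Proof. by apply: integral_ge0 => s _; rewrite lee_fin. Qed.

Let mvariation : measurable_fun setT variation.
Proof. exact: measurable_joint_integral mnX. Qed.

(* On a bounded time interval a square integrable process is integrable, as
   |x| <= 1 + x ^ 2. *)
Let variation_integrable : P.-integrable setT variation.
Proof.
apply/integrableP; split => //; under eq_integral do rewrite gee0_abs//.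
have [_ X2] := HX.
pose Q w : \bar R := (\int[leb]_s (`|horizon_path (s, w)| ^+ 2)%:E)%E.
have mQ : measurable_fun setT Q.
  apply: (measurable_joint_integral (h := fun p => (`|horizon_path p| ^+ 2)%:E)).
  by apply/measurable_EFinP; apply: measurable_funX; exact: measurableT_comp.
have hout w s : ~ `[0, T]%classic s -> horizon_path (s, w) = 0.
  by move=> sT; rewrite /horizon_path patchE ifF//; apply/negP; rewrite inE /= => -[].
have QE w : Q w = (\int[leb]_(s in `[0%R, T]) (`|X s w| ^+ 2)%:E)%E.
  rewrite [RHS]integral_mkcond; apply: eq_integral => s _; rewrite patchE.
  case: ifPn; rewrite ?inE => sT.
    by rewrite /horizon_path patchE mem_set.
  by rewrite hout ?normr0 ?expr0n// => h; rewrite mem_set in sT.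
have Q0 w : (0 <= Q w)%E by apply: integral_ge0 => s _; rewrite lee_fin sqr_ge0.
apply: (@le_lt_trans _ _ (\int[P]_w (T%:E + Q w))%E); last first.
  rewrite ge0_integralD//; last by move=> w _; rewrite lee_fin ltW.
  rewrite integral_cst// [X in (_ * X)%E](_ : _ = 1%E); last exact: probability_setT.
  rewrite mule1; apply: lte_add_pinfty; first exact: ltry.
  by under eq_integral do rewrite QE.
apply: ge0_le_integral => //.
  by apply: emeasurable_funD.
move=> w _.
have mh : measurable_fun setT (fun s => horizon_path (s, w)) by exact: measurable_section.
pose one : R -> R := \1_(`[0, T]).
have one0 s : 0 <= one s by rewrite /one indicE.
have -> : T%:E = (\int[leb]_s (one s)%:E)%E.
  rewrite integral_indic// setIT; transitivity (lebesgue_measure `[0, T]%classic) => //.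
  by rewrite lebesgue_measure_itv/= lte_fin T0 oppr0 addr0.
have mone : measurable_fun setT (fun s => (one s)%:E).
  by apply/measurable_EFinP; exact: measurable_indic.
have mh2 : measurable_fun setT (fun s => (`|horizon_path (s, w)| ^+ 2)%:E).
  by apply/measurable_EFinP; apply: measurable_funX; exact: measurableT_comp.
have one0' s : setT s -> (0 <= (one s)%:E)%E by rewrite lee_fin.
have h20 s : setT s -> (0 <= (`|horizon_path (s, w)| ^+ 2)%:E)%E.
  by rewrite lee_fin sqr_ge0.
rewrite /Q -(ge0_integralD leb measurableT one0' mone h20 mh2).
apply: ge0_le_integral => //.
- by apply/measurable_EFinP; exact: measurableT_comp.
- exact: emeasurable_funD.
- move=> s _; rewrite -EFinD lee_fin.
  have [sT|sT] := pselect (`[0, T]%classic s); last first.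
    by rewrite hout// normr0 expr0n addr0.
  rewrite /one indicE mem_set//=.
  have := sqr_ge0 (`|horizon_path (s, w)| - 1); rewrite sqrrB1 mulr2n.
  have := normr_ge0 (horizon_path (s, w)); lra.
Qed.

Lemma path_variation_summable : summable_rv P (path_variation T).
Proof.
apply: (le_integrable _ _ _ variation_integrable) => //.
  by apply/measurable_EFinP; exact: measurable_path_variation.
move=> w _; rewrite [leRHS]gee0_abs//= ger0_norm; last exact: Rintegral_ge0.
rewrite /path_variation /Rintegral fineK; last first.
  by apply: integrable_fin_num => //; exact: (integrable_norm (path_rate_integrableS w _)).
apply: (@le_trans _ _ (\int[leb]_s `|path_rate (s, w)|%:E)%E).
  apply: ge0_subset_integral => //.
  apply/measurable_EFinP; apply: measurableT_comp => //.
  exact: measurable_section measurable_path_rate.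
by rewrite total_variation; case: ifP => _ //; exact: variation_ge0.
Qed.

Lemma ae_integrable_paths : {ae P, forall w, integrable_paths w}.
Proof.
have := integrable_ae measurableT variation_integrable.
by apply: filterS => w /(_ I); rewrite ge0_fin_numE.
Qed.

Lemma integral_path a b w : integrable_paths w -> 0 <= a -> a <= b -> b <= T ->
  (\int[leb]_(s in `]a, b]) (X s w)%:E = (path_integral b w - path_integral a w)%:E)%E.
Proof.
move=> gw a0 ab bT; rewrite path_integralB// /Rintegral fineK; last first.
  by apply: integrable_fin_num => //; exact: path_rate_integrableS.
apply: eq_integral => s; rewrite inE /= in_itv/= => /andP[h1 h2].
by rewrite path_rate_good// (le_trans a0 (ltW h1)) (le_trans h2).
Qed.

End PathIntegral.

(** * The stopping problem of one mode *)

Section BigMax.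
Context {R : realType}.

Lemma cvg_bigmaxr (I V : Type) (r : seq I) (p : pred I) (D : set_system V) {FD : Filter D}
    (b : V -> R) (f : I -> V -> R) (lb : R) (l : I -> R) :
  b @ D --> lb -> (forall j, f j @ D --> l j) ->
  (fun x => \big[Num.max/b x]_(j <- r | p j) f j x) @ D -->
  \big[Num.max/lb]_(j <- r | p j) l j.
Proof.
move=> bl fl; elim: r => [|j r IH].
  by rewrite big_nil; under eq_fun do rewrite big_nil.
rewrite big_cons; under eq_fun do rewrite big_cons; case: ifP => // _.
move: IH; set B := (fun x => _); set lB := (X in _ --> X) => IH.
rewrite maxr_absE (_ : (fun x => _) =
  fun x => (f j x + B x + `|f j x - B x|) / 2); last first.
  by apply/funext => x; rewrite maxr_absE.
apply: cvgM; last exact: cvg_cst.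
apply: cvgD; first exact: cvgD (fl j) IH.
by apply: cvg_norm; exact: cvgB (fl j) IH.
Qed.

Lemma measurable_bigmaxr d (W : measurableType d) (I : Type) (r : seq I)
    (p : pred I) (b : W -> R) (f : I -> W -> R) :
  measurable_fun setT b -> (forall j, measurable_fun setT (f j)) ->
  measurable_fun setT (fun x => \big[Num.max/b x]_(j <- r | p j) f j x).
Proof.
move=> mb mf; elim: r => [|j r IH].
  by under eq_fun do rewrite big_nil.
move: IH; set B := (fun x => _) => IH.
rewrite (_ : (fun x => _) = fun x => if p j then Num.max (f j x) (B x) else B x).
  by case: (p j) => //; exact: measurable_maxr.
by apply/funext => x; rewrite big_cons.
Qed.

End BigMax.

Section SwitchingEnvelope.
Context {R : realType} {disp : measure_display} {Omega : measurableType disp}.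
Variables (P : probability Omega R) (T : R) (F : R -> set (set Omega)).
Variables (k m : nat).
Variables (psi : 'I_m -> R -> 'rV[R]_k -> R).
Variables (g : 'I_m -> 'I_m -> R -> 'rV[R]_k -> R).
Variables (X : R -> Omega -> 'rV[R]_k) (Y : 'I_m -> R -> Omega -> R).
Hypotheses (T0 : 0 < T) (hm : (1 < m)%N) (HF : filtration T F).
Hypothesis hpsiX : forall i, M2 P T F (fun t w => psi i t (X t w)).
Hypothesis hgX : forall i j, S2 P T F (fun t w => g i j t (X t w)).
Hypothesis hYS2 : forall i, S2 P T F (Y i).
Hypothesis hY : snell_system P T F psi g X Y.
Implicit Types (s t e : R) (sigma tau : Omega -> R) (A : set Omega) (w : Omega) (i j : 'I_m).

Local Notation stopping := (stopping_time T F).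
Local Notation stopped := (stopped_sigma_algebra T F).
Local Notation leb := (@lebesgue_measure R).

Let T0' : 0 <= T := ltW T0.

(** These are the real numbers behind [obstacle].  A maximum of reals has no
    neutral element and needs a starting value, taken at some mode other than
    [i] so that it does not change the maximum. *)
Definition switch_gain i j s w : R := - g i j s (X s w) + Y j s w.
Definition other_mode i : 'I_m :=
  if i == Ordinal (ltnW hm) then Ordinal hm else Ordinal (ltnW hm).
Definition best_gain i s w : R :=
  \big[Num.max/switch_gain i (other_mode i) s w]_(j < m | j != i) switch_gain i j s w.

Lemma other_modeP i : other_mode i != i.
Proof.
rewrite /other_mode; case: ifPn => [/eqP ->|]; first by rewrite -val_eqE.
by rewrite eq_sym.
Qed.

Lemma best_gain_ge i j s w : j != i -> switch_gain i j s w <= best_gain i s w.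
Proof. by move=> ji; exact: (le_bigmax_cond _ (fun j => switch_gain i j s w) ji). Qed.

Lemma best_gain_attained i s w : exists2 j, j != i & best_gain i s w = switch_gain i j s w.
Proof.
rewrite /best_gain; elim/big_ind : _ => [|x y [j ji ->] [l li ->]|j ji].
- by exists (other_mode i) => //; exact: other_modeP.
- by rewrite /Num.max; case: ifP => _; [exists l|exists j].
- by exists j.
Qed.

Lemma obstacleE i s w : obstacle g X Y i s w = (best_gain i s w)%:E.
Proof.
apply/eqP; rewrite eq_le; apply/andP; split.
  apply/bigmax_leP; split; first exact: leNye.
  by move=> j ji; rewrite lee_fin best_gain_ge.
have [j ji ->] := best_gain_attained i s w.
exact: (le_bigmax_cond _ (fun j => (switch_gain i j s w)%:E) ji).
Qed.

Let cont_g i j w : {within `[0, T], continuous (fun t => g i j t (X t w))}.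
Proof. by have [_ + _] := hgX i j; apply. Qed.

Let cont_Y i w : {within `[0, T], continuous (Y i ^~ w)}.
Proof. by have [_ + _] := hYS2 i; apply. Qed.

Lemma switch_gain_continuous i j w : {within `[0, T], continuous (switch_gain i j ^~ w)}.
Proof. by move=> x; apply: cvgD; [apply: cvgN; exact: cont_g|exact: cont_Y]. Qed.

Lemma best_gain_continuous i w : {within `[0, T], continuous (best_gain i ^~ w)}.
Proof.
by move=> x; apply: cvg_bigmaxr => [|j]; exact: switch_gain_continuous.
Qed.

Lemma switch_gain_adapted i j t : 0 <= t <= T ->
  measurable_fun setT (switch_gain i j t : g_sigma_algebraType (F t) -> R).
Proof.
move=> tT.
have mgij : measurable_fun setT
    ((fun w => g i j t (X t w)) : g_sigma_algebraType (F t) -> R).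
  apply: (progressive_adapted (X := fun t w => g i j t (X t w)) _ tT).
  by case: (hgX i j).
apply: measurable_funD; first exact: measurableT_comp mgij.
by apply: progressive_adapted tT; case: (hYS2 j).
Qed.

Lemma best_gain_adapted i t : 0 <= t <= T ->
  measurable_fun setT (best_gain i t : g_sigma_algebraType (F t) -> R).
Proof. by move=> tT; apply: measurable_bigmaxr => [|j]; exact: switch_gain_adapted. Qed.

Let mbest i t : 0 <= t <= T -> measurable_fun setT (best_gain i t).
Proof. by move=> tT; have /andP[_ tT'] := tT; apply: (measurable_filtration HF tT'); exact: best_gain_adapted tT. Qed.

Definition running i : R -> Omega -> R :=
  path_integral T (fun t w => psi i t (X t w)).

(** Counting profit from time 0 turns the Snell equation of mode [i] into an
    ordinary optimal stopping problem, whose reward does not depend on the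
    starting time. *)
Definition envelope i s w : R := Y i s w + running i s w.
Definition reward i s w : R :=
  running i s w + (if s < T then best_gain i s w else 0).

Definition integrable_profit : set Omega :=
  [set w | forall i, integrable_paths T (fun t w => psi i t (X t w)) w].

(** One variable bounds all the processes of the problem, so that it serves for
    every passage to the limit under an expectation. *)
Lemma switching_dominated : exists U : Omega -> R,
  [/\ summable_rv P U, forall w, 0 <= U w,
      forall i t w, 0 <= t <= T ->
      [/\ `|Y i t w| <= U w, `|best_gain i t w| <= U w,
          `|running i t w| <= U w, `|envelope i t w| <= U w & `|reward i t w| <= U w],
      forall i j t w, 0 <= t <= T -> `|g i j t (X t w)| <= U w &
      forall w, \sum_i path_variation T (fun t w => psi i t (X t w)) T w <= U w].
Proof.
have /choice[UY hUY] j := S2_dominated T0 HF (hYS2 j).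
have /choice[Ug hUg] (p : 'I_m * 'I_m) := S2_dominated T0 HF (hgX p.1 p.2).
pose V1 w := \sum_j UY j w. pose V2 w := \sum_p Ug p w.
pose V3 w := \sum_i path_variation T (fun t w => psi i t (X t w)) T w.
have V3_0 i w : 0 <= path_variation T (fun t w => psi i t (X t w)) T w by exact: Rintegral_ge0.
have leV1 j w : UY j w <= V1 w.
  by rewrite /V1 (bigD1 j)//= lerDl sumr_ge0// => l _; case: (hUY l).
have leV2 p w : Ug p w <= V2 w.
  by rewrite /V2 (bigD1 p)//= lerDl sumr_ge0// => l _; case: (hUg l).
have leV3 i w : path_variation T (fun t w => psi i t (X t w)) T w <= V3 w.
  by rewrite /V3 (bigD1 i)//= lerDl sumr_ge0// => l _; exact: V3_0.
have [p1 p2 p3] : [/\ forall w, 0 <= V1 w, forall w, 0 <= V2 w & forall w, 0 <= V3 w].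
  split=> w; apply: sumr_ge0 => l _; first by case: (hUY l).
    by case: (hUg l).
  exact: V3_0.
have bg2 i j t w : 0 <= t <= T -> `|g i j t (X t w)| <= V2 w.
  by move=> tT; apply: le_trans (leV2 (i, j) w); case: (hUg (i, j)) => _ _; apply.
exists (fun w => (V1 w + V2 w) + V3 w); split.
- apply: summable_rvD; last by apply: summable_rv_sum => i; exact: (path_variation_summable T0 HF (hpsiX i)).
  by apply: summable_rvD; apply: summable_rv_sum => j; [case: (hUY j)|case: (hUg j)].
- by move=> w; rewrite !addr_ge0.
- move=> i t w tT; have := p1 w; have := p2 w; have := p3 w => h3 h2 h1.
  have bY j : `|Y j t w| <= V1 w by apply: le_trans (leV1 j w); case: (hUY j) => _ _; apply.
  have bg j : `|g i j t (X t w)| <= V2 w by exact: bg2.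
  have bb : `|best_gain i t w| <= V1 w + V2 w.
    have [j _ ->] := best_gain_attained i t w.
    rewrite /switch_gain addrC (le_trans (ler_normB _ _))//.
    by rewrite lerD.
  have br : `|running i t w| <= V3 w.
    by apply: le_trans (leV3 i w); exact: (path_integral_bound T0 HF (hpsiX i)).
  split.
  - by apply: le_trans (bY i) _; lra.
  - by apply: le_trans bb _; lra.
  - by apply: le_trans br _; lra.
  - by apply: le_trans (ler_normD _ _) _; have := bY i; lra.
  - apply: le_trans (ler_normD _ _) _; rewrite /=; case: ifP => _; last by rewrite normr0; lra.
    by lra.
- move=> i j t w tT; apply: le_trans (bg2 i j t w tT) _.
  by have := p1 w; have := p3 w; lra.
- by move=> w; have := p1 w; have := p2 w; rewrite /V3; lra.
Qed.

Let prog_Y i : progressive T F (Y i). Proof. by case: (hYS2 i). Qed.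

Let mY i t : 0 <= t <= T -> measurable_fun setT (Y i t).
Proof. exact: (progressive_measurable HF (prog_Y i)). Qed.

Let mrunning i t : measurable_fun setT (running i t).
Proof. exact: (measurable_path_integral T0 HF (hpsiX i)). Qed.

Let cont_running i w : {within `[0, T], continuous (running i ^~ w)}.
Proof. exact: (path_integral_continuous T0 HF (hpsiX i)). Qed.

Lemma envelope_measurable i t : 0 <= t <= T -> measurable_fun setT (envelope i t).
Proof. by move=> tT; apply: measurable_funD; [exact: mY|exact: mrunning]. Qed.

Lemma envelope_continuous i w : {within `[0, T], continuous (envelope i ^~ w)}.
Proof. by move=> x; apply: cvgD; [exact: cont_Y|exact: cont_running]. Qed.

Lemma reward_continuous i w b : b < T -> {within `[0, b], continuous (reward i ^~ w)}.
Proof.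
move=> bT.
have sub : `[0, b] `<=` `[0, T].
  by move=> x /=; rewrite !in_itv/= => /andP[-> /le_trans ->//]; exact: ltW.
have c1 := continuous_subspaceW sub (@cont_running i w).
have c2 := continuous_subspaceW sub (@best_gain_continuous i w).
have : {within `[0, b], continuous (fun s => running i s w + best_gain i s w)}.
  by move=> x; apply: cvgD; [exact: c1|exact: c2].
apply: subspace_eq_continuous => x; rewrite inE /= in_itv/= => /andP[_ xb].
by rewrite /from_subspace /reward /= (le_lt_trans xb bT).
Qed.

Lemma reward_measurable i tau : stopping tau ->
  measurable_fun setT (stopped_value (reward i) tau).
Proof.
move=> h; have mtau := stopping_measurable HF h.
have tauT w := stopping_itv w h.
apply: measurable_funD.
  by apply: (measurable_at_random_time _ _ tauT mtau) => [s _|w];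
    [exact: mrunning|exact: cont_running].
apply: measurable_fun_ifT => //; first exact: measurable_fun_ltr.
by apply: (measurable_at_random_time _ _ tauT mtau) => [s|w];
  [exact: mbest|exact: best_gain_continuous].
Qed.

Lemma ae_integrable_profit : {ae P, forall w, integrable_profit w}.
Proof.
by apply: filter_forall => i; exact: (ae_integrable_paths T0 HF (hpsiX i)).
Qed.

Local Notation payoff := (stopping_payoff T psi g X Y).

Lemma payoff_measurable i t tau : 0 <= t -> stopping tau ->
  measurable_fun setT (payoff i t tau).
Proof.
move=> t0 h; have mtau := stopping_measurable HF h.
apply: emeasurable_funD; last first.
  apply: measurable_fun_ifT => //; first exact: measurable_fun_ltr.
  under eq_fun do rewrite obstacleE.
  apply/measurable_EFinP.
  apply: (measurable_at_random_time _ _ (fun w => stopping_itv w h) mtau) => [s|w];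
  [exact: mbest|exact: best_gain_continuous].
pose hp := horizon_path T (fun t w => psi i t (X t w)).
pose H (p : R * Omega) := if (t <= p.1) && (p.1 <= tau p.2) then hp p else 0.
have mH : measurable_fun setT (fun p => (H p)%:E).
  have mtau2 : measurable_fun setT (fun p : R * Omega => tau p.2).
    exact: (measurableT_comp mtau measurable_snd).
  apply/measurable_EFinP; apply: measurable_fun_ifT => //.
    apply: measurable_and; apply: measurable_fun_ler => //; exact: measurable_fst.
  by have [pX _] := hpsiX i; exact: (progressive_joint T0 HF pX).
have := measurable_joint_integral mH.
congr (measurable_fun _ _); apply/funext => w; rewrite [RHS]integral_mkcond.
apply: eq_integral => s _; rewrite patchE /H /= mem_setE in_itv/=.
case: ifP => // /andP[ts st]; rewrite /hp /horizon_path patchE mem_set//.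
have /andP[_ tT] := stopping_itv w h.
by split => //=; rewrite in_itv/= (le_trans t0 ts) (le_trans st tT).
Qed.

Lemma payoff_reward i t tau w : 0 <= t -> stopping tau -> t <= tau w ->
  integrable_profit w ->
  payoff i t tau w = (stopped_value (reward i) tau w - running i t w)%:E.
Proof.
move=> t0 h tt gw; have /andP[_ tT] := stopping_itv w h.
rewrite /stopping_payoff /stopped_value /reward obstacleE.
rewrite -integral_itv_obnd_cbnd; last first.
  apply: (@eq_measurable_fun _ _ _ _ _ (fun s =>
    (horizon_path T (fun t w => psi i t (X t w)) (s, w))%:E)).
    move=> s; rewrite inE /= in_itv/= => /andP[h1 h2].
    rewrite /horizon_path patchE mem_set//; split => //=.
    by rewrite in_itv/= (le_trans t0 (ltW h1)) (le_trans h2 tT).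
  apply: measurable_funTS; apply/measurable_EFinP; apply: measurable_section.
  by have [pX _] := hpsiX i; exact: (progressive_joint T0 HF pX).
rewrite (integral_path T0 HF (hpsiX i))//.
rewrite -/(running i (tau w) w) -/(running i t w).
by case: ifP => _; rewrite -EFinD; congr EFin; rewrite addrAC.
Qed.

Let payoffs i t : set (Omega -> \bar R) :=
  [set p | exists tau, [/\ stopping tau, forall w, t <= tau w & p = payoff i t tau]].

Let payoffs_measurable i t p : 0 <= t -> payoffs i t p -> measurable_fun setT p.
Proof. by move=> t0 [tau [h1 h2 ->]]; exact: payoff_measurable. Qed.

Let payoffs_nonempty i t : 0 <= t <= T -> payoffs i t !=set0.
Proof.
move=> tT; exists (payoff i t (cst t)), (cst t); split => //.
exact: (stopping_cst HF).
Qed.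

Let payoffs_glue i t p q A : 0 <= t <= T -> payoffs i t p -> payoffs i t q -> F t A ->
  payoffs i t (fun w => if w \in A then p w else q w).
Proof.
move=> tT [tau1 [h1 t1 ->]] [tau2 [h2 t2 ->]] FA.
exists (fun w => if w \in A then tau1 w else tau2 w); split.
- split=> [w|s sT].
    by case: ifP => _; [exact: (stopping_itv w h1)|exact: (stopping_itv w h2)].
  have [ts|st] := leP t s; last first.
    rewrite (_ : [set _ | _] = set0); first exact: (filtration_set0 HF).
    apply/seteqP; split=> w //=; case: ifP => _ ws; [have := t1 w|have := t2 w];
      by rewrite leNgt (le_lt_trans ws st).
  rewrite (_ : [set _ | _] = (A `&` [set w | tau1 w <= s]) `|` (~` A `&` [set w | tau2 w <= s])).
    have FAs := filtration_le HF ts FA.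
    apply: (filtration_setU HF); apply: (filtration_setI HF) => //.
    + exact: (stopping_le h1).
    + exact: (filtration_setC HF).
    + exact: (stopping_le h2).
  apply/seteqP; split=> w /=.
    by case: ifPn; rewrite ?inE ?notin_setE => wA ws; [left|right].
  by case=> -[wA ws]; [rewrite mem_set|rewrite memNset].
- by move=> w; case: ifP.
- by apply/funext => w; rewrite /stopping_payoff; case: ifP.
Qed.

Let payoffs_ess_sup i t : 0 <= t <= T ->
  is_ess_sup P [set Z | exists2 p, payoffs i t p & is_cond_exp P (F t) p Z]
    (fun w => (Y i t w)%:E).
Proof.
move=> tT; have [+ _] := hY => /(_ i t tT).
congr (is_ess_sup P _ _); apply/seteqP; split=> Z /=.
  by move=> [tau [h1 h2 h3]]; exists (payoff i t tau) => //; exists tau.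
by move=> [_ [tau [h1 h2 ->]] h3]; exists tau.
Qed.

Section Dominated.
Variable U : Omega -> R.
Hypotheses (sU : summable_rv P U) (U0 : forall w, 0 <= U w).
Hypothesis dom : forall i t w, 0 <= t <= T ->
  [/\ `|Y i t w| <= U w, `|best_gain i t w| <= U w,
    `|running i t w| <= U w, `|envelope i t w| <= U w & `|reward i t w| <= U w].

Let sUU : summable_rv P (U \+ U). Proof. exact: summable_rvD. Qed.
Let UU0 w : 0 <= (U \+ U) w. Proof. exact: addr_ge0. Qed.

Let payoffs_bounded i t p : 0 <= t <= T -> payoffs i t p ->
  {ae P, forall w, (`|p w| <= ((U \+ U) w)%:E)%E}.
Proof.
move=> tT [tau [h1 h2 ->]]; have /andP[t0 _] := tT.
apply: filterS ae_integrable_profit => w gw.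
rewrite payoff_reward// abse_EFin lee_fin (le_trans (ler_normB _ _))// lerD//.
  by case: (dom i w (stopping_itv w h1)).
by case: (dom i w tT).
Qed.

Let sY i t : 0 <= t <= T -> summable_rv P (Y i t).
Proof.
move=> tT; apply: summable_rv_le sU _; first exact: mY.
by move=> w; case: (dom i w tT).
Qed.

Let srunning i t : 0 <= t <= T -> summable_rv P (running i t).
Proof.
move=> tT; apply: summable_rv_le sU _; first exact: mrunning.
by move=> w; case: (dom i w tT).
Qed.

Let sreward i tau : stopping tau -> summable_rv P (stopped_value (reward i) tau).
Proof.
move=> h; apply: summable_rv_le sU _; first exact: reward_measurable.
by move=> w; case: (dom i w (stopping_itv w h)).
Qed.

Let payoff_expect i t tau A : 0 <= t <= T -> stopping tau -> (forall w, t <= tau w) ->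
  measurable A -> (\int[P]_(w in A) payoff i t tau w =
    (expect P A (stopped_value (reward i) tau) - expect P A (running i t))%:E)%E.
Proof.
move=> tT h tt mA; have /andP[t0 _] := tT.
have sB := summable_rvB (sreward i h) (srunning i tT).
rewrite -expectB//; [|exact: sreward|exact: srunning].
rewrite expectE//; apply: ae_eq_integral => //.
- by apply: measurable_funTS; exact: payoff_measurable.
- by apply: measurable_funTS; exact: measurable_int sB.
- by apply: filterS ae_integrable_profit => w gw _; rewrite payoff_reward.
Qed.

Let expect_envelope i t A : 0 <= t <= T -> measurable A ->
  expect P A (envelope i t) = expect P A (Y i t) + expect P A (running i t).
Proof. by move=> tT mA; apply: expectD => //; [exact: sY|exact: srunning]. Qed.

(** The two halves of the Snell property in integrated form, where conditional
    expectations and essential suprema no longer occur: no time beats the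
    envelope on an event of the past, and some times nearly attain its mean. *)
Lemma reward_le_envelope i t tau A : 0 <= t <= T -> stopping tau ->
  (forall w, t <= tau w) -> F t A ->
  expect P A (stopped_value (reward i) tau) <= expect P A (envelope i t).
Proof.
move=> tT h tt FA; have /andP[t0 tT'] := tT.
have mA := filtration_measurable HF tT' FA.
have := ess_sup_ge (filtration_sigma HF t) (filtration_measurable HF tT')
  (fun p => @payoffs_measurable i t p t0) sUU UU0 (fun p => @payoffs_bounded i t p tT)
  (sY i tT) (payoffs_ess_sup i tT) (p := payoff i t tau) (A := A).
rewrite payoff_expect// expect_envelope// -lerBlDr lee_fin; apply => //.
by exists tau.
Qed.

Lemma reward_near_envelope i t e : 0 <= t <= T -> 0 < e -> exists tau,
  [/\ stopping tau, forall w, t <= tau w &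
      expect P setT (envelope i t) <= expect P setT (stopped_value (reward i) tau) + e].
Proof.
move=> tT e0; have /andP[t0 tT'] := tT.
have [_ [tau [h1 h2 ->]]] := ess_sup_near (filtration_sigma HF t)
  (filtration_measurable HF tT') (payoffs_nonempty i tT)
  (fun p => @payoffs_measurable i t p t0) sUU UU0 (fun p => @payoffs_bounded i t p tT)
  (fun p q A => @payoffs_glue i t p q A tT)
  (sY i tT) (payoffs_ess_sup i tT) e0.
rewrite payoff_expect// -EFinD lee_fin => h.
by exists tau; split => //; rewrite expect_envelope//; lra.
Qed.

(** Stopping at once is admissible, so [Y] dominates the gain at each fixed time,
    hence almost surely at all grid points before the horizon, and by continuity
    at all times before it. *)
Lemma best_gain_le_ae : {ae P, forall w i t, 0 <= t -> t < T -> best_gain i t w <= Y i t w}.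
Proof.
have sb i t : 0 <= t <= T -> summable_rv P (best_gain i t).
  move=> tT; apply: summable_rv_le sU _; first exact: mbest.
  by move=> w; case: (dom i w tT).
have fixed i t : 0 <= t -> t < T -> {ae P, forall w, best_gain i t w <= Y i t w}.
  move=> t0 tT; have tT' : 0 <= t <= T by rewrite t0 ltW.
  pose A := [set w | Y i t w < best_gain i t w].
  have FA : F t A.
    rewrite (filtrationE HF) -[X in measurable X]setTI.
    apply: (measurable_fun_ltr _ (best_gain_adapted i tT')) => //.
    exact: progressive_adapted tT'.
  have mA := filtration_measurable HF (ltW tT) FA.
  have h1 : expect P A (best_gain i t) <= expect P A (Y i t).
    have := reward_le_envelope i tT' (stopping_cst HF tT') (fun=> lexx t) FA.
    rewrite (_ : stopped_value _ _ = (running i t) \+ (best_gain i t)); last first.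
      by apply/funext => w; rewrite /stopped_value /reward /= tT.
    rewrite expectD//; [|exact: srunning|exact: sb].
    by rewrite expect_envelope// addrC lerD2r.
  pose f := (best_gain i t \- Y i t) \_ A.
  have sf : summable_rv P f.
    by apply: summable_rv_indic => //; apply: summable_rvB; [exact: sb|exact: sY].
  have f0 w : 0 <= f w.
    rewrite /f patchE; case: ifPn => //; rewrite inE /A /= => h.
    by rewrite subr_ge0 ltW.
  have fle : expect P setT f <= 0.
    rewrite -expect_mkcond expectB//; [|exact: sb|exact: sY].
    by rewrite subr_le0.
  apply: filterS (expect_le0_ae0 sf f0 fle) => w; rewrite /f patchE.
  case: ifPn => [_ /= /eqP|]; first by rewrite subr_eq0 => /eqP ->.
  by rewrite notin_setE /A /= => /negP; rewrite -leNgt.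
have : {ae P, forall w i N (l : nat), grid T N l < T ->
    best_gain i (grid T N l) w <= Y i (grid T N l) w}.
  apply: filter_forall => i; apply: ae_foralln => N; apply: ae_foralln => l.
  have [lT|lT] := ltP (grid T N l) T; last by apply: aeW.
  have l0 : 0 <= grid T N l by rewrite mulr_ge0// divr_ge0.
  by apply: filterS (fixed i _ l0 lT) => w.
apply: filterS => w hw i t t0 tT.
have tT' : 0 <= t <= T by rewrite t0 ltW.
have cv (Z : R -> Omega -> R) : {within `[0, T], continuous (Z^~ w)} ->
    Z (grid_up T N t) w @[N --> \oo] --> Z t w.
  move=> cZ; apply: (within_continuous_cvg (f := Z^~ w)) => //.
    by move=> N; exact: grid_up_itv.
  exact: cvg_grid_up.
apply: (ler_cvg_to (cv _ (@best_gain_continuous i w)) (cv _ (@cont_Y i w))).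
have : \forall N \near \oo, grid_up T N t < T by exact: (cvgr_lt _ (cvg_grid_up tT') _ tT).
by apply: filterS => N; exact: hw.
Qed.

Let Y_T_ae : {ae P, forall w i, Y i T w = 0}.
Proof. by apply: filter_forall => i; have [_] := hY; apply. Qed.

Lemma reward_le_envelope_ae i :
  {ae P, forall w, forall t, 0 <= t <= T -> reward i t w <= envelope i t w}.
Proof.
apply: filterS2 best_gain_le_ae Y_T_ae => w hb hT t /andP[t0].
rewrite /reward /envelope addrC lerD2r le_eqVlt => /orP[/eqP ->|tT].
  by rewrite ltxx hT.
by rewrite tT hb.
Qed.

Let envelope_bound i t w : 0 <= t <= T -> `|envelope i t w| <= U w.
Proof. by move=> /(dom i w)[]. Qed.

Let reward_bound i t w : 0 <= t <= T -> `|reward i t w| <= U w.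
Proof. by move=> /(dom i w)[]. Qed.

Lemma envelope_summable i tau : stopping tau ->
  summable_rv P (stopped_value (envelope i) tau).
Proof.
exact: (stopping_value_summable HF (@envelope_measurable i) (@envelope_continuous i)
  sU (@envelope_bound i)).
Qed.

Lemma envelope_supermartingale i sigma tau A : stopping sigma -> stopping tau ->
  stopped sigma A -> (forall w, A w -> sigma w <= tau w) ->
  expect P A (stopped_value (envelope i) tau) <=
  expect P A (stopped_value (envelope i) sigma).
Proof.
apply: (optional_stopping T0 HF (@envelope_measurable i) (@envelope_continuous i)
  sU (@envelope_bound i)).
exact: (snell_supermartingale HF (@envelope_measurable i) (@envelope_continuous i) sU
  (@envelope_bound i) (@reward_measurable i) (@reward_bound i)
  (@reward_le_envelope i) (@reward_near_envelope i)).
Qed.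

Lemma envelope_martingale i sigma D A : stopping sigma -> stopping D ->
  stopped sigma A -> (forall w, sigma w <= D w) ->
  (forall w s, A w -> sigma w <= s -> s < D w -> Y i s w <> best_gain i s w) ->
  expect P A (stopped_value (envelope i) D) =
  expect P A (stopped_value (envelope i) sigma).
Proof.
move=> hs hD hA sD hne.
apply: (snell_martingale T0 HF (@envelope_measurable i) (@envelope_continuous i) sU
  (@envelope_bound i) (@reward_measurable i) (@reward_bound i)
  (@reward_le_envelope i) (@reward_near_envelope i)
  (@reward_continuous i) (@reward_le_envelope_ae i)) => //.
move=> w s Aw ss sDw; have /andP[_ DT] := stopping_itv w hD.
rewrite /reward /envelope (lt_le_trans sDw DT) addrC => /addrI.
exact: hne.
Qed.

End Dominated.
End SwitchingEnvelope.

(** * The value of a strategy at its switches *)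

Section ModeSelection.
Context {R : realType} {disp : measure_display} {Omega : measurableType disp}.
Variable m : nat.

Lemma mode_selection_sum (f : 'I_m -> Omega -> R) (xi : Omega -> 'I_m) w :
  f (xi w) w = \sum_i (f i \_ (xi @^-1` [set i])) w.
Proof.
rewrite (bigD1 (xi w))//= patchE mem_set// big1 ?addr0// => i ix.
by rewrite patchE memNset//= => xi_i; rewrite xi_i eqxx in ix.
Qed.

Lemma measurable_mode_selection (f : 'I_m -> Omega -> R) (xi : Omega -> 'I_m) :
  (forall i, measurable (xi @^-1` [set i])) ->
  (forall i, measurable_fun setT (f i)) ->
  measurable_fun setT (fun w => f (xi w) w).
Proof.
move=> mxi mf; rewrite (_ : (fun _ => _) = fun w =>
    \sum_i (f i \_ (xi @^-1` [set i])) w); last first.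
  by apply/funext => w; exact: mode_selection_sum.
apply: measurable_sum => i; apply/(measurable_restrictT _ (mxi i)).
exact: measurable_funTS.
Qed.

End ModeSelection.

Section ModeIndicator.
Context {R : realType} {disp : measure_display} {Omega : measurableType disp}.
Variables (m : nat) (tau : nat -> Omega -> R) (xi : nat -> Omega -> 'I_m).
Hypothesis tau0 : forall w, tau 0%N w = 0.
Hypothesis tau_nd : forall n w, tau n w <= tau n.+1 w.

Lemma switching_times_le n p w : (n <= p)%N -> tau n w <= tau p w.
Proof.
move=> /subnK <-; elim: (p - n)%N => [//|q IH]; rewrite addSn.
exact: le_trans IH (tau_nd _ _).
Qed.

Lemma switching_interval_unique n p w s :
  tau n w < s <= tau n.+1 w -> tau p w < s <= tau p.+1 w -> n = p.
Proof.
move=> /andP[n1 n2] /andP[p1 p2]; apply/eqP; rewrite eqn_leq.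
apply/andP; split; rewrite leqNgt; apply/negP => np.
  by have := lt_le_trans n1 p2; rewrite ltNge switching_times_le.
by have := lt_le_trans p1 n2; rewrite ltNge switching_times_le.
Qed.

Lemma mode_indicator_in n s w : tau n w < s <= tau n.+1 w ->
  mode_indicator tau xi s w = Some (xi n w).
Proof.
move=> hs; have /andP[h1 h2] := hs; rewrite /mode_indicator; case: ifP => s1.
  congr (Some (xi _ w)); apply: (@switching_interval_unique _ _ w s) => //.
  by rewrite s1 andbT (le_lt_trans _ h1)// switching_times_le.
case: pselect => [ex|[]]; last by exists n.
congr (Some (xi _ w)); case: ex_minnP => p hp _.
exact: switching_interval_unique hp hs.
Qed.

Lemma mode_indicator_out s w : 0 < s ->
  (forall n, ~~ (tau n w < s <= tau n.+1 w)) -> mode_indicator tau xi s w = None.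
Proof.
move=> s0 hs; rewrite /mode_indicator; case: ifP => s1.
  by have := hs 0%N; rewrite tau0 s0 s1.
by case: pselect => // -[n hn]; have := hs n; rewrite hn.
Qed.

End ModeIndicator.

Section StrategyValue.
Context {R : realType} {disp : measure_display} {Omega : measurableType disp}.
Variables (P : probability Omega R) (T : R) (F : R -> set (set Omega)).
Variables (k m : nat) (i1 : 'I_m).
Variables (psi : 'I_m -> R -> 'rV[R]_k -> R).
Variables (g : 'I_m -> 'I_m -> R -> 'rV[R]_k -> R).
Variables (X : R -> Omega -> 'rV[R]_k) (Y : 'I_m -> R -> Omega -> R).
Hypotheses (T0 : 0 < T) (hm : (1 < m)%N) (HF : filtration T F).
Hypothesis hdata : switching_data T psi g.
Hypothesis hpsiX : forall i, M2 P T F (fun t w => psi i t (X t w)).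
Hypothesis hgX : forall i j, S2 P T F (fun t w => g i j t (X t w)).
Hypothesis hYS2 : forall i, S2 P T F (Y i).
Hypothesis hY : snell_system P T F psi g X Y.
Implicit Types (s t e : R) (A : set Omega) (w : Omega) (i j : 'I_m).

Local Notation stopping := (stopping_time T F).
Local Notation stopped := (stopped_sigma_algebra T F).
Local Notation leb := (@lebesgue_measure R).
Local Notation run := (running T psi X).
Local Notation env := (envelope T psi X Y).
Local Notation psi_path i := (fun t w => psi i t (X t w)).

Variable U : Omega -> R.
Hypotheses (sU : summable_rv P U) (U0 : forall w, 0 <= U w).
Hypothesis dom : forall i t w, 0 <= t <= T ->
  [/\ `|Y i t w| <= U w, `|best_gain g X Y hm i t w| <= U w,
    `|run i t w| <= U w, `|env i t w| <= U w & `|reward T psi g X Y hm i t w| <= U w].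
Hypothesis dom_g : forall i j t w, 0 <= t <= T -> `|g i j t (X t w)| <= U w.
Hypothesis dom_var : forall w, \sum_i path_variation T (psi_path i) T w <= U w.

Section OneStrategy.
Variables (tau : nat -> Omega -> R) (xi : nat -> Omega -> 'I_m).
Hypothesis st : strategy T F i1 tau xi.

Let tau0 := strategy_tau0 st.
Let tau_nd := strategy_nondecreasing st.
Let tau_st := strategy_stopping st.

Let tauT n w : 0 <= tau n w <= T. Proof. exact: (stopping_itv w (tau_st n)). Qed.

Lemma strategy_mode_stopped n i : stopped (tau n) (xi n @^-1` [set i]).
Proof.
case: n => [|n]; last exact: (strategy_measurable st).
have -> : xi 0 = cst i1 by apply/funext => w; exact: (strategy_xi0 st).
exact: (stopped_preimage_cst HF).
Qed.

Let mxi n i : measurable (xi n @^-1` [set i]).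
Proof.
apply: (filtration_measurable HF (lexx T)).
exact: (stopped_measurable (ltW T0) (tau_st n) (@strategy_mode_stopped n i)).
Qed.

Let mtau n : measurable_fun setT (tau n).
Proof. exact: (stopping_measurable HF (tau_st n)). Qed.

(** [value n] is what the strategy is worth if an optimal one takes over at the
    [n]-th switch; it interpolates between the envelope at time 0 and the total
    profit. *)
Definition accrued n w : R :=
  \sum_(l < n) (run (xi l w) (tau l.+1 w) w - run (xi l w) (tau l w) w).
Definition paid_at l w : R := if tau l.+1 w < T
  then g (xi l w) (xi l.+1 w) (tau l.+1 w) (X (tau l.+1 w) w) else 0.
Definition paid n w : R := \sum_(l < n) paid_at l w.
Definition value n w : R := accrued n w - paid n w + Y (xi n w) (tau n w) w.

Definition envelope_increment n w : R :=
  env (xi n w) (tau n.+1 w) w - env (xi n w) (tau n w) w.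

Let measurable_at_mode (Z : 'I_m -> R -> Omega -> R) n p :
  (forall i t, 0 <= t <= T -> measurable_fun setT (Z i t)) ->
  (forall i w, {within `[0, T], continuous (Z i ^~ w)}) ->
  measurable_fun setT (fun w => Z (xi n w) (tau p w) w).
Proof.
move=> mZ cZ; apply: (measurable_mode_selection (f := fun i w => Z i (tau p w) w)) => // i.
exact: measurable_at_random_time (@mZ i) (cZ i) (tauT p) (mtau p).
Qed.

Let mY i t : 0 <= t <= T -> measurable_fun setT (Y i t).
Proof. by move=> tT; apply: (progressive_measurable HF _ tT); case: (hYS2 i). Qed.

Let cY i w : {within `[0, T], continuous (Y i ^~ w)}.
Proof. by have [_ + _] := hYS2 i; apply. Qed.

Let mrun i t : measurable_fun setT (run i t).
Proof. exact: (measurable_path_integral T0 HF (hpsiX i)). Qed.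

Let crun i w : {within `[0, T], continuous (run i ^~ w)}.
Proof. exact: (path_integral_continuous T0 HF (hpsiX i)). Qed.

Let menv i t : 0 <= t <= T -> measurable_fun setT (env i t).
Proof. exact: (envelope_measurable T0 HF hpsiX hYS2). Qed.

Let cenv i w : {within `[0, T], continuous (env i ^~ w)}.
Proof. exact: (envelope_continuous T0 HF hpsiX hYS2). Qed.

Lemma measurable_accrued n : measurable_fun setT (accrued n).
Proof.
by apply: measurable_sum => l; apply: measurable_funB; apply: measurable_at_mode.
Qed.

Lemma measurable_paid_at l : measurable_fun setT (paid_at l).
Proof.
apply: measurable_fun_ifT => //; first exact: measurable_fun_ltr.
apply: (measurable_mode_selection
  (f := fun i w => g i (xi l.+1 w) (tau l.+1 w) (X (tau l.+1 w) w))) => // i.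
apply: (measurable_mode_selection
  (f := fun j w => g i j (tau l.+1 w) (X (tau l.+1 w) w))) => // j.
have [pg cg _] := hgX i j.
apply: (measurable_at_random_time (Z := fun t w => g i j t (X t w)) _ cg (tauT l.+1) (mtau l.+1)).
by move=> s sT; exact: (progressive_measurable HF pg sT).
Qed.

Lemma measurable_paid n : measurable_fun setT (paid n).
Proof. by apply: measurable_sum => l; exact: measurable_paid_at. Qed.

Lemma measurable_value n : measurable_fun setT (value n).
Proof.
apply: measurable_funD; last exact: measurable_at_mode.
by apply: measurable_funB; [exact: measurable_accrued|exact: measurable_paid].
Qed.

Lemma paid_at_ge0 l w : 0 <= paid_at l w.
Proof. by rewrite /paid_at; case: ifP => // _; apply: (g_ge0 hdata). Qed.

Lemma paid_at_le l w : paid_at l w <= U w.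
Proof.
rewrite /paid_at; case: ifP => // _; apply: le_trans (ler_norm _) _.
exact: dom_g.
Qed.

(** The increments of a running profit are bounded by those of its variation,
    which telescope once the variations of all modes are added. *)
Lemma accrued_le n w : `|accrued n w| <= U w.
Proof.
pose V t := \sum_i path_variation T (psi_path i) t w.
apply: le_trans (dom_var w).
suff h : `|accrued n w| <= V (tau n w).
  apply: le_trans h _; apply: ler_sum => i _.
  have /andP[h0 hT] := tauT n w.
  exact: (path_variation_nd T0 HF (hpsiX i)).
elim: n => [|n IH].
  by rewrite /accrued big_ord0 normr0 tau0 /V sumr_ge0// => i _; exact: Rintegral_ge0.
rewrite /accrued big_ord_recr/= -/(accrued n w) (le_trans (ler_normD _ _))//.
rewrite -[leRHS](subrK (V (tau n w))) addrC lerD//.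
have /andP[h0 hT] := tauT n w.
apply: (@le_trans _ _ (path_variation T (psi_path (xi n w)) (tau n.+1 w) w -
   path_variation T (psi_path (xi n w)) (tau n w) w)).
  exact: (path_integral_variation T0 HF (hpsiX (xi n w))).
rewrite /V -sumrB (bigD1 (xi n w))//= lerDl sumr_ge0// => i _.
by rewrite subr_ge0 (path_variation_nd T0 HF (hpsiX i)).
Qed.

Lemma accrued_summable n : summable_rv P (accrued n).
Proof. by apply: summable_rv_le (measurable_accrued n) sU (accrued_le n). Qed.

Lemma paid_summable n : summable_rv P (paid n).
Proof.
apply: summable_rv_sum => l; apply: summable_rv_le (measurable_paid_at l) sU _ => w.
by rewrite ger0_norm ?paid_at_ge0// paid_at_le.
Qed.

Lemma Y_at_switch_summable n : summable_rv P (fun w => Y (xi n w) (tau n w) w).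
Proof.
apply: summable_rv_le sU _; first exact: measurable_at_mode.
by move=> w; case: (dom (xi n w) w (tauT n w)).
Qed.

Lemma value_summable n : summable_rv P (value n).
Proof.
apply: summable_rvD (Y_at_switch_summable n).
by apply: summable_rvB; [exact: accrued_summable|exact: paid_summable].
Qed.

Lemma envelope_increment_summable n : summable_rv P (envelope_increment n).
Proof.
apply: summable_rvB.
  apply: summable_rv_le sU _; first exact: measurable_at_mode.
  by move=> w; case: (dom (xi n w) w (tauT n.+1 w)).
apply: summable_rv_le sU _; first exact: measurable_at_mode.
by move=> w; case: (dom (xi n w) w (tauT n w)).
Qed.

Let superm := envelope_supermartingale T0 HF hpsiX hgX hYS2 hY sU U0 dom.

Let env_summable i rho : stopping rho -> summable_rv P (stopped_value (env i) rho).
Proof. exact: (envelope_summable T0 HF hpsiX hYS2 sU dom). Qed.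

(** The mode at the [n]-th switch is known then, so the increment splits over the
    modes into increments of the individual envelopes. *)
Lemma expect_envelope_increment n : expect P setT (envelope_increment n) =
  \sum_i (expect P (xi n @^-1` [set i]) (stopped_value (env i) (tau n.+1)) -
          expect P (xi n @^-1` [set i]) (stopped_value (env i) (tau n))).
Proof.
rewrite (expect_partition measurableT (mxi n)).
- apply: eq_bigr => i _; rewrite setTI.
  rewrite -expectB; [|exact: mxi|exact: env_summable|exact: env_summable].
  by apply: eq_expect => w <-.
- by move=> w _; exists (xi n w).
- exact: envelope_increment_summable.
Qed.

Lemma envelope_increment_le0 n : expect P setT (envelope_increment n) <= 0.
Proof.
rewrite expect_envelope_increment; apply: sumr_le0 => i _; rewrite subr_le0.
by apply: superm => //; exact: strategy_mode_stopped.
Qed.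

Lemma value0 w : value 0 w = Y i1 0 w.
Proof.
by rewrite /value /accrued /paid !big_ord0 subr0 add0r tau0 (strategy_xi0 st).
Qed.

Lemma valueS n w : value n.+1 w = value n w + envelope_increment n w -
  (paid_at n w + Y (xi n w) (tau n.+1 w) w - Y (xi n.+1 w) (tau n.+1 w) w).
Proof.
rewrite /value /accrued /paid !big_ord_recr/= /envelope_increment /envelope; lra.
Qed.

Let Y_T_ae : {ae P, forall w i, Y i T w = 0}.
Proof. by apply: filter_forall => i; have [_] := hY; apply. Qed.

(** [Y] dominates the gain from switching before the horizon and vanishes at the
    horizon. *)
Lemma switch_loss_ge0 : {ae P, forall w n,
  0 <= paid_at n w + Y (xi n w) (tau n.+1 w) w - Y (xi n.+1 w) (tau n.+1 w) w}.
Proof.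
have best := best_gain_le_ae T0 HF hpsiX hgX hYS2 hY sU U0 dom.
apply: filterS2 best Y_T_ae => w hb hT n.
have /andP[t0 tT] := tauT n.+1 w; move: tT; rewrite le_eqVlt => /orP[/eqP tT|tT].
  by rewrite /paid_at tT ltxx !hT subr0 addr0.
rewrite /paid_at tT; have := hb (xi n w) _ t0 tT.
have := best_gain_ge g X Y hm (tau n.+1 w) w (strategy_switch st tT).
by rewrite /switch_gain => h1 h2; have := le_trans h1 h2; lra.
Qed.

Lemma value_nonincreasing n : expect P setT (value n.+1) <= expect P setT (value n).
Proof.
apply: (@le_trans _ _ (expect P setT (value n \+ envelope_increment n))).
  apply: ae_le_expect => //; first exact: value_summable.
    by apply: summable_rvD; [exact: value_summable|exact: envelope_increment_summable].
  by apply: filterS switch_loss_ge0 => w h _; rewrite valueS /= gerBl.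
rewrite expectD//; [|exact: value_summable|exact: envelope_increment_summable].
by rewrite gerDl envelope_increment_le0.
Qed.

Lemma value_le n : expect P setT (value n) <= expect P setT (Y i1 0).
Proof.
elim: n => [|n IH]; last exact: le_trans (value_nonincreasing n) IH.
by rewrite (@eq_expect _ _ _ _ _ _ (Y i1 0))// => w _; exact: value0.
Qed.

(** * The running profit along a strategy *)

Let profit_rate s w : R :=
  running_profit psi (mode_indicator tau xi s w) s (X s w).
Let hp i : R * Omega -> R := horizon_path T (psi_path i).
Let interval n i : set (R * Omega) :=
  [set p | tau n p.2 < p.1] `&` [set p | p.1 <= tau n.+1 p.2] `&`
  (setT `*` (xi n @^-1` [set i])).

Let cut_rate : R * Omega -> R := (fun p => profit_rate p.1 p.2) \_ (`]0, T] `*` setT).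

Let measurable_hp i : measurable_fun setT (hp i).
Proof. by have [pX _] := hpsiX i; exact: (progressive_joint T0 HF pX). Qed.

Let measurable_interval n i : measurable (interval n i).
Proof.
have mtau2 l : measurable_fun setT (fun p : R * Omega => tau l p.2).
  exact: (measurableT_comp (mtau l) measurable_snd).
apply: measurableI; last exact: measurableX.
by apply: measurableI; rewrite -[X in measurable X]setTI;
  [apply: measurable_fun_ltr|apply: measurable_fun_ler] => //; exact: measurable_fst.
Qed.

Let hp_in i s w : 0 <= s <= T -> hp i (s, w) = psi i s (X s w).
Proof. by move=> sT; rewrite /hp /horizon_path patchE mem_set//; split=> //=; rewrite in_itv. Qed.

Let interval_term n i s w : (hp i \_ (interval n i)) (s, w) =
  if (tau n w < s <= tau n.+1 w) && (xi n w == i) then psi i s (X s w) else 0.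
Proof.
rewrite patchE; case: ifPn => [|nI].
  rewrite inE => -[[/= h1 h2] [_ /= h3]]; rewrite h1 h2 h3 eqxx/= hp_in//.
  have /andP[t0 _] := tauT n w; have /andP[_ tT] := tauT n.+1 w.
  by rewrite (le_trans t0 (ltW h1)) (le_trans h2 tT).
case: ifPn => // /andP[/andP[h1 h2] /eqP h3]; move: nI.
by rewrite notin_setE; case; split.
Qed.

(** The rate of profit is a limit of finite sums over the switching intervals, at
    most one of which contains a given time. *)
Let measurable_cut_rate : measurable_fun setT cut_rate.
Proof.
apply: (measurable_fun_seq_limit (h := fun N p =>
  \sum_(n < N) \sum_i (hp i \_ (interval n i)) p)) => [N|[s w]].
  apply: measurable_sum => n; apply: measurable_sum => i.
  by apply/(measurable_restrictT _ (measurable_interval n i)); exact: measurable_funTS.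
have inner n : \sum_i (hp i \_ (interval n i)) (s, w) =
    if tau n w < s <= tau n.+1 w then psi (xi n w) s (X s w) else 0.
  rewrite (bigD1 (xi n w))//= interval_term eqxx andbT big1 ?addr0// => i ix.
  by rewrite interval_term eq_sym (negbTE ix) andbF.
under eq_fun do under eq_bigr do rewrite inner.
have [[n hn]|none] := pselect (exists n, tau n w < s <= tau n.+1 w).
  have sT : `]0, T]%classic s.
    rewrite /= in_itv/=; have /andP[h1 h2] := hn.
    have /andP[t0 _] := tauT n w; have /andP[_ tT] := tauT n.+1 w.
    by rewrite (le_lt_trans t0 h1) (le_trans h2 tT).
  rewrite /cut_rate patchE mem_set//= /profit_rate (mode_indicator_in _ tau_nd hn)/=.
  apply: cvg_near_cst; exists n.+1 => // N /= nN.
  rewrite (bigD1 (Ordinal nN))//= hn big1 ?addr0// => l ln.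
  case: ifPn => // hl; have := switching_interval_unique tau_nd hn hl.
  by move=> nl; exfalso; move: ln; rewrite -val_eqE/= nl eqxx.
have -> : cut_rate (s, w) = 0.
  rewrite /cut_rate patchE; case: ifPn => //; rewrite inE => -[+ _].
  rewrite /= in_itv/= => /andP[s0 _]; rewrite /profit_rate mode_indicator_out//.
  by move=> n; apply/negP => hn; apply: none; exists n.
apply: cvg_near_cst; apply: nearW => N; rewrite big1// => n _.
by case: ifPn => // hn; exfalso; apply: none; exists n.
Qed.

Definition total_profit w : \bar R :=
  (\int[leb]_(s in `[0%R, T]) (running_profit psi (mode_indicator tau xi s w) s (X s w))%:E)%E.

Let cut_rate_in s w : 0 < s <= T -> cut_rate (s, w) = profit_rate s w.
Proof. by move=> sT; rewrite /cut_rate patchE mem_set//; split=> //=; rewrite in_itv. Qed.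

Let measurable_profit_rate w (A : set R) : measurable A -> A `<=` `]0, T] ->
  measurable_fun A (fun s => (profit_rate s w)%:E).
Proof.
move=> mA AT; apply: (@eq_measurable_fun _ _ _ _ _ (fun s => (cut_rate (s, w))%:E)).
  by move=> s; rewrite inE => /AT /=; rewrite in_itv/= => /cut_rate_in ->.
apply: measurable_funTS; apply/measurable_EFinP; exact: measurable_section.
Qed.

Let total_profitE w :
  total_profit w = (\int[leb]_(s in `]0%R, T]) (profit_rate s w)%:E)%E.
Proof.
by rewrite /total_profit -integral_itv_obnd_cbnd//; exact: measurable_profit_rate.
Qed.

Lemma total_profit_measurable : measurable_fun setT total_profit.
Proof.
have := measurable_joint_integral (h := fun p => (cut_rate p)%:E).
rewrite (_ : (fun w => _) = total_profit); last first.
  apply/funext => w; rewrite total_profitE [RHS]integral_mkcond.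
  apply: eq_integral => s _; rewrite patchE; case: ifPn.
    by rewrite inE /= in_itv/= => /cut_rate_in ->.
  rewrite notin_setE => sT; rewrite /cut_rate patchE ifF//.
  by apply/negP; rewrite inE => -[].
by apply; exact/measurable_EFinP.
Qed.

Let sub_horizon a b : 0 <= a -> b <= T -> `]a, b] `<=` `]0, T].
Proof.
by move=> a0 bT s /=; rewrite !in_itv/= => /andP[h1 h2]; rewrite (le_lt_trans a0 h1) (le_trans h2 bT).
Qed.

Let accruedE n w : integrable_profit T psi X w ->
  (\int[leb]_(s in `]0%R, tau n w]) (profit_rate s w)%:E = (accrued n w)%:E)%E.
Proof.
move=> gw; elim: n => [|n IH].
  by rewrite tau0 set_itv_ge ?integral_set0 ?/accrued ?big_ord0// bnd_simp ltxx.
have /andP[h0 _] := tauT n w; have /andP[_ hT] := tauT n.+1 w.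
have hS := tau_nd n w.
have -> : `]0, tau n.+1 w]%classic = `]0, tau n w] `|` `]tau n w, tau n.+1 w].
  by rewrite -itv_bndbnd_setU// bnd_simp.
rewrite integral_setU//; last 2 first.
- apply: measurable_profit_rate; first exact: measurableU.
  move=> s [|]; apply: sub_horizon => //; exact: le_trans hS hT.
- apply/disj_setPS => s [] /=; rewrite !in_itv/= => /andP[_ h1] /andP[h2 _].
  by have := lt_le_trans h2 h1; rewrite ltxx.
rewrite IH /accrued big_ord_recr/= EFinD; congr (_ + _)%E.
rewrite -(integral_path T0 HF (hpsiX (xi n w)))//.
apply: eq_integral => s; rewrite inE /= in_itv/= => hs.
by rewrite /profit_rate (mode_indicator_in _ tau_nd hs).
Qed.

Lemma total_profit_accrued n w : integrable_profit T psi X w -> tau n w = T ->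
  total_profit w = (accrued n w)%:E.
Proof. by move=> gw nT; rewrite total_profitE -(accruedE n gw) nT. Qed.

Lemma total_profit_le w : integrable_profit T psi X w ->
  (`|total_profit w| <= (U w)%:E)%E.
Proof.
move=> gw; rewrite total_profitE.
apply: (le_trans (le_abse_integral _ _ _)) => //; first exact: measurable_profit_rate.
apply: (@le_trans _ _ (\sum_i (path_variation T (psi_path i) T w)%:E)%E); last first.
  by rewrite sumEFin lee_fin.
have mrate i : measurable_fun setT (fun s => path_rate T (psi_path i) (s, w)).
  by apply: measurable_section; exact: (measurable_path_rate T0 HF (hpsiX i)).
have mnr i : measurable_fun `]0, T] (fun s => `|path_rate T (psi_path i) (s, w)|%:E).
  by apply/measurable_EFinP; apply: measurable_funTS; exact: measurableT_comp (mrate i).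
have pvE i : ((path_variation T (psi_path i) T w)%:E =
    \int[leb]_(s in `]0%R, T]) `|path_rate T (psi_path i) (s, w)|%:E)%E.
  rewrite integral_itv_obnd_cbnd//.
  rewrite /path_variation /Rintegral fineK// integrable_fin_num//.
  exact: (integrable_norm (path_rate_integrableS T0 HF (hpsiX i) w _)).
under [leRHS]eq_bigr do rewrite pvE.
rewrite -ge0_integral_sum//.
apply: ge0_le_integral => //.
- by apply: measurableT_comp => //; exact: measurable_profit_rate.
- exact: emeasurable_sum.
- move=> s; rewrite /= in_itv/= => /andP[s0 sT].
  rewrite sumEFin lee_fin /profit_rate.
  case: (mode_indicator tau xi s w) => [i|] /=; last by rewrite normr0 sumr_ge0.
  rewrite (bigD1 i)//= (path_rate_good (X := psi_path i))//; last by rewrite ltW.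
  by rewrite lerDl sumr_ge0.
Qed.

(** * Total cost and total profit *)

Local Notation cost := (switching_cost T g X tau xi).

Lemma switching_costE w : cost w = (\sum_(n <oo) (paid_at n w)%:E)%E.
Proof.
by apply: eq_eseriesr => n _; rewrite /paid_at; case: ifP.
Qed.

Lemma switching_cost_ge0 w : (0 <= cost w)%E.
Proof.
by rewrite switching_costE; apply: nneseries_ge0 => n _ _; rewrite lee_fin paid_at_ge0.
Qed.

Lemma switching_cost_measurable : measurable_fun setT cost.
Proof.
rewrite (_ : cost = fun w => (\sum_(n <oo) (paid_at n w)%:E)%E); last first.
  by apply/funext => w; exact: switching_costE.
apply: (@ge0_emeasurable_sum _ _ _ setT (fun n w => (paid_at n w)%:E) predT).
  by move=> n w _ _; rewrite lee_fin paid_at_ge0.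
by move=> n _; apply/measurable_EFinP; exact: measurable_paid_at.
Qed.

Lemma paid_le_cost n w : ((paid n w)%:E <= cost w)%E.
Proof.
rewrite switching_costE /paid -sumEFin -(big_mkord xpredT (fun l => (paid_at l w)%:E)).
by apply: nneseries_lim_ge => l _ _; rewrite lee_fin paid_at_ge0.
Qed.

Lemma after_horizon n p w : tau n w = T -> (n <= p)%N -> tau p w = T.
Proof.
move=> nT np; apply/eqP; rewrite eq_le; have /andP[_ ->] := tauT p w.
by rewrite -nT (switching_times_le tau_nd).
Qed.

Lemma paid_after_horizon n p w : tau n w = T -> (n <= p)%N -> paid p w = paid n w.
Proof.
move=> nT; elim: p => [|p IH]; first by rewrite leqn0 => /eqP ->.
rewrite leq_eqVlt => /orP[/eqP -> //|np]; rewrite /paid big_ord_recr/= -/(paid p w).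
by rewrite IH// /paid_at (after_horizon nT) ?ltxx ?addr0// ltnW.
Qed.

Lemma accrued_after_horizon n p w : tau n w = T -> (n <= p)%N ->
  accrued p w = accrued n w.
Proof.
move=> nT; elim: p => [|p IH]; first by rewrite leqn0 => /eqP ->.
rewrite leq_eqVlt => /orP[/eqP -> //|np]; rewrite /accrued big_ord_recr/= -/(accrued p w).
by rewrite IH// (after_horizon nT np) (after_horizon nT (ltnW np)) subrr addr0.
Qed.

Lemma cost_after_horizon n w : tau n w = T -> cost w = (paid n w)%:E.
Proof.
move=> nT; rewrite switching_costE; apply/cvg_lim => //.
apply: cvg_near_cst; exists n => // p /= np.
by rewrite sumEFin big_mkord -/(paid p w) (paid_after_horizon nT np).
Qed.

(** The accumulation argument applies to the continuous paths of the switching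
    costs for the given outcome. *)
Lemma finite_cost_finite_switches w : (cost w < +oo)%E -> exists n, tau n w = T.
Proof.
move=> cfin; apply: contrapT => nT; move: cfin; apply/negP; rewrite -leNgt leye_eq.
have tlt n : tau n w < T.
  rewrite lt_neqAle; have /andP[_ ->] := tauT n w; rewrite andbT.
  by apply/eqP => h; apply: nT; exists n.
have [alpha alpha0 loop] := g_no_free_loop hdata.
rewrite switching_costE; apply/eqP.
under eq_eseriesr do rewrite /paid_at tlt.
apply: (@infinitely_many_switches_cost _ T alpha _ (fun i j t => g i j t (X t w)) alpha0
  _ _ _ _ _ (xi^~ w) (tau^~ w)) => //.
- by move=> i j; have [_ + _] := hgX i j; apply.
- by move=> i j t tT; exact: (g_ge0 hdata).
- by move=> i t tT; exact: (g_diag hdata).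
- by move=> i j l t *; exact: (g_triangle hdata).
- by move=> i j t *; exact: loop.
- by move=> n; exact: (strategy_switch st).
Qed.

Local Notation total := (profit P T psi g X tau xi).

Let integrable_cost : (\int[P]_w cost w < +oo)%E -> P.-integrable setT cost.
Proof.
move=> cfin; apply/integrableP; split; first exact: switching_cost_measurable.
by under eq_integral do rewrite gee0_abs ?switching_cost_ge0//.
Qed.

Lemma ae_finite_switches : (\int[P]_w cost w < +oo)%E ->
  {ae P, forall w, exists n, tau n w = T}.
Proof.
move=> /integrable_cost/(integrable_ae measurableT).
apply: filterS => w /(_ I); rewrite ge0_fin_numE ?switching_cost_ge0//.
exact: finite_cost_finite_switches.
Qed.

Let good := ae_integrable_profit T0 HF hpsiX.

Lemma total_profit_integrable : P.-integrable setT total_profit.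
Proof.
apply/integrableP; split; first exact: total_profit_measurable.
apply: le_lt_trans (_ : \int[P]_w (U w)%:E < +oo)%E; last exact: integrable_lty.
apply: ae_ge0_le_integral => //.
- exact: measurableT_comp total_profit_measurable.
- by move=> w _; rewrite lee_fin.
- exact: measurable_int sU.
- by apply: filterS good => w gw _; exact: total_profit_le.
Qed.

(** Almost every path stops switching, and from then on its value is its profit,
    since the continuation value vanishes at the horizon.  The total cost enters
    the variable that dominates the values. *)
Lemma value_cvg_profit : (\int[P]_w cost w < +oo)%E -> exists2 x : R,
  total = x%:E & expect P setT (value n) @[n --> \oo] --> x.
Proof.
move=> cfin; have ic := integrable_cost cfin.
have ip := total_profit_integrable.
pose V w := fine (total_profit w) - fine (cost w).
have sV : summable_rv P V by apply: summable_rvB; exact: summable_rv_fine.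
exists (expect P setT V).
  rewrite expectE//; apply: ae_eq_integral => //.
  - by apply: emeasurable_funB; [exact: total_profit_measurable|exact: switching_cost_measurable].
  - exact: measurable_int sV.
  - apply: filterS2 (integrable_ae_fine ip) (integrable_ae_fine ic) => w hp' hc _.
    by rewrite -[X in (X - _)%E]/(total_profit w) hp' hc.
pose W w := (U w + fine (cost w)) + U w.
have sW : summable_rv P W.
  by apply: summable_rvD => //; apply: summable_rvD => //; exact: summable_rv_fine.
apply: (cvg_expect measurableT measurable_value sV sW).
- apply: filterS3 good (ae_finite_switches cfin) Y_T_ae => w gw [n nT] YT _.
  apply: cvg_near_cst; exists n => // p /= np.
  rewrite /value /V (total_profit_accrued gw nT) (cost_after_horizon nT)/=.
  by rewrite (accrued_after_horizon nT np) (paid_after_horizon nT np) (after_horizon nT np) YT addr0.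
- move=> n; apply: filterS (integrable_ae_fine ic) => w hc.
  rewrite /value /W (le_trans (ler_normD _ _))// lerD//; last first.
    by case: (dom (xi n w) w (tauT n w)).
  rewrite (le_trans (ler_normB _ _))// lerD ?accrued_le//.
  have := paid_le_cost n w; rewrite hc lee_fin ger0_norm//.
  by rewrite sumr_ge0// => l _; exact: paid_at_ge0.
Qed.

(** As the running profit is integrable, the expectation of the negative part of
    the profit is infinite and that of its positive part finite. *)
Lemma profit_infinite_cost : ~ (\int[P]_w cost w < +oo)%E -> total = -oo%E.
Proof.
move=> cinf; pose f w := (total_profit w - cost w)%E.
have mf : measurable_fun setT f.
  by apply: emeasurable_funB; [exact: total_profit_measurable|exact: switching_cost_measurable].
have Ufin : (\int[P]_w (U w)%:E < +oo)%E by exact: integrable_lty.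
have mU := measurable_int _ sU.
have U0e w : [set: Omega] w -> (0 <= (U w)%:E)%E by rewrite lee_fin.
have total_fin w : integrable_profit T psi X w ->
    exists2 r : R, total_profit w = r%:E & `|r| <= U w.
  move=> /total_profit_le; case: (total_profit w) => [r|//|//] /=.
  by rewrite lee_fin => h; exists r.
have pos_fin : (\int[P]_w f^\+ w < +oo)%E.
  apply: le_lt_trans Ufin; apply: ae_ge0_le_integral => //.
    exact: measurable_funepos.
  apply: filterS good => w /total_fin[r rE rU] _; rewrite funeposE ge_max U0e// andbT.
  rewrite /f rE; have := switching_cost_ge0 w; case: (cost w) => [c| |//]; last by rewrite leNye.
  rewrite -EFinB !lee_fin => c0; have := ler_norm r; lra.
have neg_inf : (\int[P]_w f^\- w = +oo)%E.
  apply/eqP; rewrite eq_le leey/= leNgt; apply/negP => neg_fin; apply: cinf.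
  apply: (@le_lt_trans _ _ (\int[P]_w (f^\- w + (U w)%:E))%E).
    apply: ae_ge0_le_integral => //.
    - by move=> w _; exact: switching_cost_ge0.
    - exact: switching_cost_measurable.
    - by move=> w _; rewrite adde_ge0// lee_fin.
    - by apply: emeasurable_funD => //; exact: measurable_funeneg.
    - apply: filterS good => w /total_fin[r rE rU] _; rewrite funenegE /f rE.
      have := switching_cost_ge0 w; case: (cost w) => [c| |//] c0.
        rewrite -EFinB -EFinN -EFin_max -EFinD lee_fin.
        have : - (r - c) <= Num.max (- (r - c)) 0 by rewrite le_max lexx.
        by have := ler_norm r; lra.
      by rewrite /= maxye.
  rewrite ge0_integralD//; last exact: measurable_funeneg.
  exact: lte_add_pinfty.
rewrite /profit -/(\int[P]_w f w)%E integralE neg_inf.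
by move: pos_fin; case: (\int[P]_w f^\+ w)%E.
Qed.

Lemma profit_le : (total <= (expect P setT (Y i1 0))%:E)%E.
Proof.
have [cfin|/profit_infinite_cost ->] := pselect (\int[P]_w cost w < +oo)%E; last exact: leNye.
have [x -> hx] := value_cvg_profit cfin.
by rewrite lee_fin; apply: (cvgr_to_le hx); apply: nearW => n; exact: value_le.
Qed.

(** A constant mean of [value n] bounds the mean of the costs paid up to the
    [n]-th switch uniformly in [n], so the expected total cost is finite and the
    values converge to the profit. *)
Lemma optimal_value : (forall n, expect P setT (value n) = expect P setT (Y i1 0)) ->
  (\int[P]_w cost w < +oo)%E /\ total = (expect P setT (Y i1 0))%:E.
Proof.
move=> hv.
have cfin : (\int[P]_w cost w < +oo)%E.
  pose C := expect P setT U + expect P setT U - expect P setT (Y i1 0).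
  apply: (@le_lt_trans _ _ C%:E); last exact: ltry.
  under eq_integral do rewrite switching_costE.
  rewrite integral_nneseries//; last 2 first.
  - by move=> n; apply/measurable_EFinP; exact: measurable_paid_at.
  - by move=> n w _; rewrite lee_fin paid_at_ge0.
  have spaid_at n : summable_rv P (paid_at n).
    apply: summable_rv_le (measurable_paid_at n) sU _ => w.
    by rewrite ger0_norm ?paid_at_ge0// paid_at_le.
  apply: lime_le.
    by apply: is_cvg_nneseries => n _ _; apply: integral_ge0 => w _; rewrite lee_fin paid_at_ge0.
  apply: nearW => n.
  under eq_bigr do rewrite -expectE//.
  rewrite sumEFin lee_fin big_mkord -expect_sum// -/(paid n).
  have := hv n; rewrite /value.
  have sA := accrued_summable n; have sPd := paid_summable n.
  have sYn := Y_at_switch_summable n.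
  have -> : expect P setT (fun w => accrued n w - paid n w + Y (xi n w) (tau n w) w) =
     expect P setT (accrued n) - expect P setT (paid n) +
     expect P setT (fun w => Y (xi n w) (tau n w) w).
    by rewrite -expectB// -expectD//; exact: summable_rvB.
  have hA : expect P setT (accrued n) <= expect P setT U.
    by apply: le_expect => // w _; apply: le_trans (ler_norm _) (accrued_le n w).
  have hYn : expect P setT (fun w => Y (xi n w) (tau n w) w) <= expect P setT U.
    apply: le_expect => // w _; apply: le_trans (ler_norm _) _.
    by case: (dom (xi n w) w (tauT n w)).
  by rewrite /C => hn; lra.
split=> //; have [x -> hx] := value_cvg_profit cfin.
congr EFin; apply: (cvg_unique _ hx) => //.
rewrite (_ : (fun n => _) = cst (expect P setT (Y i1 0))); first exact: cvg_cst.
by apply/funext => n; exact: hv.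
Qed.

End OneStrategy.
End StrategyValue.

(** * Contact times and best modes *)

Section FirstContact.
Context {R : realType}.
Variables (T : R) (Z : R -> R) (sigma D : R).
Hypothesis cZ : {within `[0, T], continuous Z}.
Hypothesis sigmaT : 0 <= sigma <= T.
Hypothesis DE : D%:E = mine (ereal_inf [set s%:E | s in
  [set s | sigma <= s <= T /\ Z s = 0]]) T%:E.

Local Notation contacts := [set s%:E | s in [set s | sigma <= s <= T /\ Z s = 0]].

Lemma first_contact_le : D <= T.
Proof. by rewrite -lee_fin DE ge_min lexx orbT. Qed.

Lemma first_contact_ge : sigma <= D.
Proof.
rewrite -lee_fin DE le_min lee_fin; have /andP[_ ->] := sigmaT.
rewrite andbT; apply: le_ereal_inf_tmp => _ [s [/andP[ss _] _] <-].
by rewrite lee_fin.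
Qed.

Lemma first_contact_before s : sigma <= s -> s < D -> Z s <> 0.
Proof.
move=> ss sD Zs; have := sD; rewrite ltNge => /negP; apply.
rewrite -lee_fin DE ge_min ereal_inf_lbound//.
by exists s => //; split=> //; rewrite ss (le_trans (ltW sD) first_contact_le).
Qed.

Lemma first_contact_at : D < T -> Z D = 0.
Proof.
move=> DT; have DinfE : D%:E = ereal_inf contacts.
  move: DE; rewrite /mine; case: ifP => // _ [] DT'.
  by move: DT; rewrite DT' ltxx.
have D0 : 0 <= D by case/andP: sigmaT => /le_trans h _; exact: h first_contact_ge.
apply: contrapT => ZD.
have nZ0 : 0 < `|Z D| by rewrite normr_gt0; apply/eqP.
have ZcD : Z s @[s --> within `[0, T] (nbhs D)] --> Z D.
  by move/subspace_continuousP : cZ; apply; rewrite /= in_itv/= D0 ltW.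
have /cvgrPdist_lt/(_ _ nZ0) := ZcD.
rewrite near_withinE => /nbhs_ballP[e /= e0 he].
have [_ [s [/andP[ss sT] Zs] <-]] : exists2 x, contacts x & (x < (D + e)%:E)%E.
  by apply: ereal_inf_lt; rewrite -DinfE lte_fin ltrDl.
rewrite lte_fin => sDe.
have Ds : D <= s by rewrite -lee_fin DinfE ereal_inf_lbound//; exists s => //; rewrite /= ss sT.
have : ball D e s by rewrite -ball_normE /= ler0_norm ?subr_le0// opprB ltrBlDl.
move=> /he /=; rewrite in_itv/= (le_trans D0 Ds) sT => /(_ isT).
by rewrite Zs subr0 ltxx.
Qed.

(** Since [Z] is continuous and [sigma, t] is compact, [Z] vanishes somewhere on it
    if and only if it takes arbitrarily small values at grid points of it.  These
    are countably many conditions on the values of [Z] up to time [t]. *)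
Lemma first_contact_leP t : 0 <= t -> t < T ->
  D <= t <-> forall n, exists N l, (l <= N.+1)%N /\
    (sigma <= grid t N l /\ `|Z (grid t N l)| < n.+1%:R^-1).
Proof.
move=> t0 tT; split=> [Dt n|h].
  have DT := le_lt_trans Dt tT.
  have D0 : 0 <= D by case/andP: sigmaT => /le_trans hh _; exact: hh first_contact_ge.
  have Dt' : 0 <= D <= t by rewrite D0.
  have cv : Z (grid_up t N D) @[N --> \oo] --> Z D.
    apply: (within_continuous_cvg cZ).
    - move=> N; have /andP[g0 gt] := grid_up_itv N D t0.
      by rewrite g0 (le_trans gt (ltW tT)).
    - by rewrite D0 ltW.
    - exact: cvg_grid_up.
  have n0 : (0 : R) < n.+1%:R^-1 by rewrite invr_gt0.
  have /cvgrPdist_lt/(_ _ n0)[N _ /(_ N (leqnn N))] := cv.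
  rewrite first_contact_at// sub0r normrN => hN.
  exists N, (grid_index t N D); split; first exact: grid_index_le.
  by split => //; apply: le_trans first_contact_ge _; exact: grid_up_ge.
have [N0 [l0 [lN0 [s0 _]]]] := h 0%N.
have /andP[sg0 sgT] := sigmaT.
have st : sigma <= t.
  by apply: le_trans s0 _; case/andP: (grid_itv t0 lN0).
have cnZ : {within `[sigma, t], continuous (fun s => `|Z s|)}.
  have sub : `[sigma, t] `<=` `[0, T].
    move=> x /=; rewrite !in_itv/= => /andP[h1 h2].
    by rewrite (le_trans sg0 h1) (le_trans h2 (ltW tT)).
  have c := continuous_subspaceW sub cZ.
  by move=> x; apply: cvg_norm; exact: c.
have [c cI cmin] := EVT_min st cnZ; move: cI; rewrite in_itv/= => /andP[sc ct].
have Zc : Z c = 0.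
  apply/normr0_eq0; apply/eqP; rewrite eq_le normr_ge0 andbT.
  apply/ler_addgt0Pr => d d0; rewrite add0r.
  have /cvgrPdist_lt/(_ _ d0)[n _ /(_ n (leqnn n))] := @cvg_harmonic R.
  rewrite /= sub0r normrN ger0_norm ?invr_ge0// => hd.
  have [N [l [lN [sl Zl]]]] := h n.
  have := cmin (grid t N l); rewrite in_itv/= sl; have /andP[_ ->] := grid_itv t0 lN.
  by move=> /(_ isT) /le_trans -> //; exact: ltW (lt_trans Zl hd).
rewrite leNgt; apply/negP => tD.
exact: (first_contact_before sc (le_lt_trans ct tD) Zc).
Qed.

End FirstContact.

Section BestMode.
Context {R : realType}.
Variables (m : nat) (hm : (1 < m)%N).
Implicit Types (v : 'I_m -> R) (i j l : 'I_m).

Definition is_best i v j : bool :=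
  (j != i) && [forall (l | l != i), v l <= v j].

(** Several modes may attain the maximum; the choice of the least one depends
    measurably on the gains. *)
Definition is_first_best i v j : bool :=
  is_best i v j && [forall (l : 'I_m | (l < j)%N), ~~ is_best i v l].
Definition first_best i v : 'I_m :=
  odflt (other_mode hm i) [pick j | is_first_best i v j].

Lemma first_bestP i v : is_first_best i v (first_best i v).
Proof.
rewrite /first_best; case: pickP => //= none.
have ex : exists j, is_best i v j.
  have io := other_modeP hm i.
  exists [arg max_(j > other_mode hm i | j != i) v j]%O; rewrite /is_best.
  case: arg_maxP => //= j ji jmax; rewrite ji/=.
  by apply/forall_inP => l li; exact: jmax.
have [j0 hj0] := ex.
have := none [arg min_(j < j0 | is_best i v j) (j : nat)].
case: arg_minnP => //= j hj jmin; rewrite /is_first_best hj/= => /negbT/negP[].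
apply/forall_inP => l lj; apply/negP => /jmin; by rewrite leqNgt lj.
Qed.

Lemma first_best_eq i v j : (first_best i v == j) = is_first_best i v j.
Proof.
apply/idP/idP => [/eqP <-|hj]; first exact: first_bestP.
have /andP[h1 /forall_inP h2] := first_bestP i v.
have /andP[h3 /forall_inP h4] := hj.
case: (ltngtP (first_best i v) j) => [lt|gt|eq].
- by have := h4 _ lt; rewrite h1.
- by have := h2 _ gt; rewrite h3.
- by apply/eqP/val_inj.
Qed.

Lemma measurable_forall_in d (W : measurableType d) (p : pred 'I_m) (b : 'I_m -> W -> bool) :
  (forall l, measurable_fun setT (b l)) ->
  measurable_fun setT (fun w => [forall (l | p l), b l w]).
Proof.
move=> mb; rewrite (_ : (fun w => _) = fun w => \big[andb/true]_(l | p l) b l w); last first.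
  by apply/funext => w; rewrite big_andE.
elim: (index_enum _) => [|l r IH].
  by rewrite (_ : (fun w => _) = cst true)//; apply/funext => w; rewrite big_nil.
rewrite (_ : (fun w => _) = fun w =>
  if p l then b l w && \big[andb/true]_(l <- r | p l) b l w
  else \big[andb/true]_(l <- r | p l) b l w); last first.
  by apply/funext => w; rewrite big_cons.
by case: (p l) => //; exact: measurable_and.
Qed.

Lemma measurable_first_best d (W : measurableType d) i j (v : 'I_m -> W -> R) :
  (forall l, measurable_fun setT (v l)) ->
  measurable [set w | first_best i (v^~ w) = j].
Proof.
move=> mv.
have mbest l : measurable_fun setT (fun w => is_best i (v^~ w) l).
  apply: measurable_and => //; apply: measurable_forall_in => l'.
  exact: measurable_fun_ler.
have mfirst : measurable_fun setT (fun w => is_first_best i (v^~ w) j).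
  apply: measurable_and => //; apply: measurable_forall_in => l.
  exact: measurable_neg.
rewrite (_ : [set _ | _] = (fun w => is_first_best i (v^~ w) j) @^-1` [set true]).
  by rewrite -[X in measurable X]setTI; exact: mfirst.
apply/seteqP; split=> w /=; first by move=> /eqP; rewrite first_best_eq.
by rewrite -first_best_eq => /eqP.
Qed.

End BestMode.

(** * The candidate strategy *)

Section Candidate.
Context {R : realType} {disp : measure_display} {Omega : measurableType disp}.
Variables (P : probability Omega R) (T : R) (F : R -> set (set Omega)).
Variables (k m : nat) (i1 : 'I_m).
Variables (psi : 'I_m -> R -> 'rV[R]_k -> R).
Variables (g : 'I_m -> 'I_m -> R -> 'rV[R]_k -> R).
Variables (X : R -> Omega -> 'rV[R]_k) (Y : 'I_m -> R -> Omega -> R).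
Hypotheses (T0 : 0 < T) (hm : (1 < m)%N) (HF : filtration T F).
Hypothesis hgX : forall i j, S2 P T F (fun t w => g i j t (X t w)).
Hypothesis hYS2 : forall i, S2 P T F (Y i).
Implicit Types (s t e : R) (A : set Omega) (w : Omega) (i j : 'I_m).

Local Notation stopping := (stopping_time T F).
Local Notation stopped := (stopped_sigma_algebra T F).
Local Notation best := (best_gain g X Y hm).

Definition contact_gap i s w : R := Y i s w - best i s w.

Definition contact_inf i s w : \bar R :=
  mine (ereal_inf [set x%:E | x in
    [set x | s <= x <= T /\ (Y i x w)%:E = obstacle g X Y i x w]]) T%:E.

Lemma contact_infE i s w : contact_inf i s w =
  mine (ereal_inf [set x%:E | x in [set x | s <= x <= T /\ contact_gap i x w = 0]]) T%:E.
Proof.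
rewrite /contact_inf; congr (mine (ereal_inf (image _ _)) _).
apply/seteqP; split=> x /= [h1 h2]; split=> //.
  by move: h2; rewrite (obstacleE _ _ _ hm) /contact_gap => -[->]; rewrite subrr.
by rewrite (obstacleE _ _ _ hm); congr EFin; apply/eqP; rewrite -subr_eq0; apply/eqP.
Qed.

Lemma contact_gap_continuous i w : {within `[0, T], continuous (contact_gap i ^~ w)}.
Proof.
have cY : {within `[0, T], continuous (Y i ^~ w)} by have [_ + _] := hYS2 i; apply.
by move=> x; apply: cvgB; [exact: cY|exact: (best_gain_continuous hgX hYS2)].
Qed.

Lemma contact_gap_adapted i t : 0 <= t <= T ->
  measurable_fun setT (contact_gap i t : g_sigma_algebraType (F t) -> R).
Proof.
move=> tT; apply: measurable_funB; last exact: (best_gain_adapted hm hgX hYS2).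
by apply: progressive_adapted tT; case: (hYS2 i).
Qed.

(** A contact before [t] is detected by the values of the gap at countably many
    times up to [t], while [sigma] and the mode chosen at [sigma] are known at
    [t] on the event that [sigma] is at most [t]. *)
Lemma contact_time_stopping (sigma D : Omega -> R) (x : Omega -> 'I_m) :
  stopping sigma -> (forall i, stopped sigma (x @^-1` [set i])) ->
  (forall w, (D w)%:E = contact_inf (x w) (sigma w) w) -> stopping D.
Proof.
move=> hs hx hD.
have DE w : (D w)%:E = mine (ereal_inf [set s%:E | s in
    [set s | sigma w <= s <= T /\ contact_gap (x w) s w = 0]]) T%:E.
  by rewrite hD contact_infE.
have sT w := stopping_itv w hs.
have D0 w : 0 <= D w.
  by case/andP: (sT w) => /le_trans h _; exact: h (first_contact_ge (sT w) (DE w)).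
split=> [w|t /andP[t0 tT]]; first by rewrite D0 (first_contact_le (DE w)).
move: tT; rewrite le_eqVlt => /orP[/eqP ->|tT].
  rewrite (_ : [set _ | _] = setT); first exact: (filtration_setT HF).
  by apply/seteqP; split=> // w _; exact: (first_contact_le (DE w)).
pose E i n N l : set Omega :=
  [set w | sigma w <= grid t N l] `&` [set w | `|contact_gap i (grid t N l) w| < n.+1%:R^-1].
rewrite (_ : [set _ | _] = \bigcup_i ((x @^-1` [set i] `&` [set w | sigma w <= t]) `&`
  \bigcap_n \bigcup_N \bigcup_l (if (l <= N.+1)%N then E i n N l else set0))); last first.
  apply/seteqP; split=> w /=.
    move=> Dt; exists (x w) => //; split.
      by split => //; exact: le_trans (first_contact_ge (sT w) (DE w)) Dt.
    move=> n _; have := (first_contact_leP (@contact_gap_continuous (x w) w) (sT w) (DE w) t0 tT).1 Dt n.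
    by move=> [N [l [lN [h1 h2]]]]; exists N => //; exists l => //; rewrite lN.
  move=> [i _ [[xi _] h]].
  apply/(first_contact_leP (@contact_gap_continuous (x w) w) (sT w) (DE w) t0 tT) => n.
  have [N _ [l _]] := h n I; case: ifP => // lN [h1 h2].
  by exists N, l; split=> //; rewrite xi.
apply: (filtration_fin_bigcup HF) => i; apply: (filtration_setI HF).
  by apply: hx; rewrite t0 ltW.
apply: (filtration_bigcap HF) => n; apply: (filtration_bigcup HF) => N.
apply: (filtration_bigcup HF) => l; case: ifP => lN; last exact: (filtration_set0 HF).
have /andP[g0 gt] := grid_itv t0 lN.
have gT : 0 <= grid t N l <= T by rewrite g0 (le_trans gt (ltW tT)).
apply: (filtration_le HF gt); apply: (filtration_setI HF); first exact: (stopping_le hs).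
rewrite (filtrationE HF) -[X in measurable X]setTI.
apply: (measurable_fun_ltr _ (measurable_cst (n.+1%:R^-1 : R))) => //.
by apply: measurableT_comp => //; exact: contact_gap_adapted.
Qed.

Section OneCandidate.
Variables (tau : nat -> Omega -> R) (xi : nat -> Omega -> 'I_m).
Hypothesis cand : optimal_candidate T F i1 g X Y tau xi.

Let tauE n w : (tau n.+1 w)%:E = contact_inf (xi n w) (tau n w) w.
Proof. exact: (candidate_tauS cand). Qed.

Let tauE' n w := etrans (tauE n w) (contact_infE _ _ _).

Lemma candidate_stopping n :
  stopping (tau n) /\ forall i, stopped (tau n) (xi n @^-1` [set i]).
Proof.
elim: n => [|n [h1 h2]]; last first.
  split; first exact: contact_time_stopping h1 h2 (tauE n).
  by move=> i; exact: (candidate_measurable cand).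
have -> : tau 0 = cst 0 by apply/funext => w; exact: (candidate_tau0 cand).
have -> : xi 0 = cst i1 by apply/funext => w; exact: (candidate_xi0 cand).
have h0 : stopping (cst 0) by apply: (stopping_cst HF); rewrite lexx ltW.
by split => // i; exact: (stopped_preimage_cst HF).
Qed.

Let tauT n w : 0 <= tau n w <= T.
Proof. by have [h _] := candidate_stopping n; exact: stopping_itv h. Qed.

Lemma candidate_nondecreasing n w : tau n w <= tau n.+1 w.
Proof. exact: (first_contact_ge (tauT n w) (tauE' n w)). Qed.

Lemma candidate_strategy : strategy T F i1 tau xi.
Proof.
split.
- exact: (candidate_tau0 cand).
- exact: (candidate_xi0 cand).
- by move=> n; case: (candidate_stopping n).
- exact: candidate_nondecreasing.
- exact: (candidate_measurable cand).
- by move=> n w _; exact: (candidate_switch cand).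
Qed.

Lemma candidate_before_contact n w s : tau n w <= s -> s < tau n.+1 w ->
  Y (xi n w) s w <> best (xi n w) s w.
Proof.
move=> h1 h2 h3; apply: (first_contact_before (tauE' n w) h1 h2).
by rewrite /contact_gap h3 subrr.
Qed.

Lemma candidate_at_contact n w : tau n.+1 w < T ->
  Y (xi n w) (tau n.+1 w) w = switch_gain g X Y (xi n w) (xi n.+1 w) (tau n.+1 w) w.
Proof.
move=> tT; have := first_contact_at (@contact_gap_continuous (xi n w) w) (tauT n w) (tauE' n w) tT.
move=> /eqP; rewrite subr_eq0 => /eqP ->.
by have := candidate_argmax cand n w; rewrite (obstacleE _ _ _ hm) => -[].
Qed.

Hypothesis hdata : switching_data T psi g.
Hypothesis hpsiX : forall i, M2 P T F (fun t w => psi i t (X t w)).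
Hypothesis hY : snell_system P T F psi g X Y.
Variable U : Omega -> R.
Hypotheses (sU : summable_rv P U) (U0 : forall w, 0 <= U w).
Hypothesis dom : forall i t w, 0 <= t <= T ->
  [/\ `|Y i t w| <= U w, `|best i t w| <= U w,
    `|running T psi X i t w| <= U w, `|envelope T psi X Y i t w| <= U w &
    `|reward T psi g X Y hm i t w| <= U w].
Hypothesis dom_g : forall i j t w, 0 <= t <= T -> `|g i j t (X t w)| <= U w.
Hypothesis dom_var : forall w,
  \sum_i path_variation T (fun t w => psi i t (X t w)) T w <= U w.

(** Between switches the envelope of the current mode is a martingale, as there is
    no contact, and at a switch the cost equals the gain of the continuation
    value. *)
Lemma candidate_value n :
  expect P setT (value T psi g X Y tau xi n) = expect P setT (Y i1 0).
Proof.
have st := candidate_strategy.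
have sV := value_summable T0 HF hdata hpsiX hgX hYS2 sU U0 dom dom_g dom_var st.
have sE := envelope_increment_summable T0 HF hpsiX hYS2 sU dom st.
elim: n => [|n <-].
  by rewrite (@eq_expect _ _ _ _ _ _ (Y i1 0))// => w _; exact: (value0 _ _ _ _ st).
have inc0 : expect P setT (envelope_increment T psi X Y tau xi n) = 0.
  rewrite (expect_envelope_increment T0 HF hpsiX hYS2 sU dom st).
  apply: big1 => i _; apply/eqP; rewrite subr_eq0; apply/eqP.
  have [s1 h1] := candidate_stopping n; have [s2 _] := candidate_stopping n.+1.
  apply: (envelope_martingale T0 HF hpsiX hgX hYS2 hY sU U0 dom) => //.
    exact: candidate_nondecreasing.
  by move=> w s <-; exact: candidate_before_contact.
rewrite -[RHS]addr0 -inc0 -expectD//.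
apply: ae_eq_expect => //; first exact: summable_rvD.
have YT : {ae P, forall w i, Y i T w = 0}.
  by apply: filter_forall => i; have [_] := hY; apply.
apply: filterS YT => w hT _; rewrite valueS /= /paid_at.
have /andP[_ tT] := tauT n.+1 w; move: tT; rewrite le_eqVlt => /orP[/eqP tT|tT].
  by rewrite tT ltxx !hT subr0 addr0 subr0.
rewrite tT candidate_at_contact// /switch_gain; lra.
Qed.

End OneCandidate.

(** The least best mode is known at the contact time, so that the recursion stays
    within stopping times and modes known at them. *)
Lemma candidate_exists : exists (tau : nat -> Omega -> R) (xi : nat -> Omega -> 'I_m),
  optimal_candidate T F i1 g X Y tau xi.
Proof.
pose D (x : Omega -> 'I_m) (sigma : Omega -> R) w := fine (contact_inf (x w) (sigma w) w).
pose B (x : Omega -> 'I_m) (rho : Omega -> R) w :=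
  first_best hm (x w) (fun l => switch_gain g X Y (x w) l (rho w) w).
pose S := fix S n := if n is n'.+1
  then (D (S n').2 (S n').1, B (S n').2 (D (S n').2 (S n').1))
  else (cst 0, cst i1).
pose tau n := (S n).1; pose xi n := (S n).2.
have DE x sigma w : 0 <= sigma w -> (D x sigma w)%:E = contact_inf (x w) (sigma w) w.
  move=> s0; rewrite /D fineK// fin_numE; apply/andP; split.
    rewrite -ltNye; apply: (@lt_le_trans _ _ (Num.min (sigma w) T)%:E); first exact: ltNye.
    rewrite le_min lee_fin ge_min lexx orbT andbT.
    apply: le_ereal_inf_tmp => _ [s [/andP[ss _] _] <-].
    by rewrite lee_fin ge_min ss.
  by rewrite -ltey; apply: le_lt_trans (ltry T); rewrite ge_min lexx orbT.
have mB x rho : stopping rho -> (forall i, stopped rho (x @^-1` [set i])) ->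
    forall j, stopped rho (B x rho @^-1` [set j]).
  move=> hr hx j t tT; have /andP[t0 tT'] := tT.
  pose v i l w := switch_gain g X Y i l (Num.min (rho w) t) w.
  have mv i l : measurable_fun setT (v i l : g_sigma_algebraType (F t) -> R).
    have mr := stopping_capped_measurable HF hr tT.
    have rt w : 0 <= Num.min (rho w) t <= t.
      by have /andP[r0 _] := stopping_itv w hr; rewrite le_min ge_min lexx r0 t0 orbT.
    apply: (measurable_at_random_time (Z := fun s (w : g_sigma_algebraType (F t)) =>
      switch_gain g X Y i l s w) _ _ rt mr) => [s /andP[s0 st]|w].
      have sT : 0 <= s <= T by rewrite s0 (le_trans st).
      exact: (adapted_le HF st (switch_gain_adapted hgX hYS2 i l sT)).
    have sub : `[0, t] `<=` `[0, T].
      by move=> y /=; rewrite !in_itv/= => /andP[-> /le_trans ->].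
    exact: (continuous_subspaceW sub (fun y => @switch_gain_continuous _ _ _ _ _ _ _ _ _ _ _ hgX hYS2 i l w y)).
  rewrite (_ : _ `&` _ = \bigcup_i ((x @^-1` [set i] `&` [set w | rho w <= t]) `&`
      [set w | first_best hm i ((v i)^~ w) = j])); last first.
    have vE w : rho w <= t ->
        (fun l => switch_gain g X Y (x w) l (rho w) w) = (v (x w))^~ w.
      by move=> /min_idPl rt; apply/funext => l; rewrite /v rt.
    apply/seteqP; split=> w /=.
      by move=> [Bj rt]; exists (x w) => //; split => //=; rewrite -vE.
    by move=> [i _ [[<- rt] /= Bj]]; split => //; rewrite /B vE.
  apply: (filtration_fin_bigcup HF) => i; apply: (filtration_setI HF); first exact: hx.
  rewrite (filtrationE HF); apply: measurable_first_best => l; exact: mv.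
have inv n : stopping (tau n) /\ forall i, stopped (tau n) (xi n @^-1` [set i]).
  elim: n => [|n [h1 h2]].
    have h0 : stopping (cst 0) by apply: (stopping_cst HF); rewrite lexx ltW.
    by split => // i; exact: (stopped_preimage_cst HF).
  have hD : stopping (tau n.+1).
    apply: (contact_time_stopping h1 h2) => w; apply: DE.
    by case/andP: (stopping_itv w h1).
  have nd w : tau n w <= tau n.+1 w.
    have DEw := etrans (DE (xi n) (tau n) w (proj1 (andP (stopping_itv w h1))))
      (contact_infE _ _ _).
    exact: (first_contact_ge (stopping_itv w h1) DEw).
  by split=> // i; apply: mB => // j; exact: (stopped_le HF hD nd (h2 j)).
exists tau, xi; split => //.
- move=> n w; apply: DE; have [h _] := inv n.
  by case/andP: (stopping_itv w h).
- by move=> n i; have [_] := inv n.+1; exact.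
- move=> n w; have /andP[/andP[h _] _] := first_bestP hm (xi n w)
    (fun l => switch_gain g X Y (xi n w) l (tau n.+1 w) w).
  exact: h.
- move=> n w; rewrite (obstacleE _ _ _ hm); congr EFin.
  have /andP[/andP[h1 /forall_inP h2] _] := first_bestP hm (xi n w)
    (fun l => switch_gain g X Y (xi n w) l (tau n.+1 w) w).
  apply/eqP; rewrite eq_le; apply/andP; split; first exact: best_gain_ge h1.
  have [j ji ->] := best_gain_attained g X Y hm (xi n w) (tau n.+1 w) w.
  exact: h2.
Qed.

End Candidate.

(** * The initial sigma-algebra *)

Section CompletedFiltration.
Context {R : realType} {disp : measure_display} {Omega : measurableType disp}.
Variables (P : probability Omega R) (T : R) (d : nat).
Variable B : R -> Omega -> 'rV[R]_d.
Hypotheses (T0 : 0 < T) (hB : brownian_motion P T B).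

Lemma completed_filtrationP : filtration T (completed_filtration P B).
Proof.
split.
- by move=> t; exact: smallest_sigma_algebra.
- move=> s t st; apply: sub_sigma_algebra2 => A [[r [a [V [/andP[r0 rs] mV ->]]]]|]; last by right.
  by left; exists r, a, V; split => //; rewrite r0 (le_trans rs).
- move=> t tT; apply: smallest_sub; first exact: sigma_algebra_measurable.
  move=> A [[r [a [V [/andP[r0 rt] mV ->]]]]|[]//].
  rewrite -[X in measurable X]setTI; apply: (bm_measurable hB) => //.
  by rewrite r0 (le_trans rt).
Qed.

(** The Brownian motion starts at a fixed point almost surely, so each generating
    event is null or of full measure. *)
Lemma completed_filtration0 A : completed_filtration P B 0 A ->
  P A = 0%E \/ P A = 1%E.
Proof.
pose G : set (set Omega) := [set A | measurable A /\ (P A = 0%E \/ P A = 1%E)].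
suff h : completed_filtration P B 0 `<=` G by move=> /h [].
apply: smallest_sub.
  split.
  - by split => //; left; exact: measure0.
  - move=> C [mC hC]; split; first exact: measurableD.
    rewrite setTD probability_setC//; case: hC => ->; [right|left].
      by rewrite sube0.
    by rewrite subee.
  - move=> C hC; have mC n : measurable (C n) by case: (hC n).
    have mU : measurable (\bigcup_n C n) by exact: bigcupT_measurable.
    split => //; have [[n Cn]|h] := pselect (exists n, P (C n) = 1%E); [right|left].
      apply/eqP; rewrite eq_le probability_le1//= -Cn.
      by apply: le_measure; rewrite ?inE//; exact: bigcup_sup.
    apply/negligibleP => //; apply: negligible_bigcup => n; apply/negligibleP => //.
    by have [_ []] := hC n => // h1; exfalso; apply: h; exists n.
move=> A' [[s [a [V [s0 mV ->]]]]|[mA A0]]; last by split; [|left].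
have -> : s = 0 by apply/le_anti; rewrite andbC.
have mA : measurable [set w | V (B 0 w ord0 a)].
  by rewrite -[X in measurable X]setTI; apply: (bm_measurable hB) => //; rewrite lexx ltW.
split => //; have [V0|V0] := pselect (V 0); [right|left].
  rewrite -(@probability_setT _ _ _ P).
  have [N [mN N0 sN]] := bm_start hB.
  apply/eqP; rewrite eq_le le_measure ?inE//= -[leRHS]adde0 -N0.
  apply: (@le_trans _ _ (P ([set w | V (B 0 w ord0 a)] `|` N))); last exact: measureU2.
  apply: le_measure; rewrite ?inE//; first exact: measurableU.
  move=> w _; have [B0|B0] := pselect (B 0 w = 0); last by right; exact: sN.
  by left; rewrite /= B0 mxE.
apply/negligibleP => //; apply: negligibleS (bm_start hB) => w /= VB B0.
by apply: V0; move: VB; rewrite B0 mxE.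
Qed.

End CompletedFiltration.

(** The event that [f] is below its mean is null or of full measure, so [f] stays
    on one side of its mean. *)
Lemma trivial_sigma_algebra_constant {R : realType} disp (Omega : measurableType disp)
    (P : probability Omega R) (G : set (set Omega)) (f : Omega -> R) :
  sigma_algebra setT G -> (forall A, G A -> P A = 0%E \/ P A = 1%E) ->
  measurable_fun setT (f : g_sigma_algebraType G -> R) -> summable_rv P f ->
  {ae P, forall w, f w = expect P setT f}.
Proof.
move=> sG trG mf sf; set c := expect P setT f.
have sc : summable_rv P (cst c) by exact: summable_rv_cst.
have Ec : expect P setT (cst c) = c.
  rewrite /expect Rintegral_cst// [X in fine X](_ : _ = 1%E); last exact: probability_setT.
  by rewrite mulr1.
have mfP : measurable_fun setT f by exact: summable_measurable sf.
(* A variable that stays on one side of its mean is equal to it. *)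
have side (h : Omega -> R) : summable_rv P h -> expect P setT h = 0 ->
    {ae P, forall w, 0 <= h w} -> {ae P, forall w, h w = 0}.
  move=> sh h0 hge; have sn := summable_rv_norm sh.
  have : expect P setT (fun w => `|h w|) <= 0.
    rewrite -h0; apply: ae_le_expect => //.
    by apply: filterS hge => w hw _; rewrite ger0_norm.
  move=> /(expect_le0_ae0 sn (fun w => normr_ge0 _)).
  by apply: filterS => w /eqP; rewrite normr_eq0 => /eqP.
pose A := [set w | f w < c].
have GA : G A.
  rewrite -(sigma_algebra_id sG).
  suff : measurable (A : set (g_sigma_algebraType G)) by [].
  rewrite -[X in measurable X]setTI.
  exact: (measurable_fun_ltr mf (measurable_cst c)).
have mA : measurable A.
  by rewrite -[X in measurable X]setTI; exact: (measurable_fun_ltr mfP (measurable_cst c)).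
have [PA|PA] := trG _ GA.
  have ge0 : {ae P, forall w, 0 <= f w - c}.
    exists A; split => // w /= h; rewrite /A /= ltNge; apply/negP => cf.
    by apply: h; rewrite subr_ge0.
  have := side _ (summable_rvB sf sc) _ ge0.
  rewrite expectB// Ec subrr => /(_ erefl).
  by apply: filterS => w /eqP; rewrite subr_eq0 => /eqP.
have le0 : {ae P, forall w, 0 <= c - f w}.
  exists (~` A); split; first exact: measurableC.
    by rewrite probability_setC// PA subee.
  by move=> w /= h Aw; apply: h; rewrite subr_ge0 ltW.
have := side _ (summable_rvB sc sf) _ le0.
rewrite expectB// Ec subrr => /(_ erefl).
by apply: filterS => w /= /eqP; rewrite subr_eq0 => /eqP ->.
Qed.

(** * Verification *)

Theorem theorem3p1 (R : realType) (T : R) (hT : 0 < T)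
    (k d m : nat) (hk : (1 <= k)%N) (hd : (1 <= d)%N) (hm : (1 < m)%N)
    (psi : 'I_m -> R -> 'rV[R]_k -> R)
    (g : 'I_m -> 'I_m -> R -> 'rV[R]_k -> R)
    (hdata : switching_data T psi g)
    (disp : measure_display) (Omega : measurableType disp)
    (P : probability Omega R)
    (B : R -> Omega -> 'rV[R]_d) (hB : brownian_motion P T B)
    (F : R -> set (set Omega)) (hF : F = completed_filtration P B)
    (X : R -> Omega -> 'rV[R]_k) (hX : progressive_continuous T F X)
    (hpsiX : forall i, M2 P T F (fun t w => psi i t (X t w)))
    (hgX : forall i j, S2 P T F (fun t w => g i j t (X t w)))
    (Y : 'I_m -> R -> Omega -> R)
    (hYS2 : forall i, S2 P T F (Y i))
    (hY : snell_system P T F psi g X Y)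
    (i1 : 'I_m) (hi1 : i1 = Ordinal (ltnW hm)) :
  {ae P, forall w, (Y i1 0 w)%:E =
    ereal_sup [set J | exists tau xi,
      strategy T F i1 tau xi /\ J = profit P T psi g X tau xi]}
  /\
  forall (tau' : nat -> Omega -> R) (xi' : nat -> Omega -> 'I_m),
    optimal_candidate T F i1 g X Y tau' xi' ->
    [/\ strategy T F i1 tau' xi',
        (\int[P]_w switching_cost T g X tau' xi' w < +oo)%E &
        forall tau xi, strategy T F i1 tau xi ->
          (profit P T psi g X tau xi <= profit P T psi g X tau' xi')%E]
    /\
    ((\int[P]_w reverse_switching_cost T g X tau' xi' w < +oo)%E \/
     (forall i j, exists c : R, forall t x, 0 <= t <= T -> g i j t x = c) ->
     P [set w | forall n, tau' n.+1 w < T] = 0%E).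
Proof.
have HF : filtration T F by rewrite hF; exact: completed_filtrationP.
have [U [sU U0 dom dom_g dom_var]] := switching_dominated hT hm HF hpsiX hgX hYS2.
have T00 : 0 <= (0 : R) <= T by rewrite lexx ltW.
set c := expect P setT (Y i1 0).
have Y0c : {ae P, forall w, Y i1 0 w = c}.
  have pY : progressive T F (Y i1) by case: (hYS2 i1).
  apply: (trivial_sigma_algebra_constant (filtration_sigma HF 0)).
  - by rewrite hF; exact: completed_filtration0 hT hB.
  - exact: progressive_adapted pY T00.
  - apply: summable_rv_le sU _; first exact: (progressive_measurable HF pY T00).
    by move=> w; case: (dom i1 0 w T00).
have upper tau xi : strategy T F i1 tau xi -> (profit P T psi g X tau xi <= c%:E)%E.
  move=> st.
  exact: (profit_le hT HF hdata hpsiX hgX hYS2 hY sU U0 dom dom_g dom_var st).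
have optimal tau xi : optimal_candidate T F i1 g X Y tau xi ->
    (\int[P]_w switching_cost T g X tau xi w < +oo)%E /\
    profit P T psi g X tau xi = c%:E.
  move=> cand; have st := candidate_strategy hT hm HF hgX hYS2 cand.
  apply: (optimal_value hT HF hdata hpsiX hgX hYS2 hY sU U0 dom dom_g dom_var st).
  exact: (candidate_value hT HF hgX hYS2 cand hdata hpsiX hY sU U0 dom dom_g dom_var).
split.
  apply: filterS Y0c => w ->; apply/eqP; rewrite eq_le; apply/andP; split.
    have [tau [xi cand]] := candidate_exists i1 hT hm HF hgX hYS2.
    apply: ereal_sup_ubound; exists tau, xi; split.
      exact: (candidate_strategy hT hm HF hgX hYS2 cand).
    by have [_ ->] := optimal _ _ cand.
  by apply: ub_ereal_sup => _ [tau [xi [st ->]]]; exact: upper.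
move=> tau xi cand; have [cfin Jc] := optimal _ _ cand.
have st := candidate_strategy hT hm HF hgX hYS2 cand.
split; first by split => // tau' xi' st'; rewrite Jc; exact: upper.
move=> _.
have mtau n : measurable_fun setT (tau n).
  exact: (stopping_measurable HF (strategy_stopping st n)).
apply/negligibleP.
  rewrite (_ : [set w | _] = \bigcap_n [set w | tau n.+1 w < T]).
    apply: bigcapT_measurable => n; rewrite -[X in measurable X]setTI.
    exact: measurable_fun_ltr.
  by apply/seteqP; split=> w /= h n; [move=> _|]; exact: h.
apply: negligibleS (ae_finite_switches hT HF hdata hgX st cfin) => w /= h [n nT].
case: n nT => [|n] nT; last by have := h n; rewrite nT ltxx.
by move: hT; rewrite -nT (strategy_tau0 st) ltxx.
Qed.
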